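(* Let $(X,G)$ be a dynamical system, $(B_n)$ a F\o lner sequence on $G$ and $p\in X$ a Besicovitch almost periodic point (with respect to $(B_n)$). Then there exists a (unique) ergodic $G$-invariant probability measure $m$ on $X$ such that $p$ is generic with respect to $m$. The dynamical system $(X,G,m)$ has pure point spectrum and $\mathrm{Eig}(X,G,m)=\mathrm{Freq}(p)$ holds. To each eigenvalue $\xi\in\mathrm{Eig}(X,G,m)$ there exists a (unique) eigenfunction $e_\xi\in L^2(X,m)$ with $$\int_X f\,\overline{e_\xi}\,\mathrm{d}m=\mathrm{A}(f_p\,\overline{\xi})\qquad\text{for all } f\in C(X).$$
   Context: $G$ is a locally compact, $\sigma$-compact abelian group, written additively, with a fixed Haar measure; $|A|$ denotes the Haar measure of $A\subset G$. $\widehat{G}$ is the dual group, i.e. the set of continuous group homomorphisms $\xi:G\to\mathbb{T}=\{z\in\mathbb{C}:|z|=1\}$. A dynamical system $(X,G)$ is a compact metrizable space $X$ with a continuous action $G\times X\to X$, $(t,x)\mapsto tx$; $(X,G,m)$ denotes such a system with a $G$-invariant Borel probability measure $m$. $C(X)$ is the set of continuous complex-valued functions on $X$; for $f\in C(X)$, $x\in X$, $f_x:G\to\mathbb{C}$ is $f_x(t)=f(tx)$, and $\mathcal{A}_x=\{f_x:f\in C(X)\}$. A F\o lner sequence $(B_n)$ is a sequence of (nonempty) open relatively compact subsets of $G$ with $\frac{|(B_n\setminus(t+B_n))\cup((t+B_n)\setminus B_n)|}{|B_n|}\to 0$ for all $t\in G$. For bounded measurable $h:G\to\mathbb{R}$,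 $\overline{M}(h)=\limsup_{n}\frac{1}{|B_n|}\int_{B_n}h(s)\,\mathrm{d}s$; for bounded measurable $h:G\to\mathbb{C}$, $\mathrm{A}(h)=\lim_{n}\frac{1}{|B_n|}\int_{B_n}h(t)\,\mathrm{d}t$ whenever the limit exists. A bounded measurable $h:G\to\mathbb{C}$ is Besicovitch almost periodic if for every $\varepsilon>0$ there are $k\in\mathbb{N}$, $\xi_1,\dots,\xi_k\in\widehat{G}$, $c_1,\dots,c_k\in\mathbb{C}$ with $\overline{M}(|h-\sum_{j=1}^k c_j\xi_j|)<\varepsilon$. A point $x\in X$ is Besicovitch almost periodic (with respect to $(B_n)$) if every element of $\mathcal{A}_x$ is Besicovitch almost periodic. For such $x$ the averages $\mathrm{A}(f_x\overline{\xi})$ exist for all $f\in C(X)$, $\xi\in\widehat{G}$, and $\mathrm{Freq}(x)$ is the set of all $\xi\in\widehat{G}$ with $\mathrm{A}(f_x\overline{\xi})\neq 0$ for some $f\in C(X)$. A point $y$ is generic with respect to $m$ (and $(B_n)$) if $\mathrm{A}(f_y)=\int_X f\,\mathrm{d}m$ for all $f\in C(X)$. An eigenfunction is $f\in L^2(X,m)$, $f\ne0$, such that for each $t\in G$ there is $\xi(t)\in\mathbb{C}$ with $f(t\,\cdot)=\xi(t)f$ in $L^2(X,m)$; then $\xi\in\widehat{G}$ and $\xi$ is called an eigenvalue. $\mathrm{Eig}(X,G,m)$ is the set of eigenvalues. $(X,G,m)$ has pure point spectrum if $L^2(X,m)$ has an orthonormal basis of eigenfunctions. *)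

(* Defs.v *)
From HB Require Import structures.
From mathcomp Require Import all_boot all_order all_algebra.
From mathcomp Require Import complex.
From mathcomp Require Import all_classical all_reals all_analysis.

Set Implicit Arguments.
Unset Strict Implicit.
Unset Printing Implicit Defensive.

Import Order.TTheory GRing.Theory Num.Theory.
Import numFieldNormedType.Exports.

Local Open Scope classical_set_scope.
Local Open Scope ring_scope.

(* Measurable types are pointed, topological groups are not: pointed_group G is
   G with the distinguished point 0. *)
Definition pointed_group (G : topologicalZmodType) : Type := G.
HB.instance Definition _ (G : topologicalZmodType) :=
  TopologicalZmodule.on (pointed_group G).
HB.instance Definition _ (G : topologicalZmodType) :=
  isPointed.Build (pointed_group G) 0.

Notation borel T := (g_sigma_algebraType (@open T)).
Notation borel_group G := (borel (pointed_group G)).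

Definition sigma_compact (T : topologicalType) :=
  exists K : nat -> set T, (forall n, compact (K n)) /\ \bigcup_n K n = setT.

Definition metrizable (R : realType) (T : topologicalType) :=
  exists d : T -> T -> R,
    [/\ forall x y, 0 <= d x y,
        forall x y, d x y = 0 <-> x = y,
        forall x y, d x y = d y x,
        forall x y z, d x z <= d x y + d y z &
        forall x, nbhs x =
          filter_from [set e : R | 0 < e] (fun e => [set y | d x y < e])].

(** Complex-valued functions. The topology on R[i] is that of R[i]^o. *)

Definition cmodulus (R : realType) (z : R[i]) : R := ComplexField.Normc.normc z.

Definition ccontinuous (R : realType) (T : topologicalType) (f : T -> R[i]) :=
  continuous (f : T -> R[i]^o).

Definition cmeasurable (R : realType) d (T : measurableType d) (f : T -> R[i]) :=
  measurable_fun setT (fun x => complex.Re (f x)) /\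
  measurable_fun setT (fun x => complex.Im (f x)).

Definition cintegral (R : realType) d (T : measurableType d)
    (mu : {measure set T -> \bar R}) (D : set T) (f : T -> R[i]) : R[i] :=
  Complex (\int[mu]_(x in D) complex.Re (f x)) (\int[mu]_(x in D) complex.Im (f x)).

Definition bounded_measurable (R : realType) d (T : measurableType d)
    (f : T -> R[i]) :=
  cmeasurable f /\ exists M : R, forall x, cmodulus (f x) <= M.

(** Elements of L^2 are represented by square-integrable functions; equality in
    L^2 is equality almost everywhere. *)

Definition L2 (R : realType) d (T : measurableType d)
    (m : {measure set T -> \bar R}) (f : T -> R[i]) :=
  cmeasurable f /\ (\int[m]_x (cmodulus (f x) ^+ 2)%:E < +oo)%E.

Definition inner (R : realType) d (T : measurableType d)
    (m : {measure set T -> \bar R}) (f g : T -> R[i]) : R[i] :=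
  cintegral m setT (fun x => f x * (g x)^*%C).

Definition orthonormal_basis (R : realType) d (T : measurableType d)
    (m : {measure set T -> \bar R}) (E : set (T -> R[i])) :=
  [/\ E `<=` L2 m,
      forall e, E e -> inner m e e = 1,
      forall e e', E e -> E e' -> e <> e' -> inner m e e' = 0 &
      forall f, L2 m f -> forall eps : R, 0 < eps ->
        exists (k : nat) (e : 'I_k -> T -> R[i]) (c : 'I_k -> R[i]),
          (forall j, E (e j)) /\
          (\int[m]_x (cmodulus (f x - \sum_(j < k) c j * e j x)%R ^+ 2)%:E
            < (eps ^+ 2)%:E)%E].

Section Group.
Variables (R : realType) (G : topologicalZmodType).

(** Nonzero translation-invariant Radon measure. *)
Definition haar (mu : {measure set (borel_group G) -> \bar R}) :=
  [/\ mu setT <> 0%E,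
      forall (t : G) (A : set (borel_group G)), measurable A ->
        mu [set t + s | s in A] = mu A,
      forall K : set G, compact K -> (mu K < +oo)%E,
      forall A : set (borel_group G), measurable A ->
        mu A = ereal_inf [set mu U | U in [set U : set G | open U /\ A `<=` U]] &
      forall U : set G, open U ->
        mu U = ereal_sup [set mu K | K in [set K : set G | compact K /\ K `<=` U]]].

Definition dual : set (G -> R[i]) :=
  [set xi | [/\ ccontinuous xi,
                forall t, cmodulus (xi t) = 1 &
                forall s t, xi (s + t) = xi s * xi t]].

Variable mu : {measure set (borel_group G) -> \bar R}.

Definition folner (B : nat -> set G) :=
  (forall n, [/\ B n !=set0, open (B n) & precompact (B n)]) /\
  (forall t : G,
    (fun n => fine (mu ((B n `\` [set t + s | s in B n]) `|`
                        ([set t + s | s in B n] `\` B n)))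
              / fine (mu (B n))) @ \oo --> (0 : R)).

Variable B : nat -> set G.

Definition upper_mean (h : G -> R) : \bar R :=
  limn_esup (fun n => ((fine (mu (B n)))^-1 * \int[mu]_(s in B n) h s)%:E).

(** [has_mean h a]: the limit A(h) exists and equals a. *)
Definition has_mean (h : G -> R[i]) (a : R[i]) :=
  (fun n => (real_complex R (fine (mu (B n))))^-1 * cintegral mu (B n) h : R[i]^o)
    @ \oo --> (a : R[i]^o).

Definition besicovitch (h : G -> R[i]) :=
  bounded_measurable (h : borel_group G -> R[i]) /\
  forall eps : R, 0 < eps ->
    exists (k : nat) (xi : 'I_k -> G -> R[i]) (c : 'I_k -> R[i]),
      (forall j, dual (xi j)) /\
      (upper_mean (fun t => cmodulus (h t - \sum_(j < k) c j * xi j t)%R) < eps%:E)%E.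

End Group.

Section DynamicalSystem.
Variables (R : realType) (G : topologicalZmodType) (X : ptopologicalType).
Variable act : G -> X -> X.

Definition dynamical_system :=
  [/\ compact [set: X], metrizable R X,
      forall x, act 0 x = x,
      forall s t x, act (s + t) x = act s (act t x) &
      continuous (fun tx : G * X => act tx.1 tx.2)].

Definition besicovitch_point (mu : {measure set (borel_group G) -> \bar R})
    (B : nat -> set G) (x : X) :=
  forall f : X -> R[i], ccontinuous f -> besicovitch mu B (fun t => f (act t x)).

Definition Freq (mu : {measure set (borel_group G) -> \bar R}) (B : nat -> set G)
    (x : X) : set (G -> R[i]) :=
  [set xi | dual xi /\
    exists (f : X -> R[i]) (a : R[i]),
      [/\ ccontinuous f, has_mean mu B (fun t => f (act t x) * (xi t)^*%C) a
        & a <> 0]].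

Variable m : probability (borel X) R.

Definition invariant_measure :=
  forall (t : G) (A : set (borel X)), measurable A -> m (act t @^-1` A) = m A.

Definition ergodic :=
  forall A : set (borel X), measurable A ->
    (forall t : G, m ((act t @^-1` A `\` A) `|` (A `\` act t @^-1` A)) = 0%E) ->
    m A = 0%E \/ m A = 1%E.

Definition generic (mu : {measure set (borel_group G) -> \bar R}) (B : nat -> set G)
    (y : X) :=
  forall f : X -> R[i], ccontinuous f ->
    has_mean mu B (fun t => f (act t y)) (cintegral m setT f).

Definition eigenfunction_for (xi : G -> R[i]) (f : borel X -> R[i]) :=
  [/\ L2 m f, ~ {ae m, forall x, f x = 0} &
      forall t, {ae m, forall x, f (act t x) = xi t * f x}].

Definition eigenfunction (f : borel X -> R[i]) :=
  exists xi : G -> R[i], eigenfunction_for xi f.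

Definition Eig : set (G -> R[i]) :=
  [set xi | exists f, eigenfunction_for xi f].

Definition pure_point_spectrum :=
  exists E : set (borel X -> R[i]),
    orthonormal_basis m E /\ E `<=` eigenfunction.

End DynamicalSystem.

(* Main.v *)
(* The averages of f(tp) w(t) along the Foelner sequence exist for f continuous and
   w a trigonometric polynomial. When w >= 0 they form a positive functional on
   C(X), hence a measure by Riesz; w = 1 gives m. Invariance and genericity are
   immediate. For a real trigonometric polynomial u with |u| <= 1, the measures
   attached to 1 + u and 1 - u sum to 2m, so f |-> A(f_p u) has a bounded density
   with respect to m; applied to the real and imaginary parts of a character xi this
   yields e_xi with <f, e_xi> = A(f_p conj(xi)). The e_xi are eigenfunctions, orthogonal
   for distinct characters.
   A bounded Besicovitch almost periodic function is approximated by trigonometric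
   polynomials in quadratic mean as well, by truncation at its sup norm. Replacing
   each character of such an approximation of f_p by the corresponding e_xi gives an
   element of L^2(m) whose distance to f is at most the quadratic mean error, by
   testing against C(X). Hence the e_xi span L^2(m); the same comparison forces
   |e_xi| = 1 in L^2 when xi is a frequency, and e_xi = 0 otherwise. Pure point
   spectrum, Eig = Freq and, e_1 being constant, ergodicity follow. *)
Require Import Defs.
From HB Require Import structures.
From mathcomp Require Import all_boot all_order all_algebra.
From mathcomp Require Import complex.
From mathcomp Require Import all_classical all_reals all_analysis.
From mathcomp Require Import measurable_realfun.
From mathcomp Require Import ring lra.

Set Implicit Arguments.
Unset Strict Implicit.
Unset Printing Implicit Defensive.

Import Order.TTheory GRing.Theory Num.Theory.
Import numFieldNormedType.Exports.

Local Open Scope classical_set_scope.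
Local Open Scope ring_scope.

(** The obstacle is that the [e xi] are known only through averages along one orbit: they are
    measurable, not continuous, so genericity gives no information about their products. Every fact
    about them is read off from inner products with C(X); this is why density of C(X) in L^2 comes
    early and why almost everywhere identities go through [orthogonal_continuous_eq0]. In particular
    neither the norm of [e xi] nor that of f - q is directly a mean along the orbit. The latter is
    bounded by duality: 2 Re <u,g> - |g|^2 is such a mean when g is continuous, and it comes close
    to |u|^2 when g is close to u = f - q. The former is carried along as an unknown k, until a (1 -
    k) = 0 is obtained for a nonzero Fourier coefficient a. Truncation enters because almost
    periodicity is given in the L^1 mean while L^2 needs the quadratic mean. A truncated
    trigonometric polynomial is no longer one, so the truncation is written with absolute values,
    and these are approximated uniformly by polynomials in the function. *)

Section Auxiliary.
Context (R : realType) d (T : measurableType d).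
Variable mu : {measure set T -> \bar R}.

Lemma bounded_integrable (D : set T) (f : T -> R) (M : R) : measurable D ->
  (mu D < +oo)%E -> measurable_fun D f -> (forall x, D x -> `|f x| <= M) ->
  mu.-integrable D (EFin \o f).
Proof.
move=> mD muD mf fM; apply: measurable_bounded_integrable => //.
exists M; split; rewrite ?num_real// => y My x Dx /=.
exact: le_trans (fM x Dx) (ltW My).
Qed.

Definition image_measure d' (T' : measurableType d') (f : T -> T')
    (mf : measurable_fun setT f) : {measure set T' -> \bar R} :=
  measure_function_pushforward__canonical__measure_function_Measure mu mf.

End Auxiliary.

Section BorelMeasurability.
Variables (R : realType) (T : ptopologicalType).

Lemma open_borel (U : set T) : open U -> measurable (U : set (borel T)).
Proof. exact: sub_sigma_algebra. Qed.

Lemma borel_measurable_fun d (S : measurableType d) (f : S -> borel T) :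
  (forall U : set T, open U -> measurable (f @^-1` U)) ->
  measurable_fun setT f.
Proof.
move=> fU; apply: (measurability _ (erefl (@measurable _ (borel T)))).
by move=> _ [U oU <-]; rewrite setTI; exact: fU.
Qed.

Lemma continuous_borel_measurable (f : T -> R) : continuous f ->
  measurable_fun setT (f : borel T -> R).
Proof.
move=> /continuousP fc; apply: (measurability _ (measurable_realfun.RGenOInfty.measurableE R)).
move=> _ [_ [a ->] <-]; rewrite setTI; apply: open_borel; apply: fc.
exact: rray_open.
Qed.

End BorelMeasurability.

(** * The Riesz representation theorem on compact metrizable spaces *)

Section OpenExhaustion.
Variables (R : realType) (X : topologicalType).

(** Take g_n = min(1, n h), with h the distance to the complement of U. The value 1 is attained, not
    just approached, so that U is the union of the sets where g_n = 1. This is the only access to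
    the metric: measurability of open sets, uniqueness of measures and L^2 density all use it. *)
Lemma metrizable_open_exhaustion (U : set X) : metrizable R X -> open U ->
  exists g : nat -> X -> R,
    [/\ forall n, continuous (g n),
        forall n x, 0 <= g n x <= 1,
        forall m n x, (m <= n)%N -> g m x <= g n x,
        forall n x, ~ U x -> g n x = 0 &
        forall x, U x -> exists n, g n x = 1].
Proof.
move=> [d [d0 deq dC dtri dnbhs]] oU.
(* When U is the whole space, the infimum defining the distance to the complement would run over the
   empty set. *)
have [U0|/set0P[y0 Uy0]] := eqVneq (~` U) set0.
  exists (fun _ _ => 1); split => //.
  - by move=> n; exact: cst_continuous.
  - by move=> n x; rewrite lexx ler01.
  - by move=> n x Ux; have : (~` U) x by []; rewrite U0.
  - by move=> x Ux; exists 0%N.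
pose h x := inf [set d x y | y in ~` U].
have hlb x y : ~ U y -> h x <= d x y.
  move=> Uy; apply: ge_inf; last by exists y.
  by exists 0 => _ [z _ <-].
have hge x e : (forall y, ~ U y -> e <= d x y) -> e <= h x.
  move=> He; apply: lb_le_inf; first by exists (d x y0), y0.
  by move=> _ [z Uz <-]; exact: He.
have h0 x : 0 <= h x by apply: hge.
have hlip x z : h z <= h x + d x z.
  rewrite -lerBlDr; apply: hge => y Uy; rewrite lerBlDr.
  apply: le_trans (hlb z y Uy) _.
  by rewrite addrC (dC x z).
have hc : continuous h.
  move=> x; apply/cvgrPdist_lt => e e0.
  have : nbhs x [set y | d x y < e] by rewrite dnbhs; exists e.
  apply: filterS => z /= xz.
  rewrite ltr_norml; apply/andP; split.
    by have := hlip x z; lra.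
  by have := hlip z x; rewrite dC; lra.
have hpos x : U x -> 0 < h x.
  move=> Ux; have : nbhs x U by apply: open_nbhs_nbhs.
  rewrite dnbhs => -[e /= e0 He]; apply: (lt_le_trans e0).
  apply: hge => y Uy; rewrite leNgt; apply/negP => xy; exact/Uy/He.
exists (fun n x => Num.min 1 (n%:R * h x)); split.
- move=> n x; apply: (@continuous_min R X (cst 1) (fun x => n%:R * h x)).
    exact: cst_continuous.
  by apply: cvgM; [exact: cvg_cst|exact: hc].
- move=> n x; rewrite ge_min lexx/= le_min ler01/=.
  by rewrite mulr_ge0.
- move=> m n x mn; rewrite le_min ge_min lexx/= ge_min; apply/orP; right.
  by rewrite ler_wpM2r// ler_nat.
- move=> n x Ux; have -> : h x = 0.
    apply/eqP; rewrite eq_le h0 andbT; apply: le_trans (hlb x x Ux) _.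
    by have /deq -> : x = x by [].
  by rewrite mulr0; apply/min_idPr.
- move=> x /hpos hx; exists (Num.truncn (h x)^-1).+1.
  apply/min_idPl; rewrite -ler_pdivrMr// div1r ltW//.
  exact: truncnS_gt.
Qed.

End OpenExhaustion.

Section Riesz.
Variables (R : realType) (X : ptopologicalType).

(** L is total on functions so that a limit operator can be plugged in as it is; its laws are
    required on continuous functions only. *)
Definition positive_functional (L : (X -> R) -> R) :=
  [/\ forall f g : X -> R, continuous f -> continuous g ->
        L (fun x => f x + g x) = L f + L g,
      forall (a : R) (f : X -> R), continuous f -> L (fun x => a * f x) = a * L f &
      forall f : X -> R, continuous f -> (forall x, 0 <= f x) -> 0 <= L f].

Lemma continuous_fun0 : continuous (fun _ : X => 0 : R).
Proof. exact: cst_continuous. Qed.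

Lemma continuous_funD (f g : X -> R) : continuous f -> continuous g ->
  continuous (fun x => f x + g x).
Proof. by move=> fc gc x; apply: cvgD; [exact: fc|exact: gc]. Qed.

Lemma continuous_funB (f g : X -> R) : continuous f -> continuous g ->
  continuous (fun x => f x - g x).
Proof. by move=> fc gc x; apply: cvgB; [exact: fc|exact: gc]. Qed.

Lemma continuous_funM (f g : X -> R) : continuous f -> continuous g ->
  continuous (fun x => f x * g x).
Proof. by move=> fc gc x; apply: cvgM; [exact: fc|exact: gc]. Qed.

Lemma continuous_fun_min (f g : X -> R) : continuous f -> continuous g ->
  continuous (fun x => Num.min (f x) (g x)).
Proof.
by move=> fc gc x; apply: (@continuous_min R X f g); [exact: fc|exact: gc].
Qed.

Lemma continuous_fun_sum (I : Type) (s : seq I) (f : I -> X -> R) :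
  (forall i, continuous (f i)) -> continuous (fun x => \sum_(i <- s) f i x).
Proof.
move=> fc; elim: s => [|i s IH].
  by under eq_fun do rewrite big_nil; exact: cst_continuous.
by under eq_fun do rewrite big_cons; apply: continuous_funD.
Qed.

Lemma continuous_fun_bounded (f : X -> R) : compact [set: X] ->
  continuous f -> exists M, forall x, `|f x| <= M.
Proof.
move=> cX fc; have : compact (f @` setT).
  by apply: continuous_compact => //; exact: continuous_subspaceT.
move=> /compact_bounded[M [_ HM]]; exists (`|M| + 1) => x.
by apply: (HM (`|M| + 1)) => //; rewrite ltr_pwDr// ler_norm.
Qed.

Variable L : (X -> R) -> R.
Hypothesis posL : positive_functional L.

Lemma positive_functional0 : L (fun=> 0) = 0.
Proof.
have [_ LZ _] := posL.
have /= := LZ 0 _ continuous_fun0.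
by rewrite !mul0r.
Qed.

Lemma positive_functionalB (f g : X -> R) : continuous f -> continuous g ->
  L (fun x => f x - g x) = L f - L g.
Proof.
have [LD LZ _] := posL => fc gc.
transitivity (L (fun x => f x + -1 * g x)).
  by congr L; apply/funext => x; rewrite mulN1r.
rewrite LD//; first by rewrite LZ// mulN1r.
by apply: continuous_funM => //; exact: cst_continuous.
Qed.

Lemma le_positive_functional (f g : X -> R) : continuous f -> continuous g ->
  (forall x, f x <= g x) -> L f <= L g.
Proof.
have [_ _ L0] := posL => fc gc fg.
rewrite -subr_ge0 -positive_functionalB//; apply: L0.
  exact: continuous_funB.
by move=> x; rewrite subr_ge0.
Qed.

Lemma positive_functional_sum (I : Type) (s : seq I) (f : I -> X -> R) :
  (forall i, continuous (f i)) ->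
  L (fun x => \sum_(i <- s) f i x) = \sum_(i <- s) L (f i).
Proof.
have [LD _ _] := posL => fc; elim: s => [|i s IH].
  by under eq_fun do rewrite big_nil; rewrite big_nil positive_functional0.
by under eq_fun do rewrite big_cons; rewrite big_cons -IH -LD//;
  exact: continuous_fun_sum.
Qed.

(* Increasing sequences, rather than series, of continuous functions make
   countable subadditivity a diagonal argument without double series. *)
Definition riesz_cover (A : set X) (c : R) :=
  exists u : nat -> X -> R,
    [/\ forall n, continuous (u n), forall n x, 0 <= u n x,
        forall m n x, (m <= n)%N -> u m x <= u n x,
        forall n, L (u n) <= c &
        forall x, A x -> exists n, 1 <= u n x].

(** Daniell's upper integral of the indicator of A: an increasing sequence stands for its lower
    semicontinuous supremum, and c bounds the integral of that supremum. *)
Definition riesz_outer (A : set X) : \bar R :=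
  ereal_inf [set c%:E | c in riesz_cover A].

Lemma riesz_cover_ge0 A c : riesz_cover A c -> 0 <= c.
Proof.
have [_ _ L0] := posL.
by move=> [u [uc u0 _ uL _]]; apply: le_trans (uL 0%N); exact: L0.
Qed.

Lemma riesz_outer_le A c : riesz_cover A c -> (riesz_outer A <= c%:E)%E.
Proof. by move=> Ac; apply: ereal_inf_lbound; exists c. Qed.

Lemma riesz_outer_ge0 A : (0 <= riesz_outer A)%E.
Proof.
by apply: le_ereal_inf_tmp => _ [c /riesz_cover_ge0 c0 <-]; rewrite lee_fin.
Qed.

Lemma riesz_outer0 : riesz_outer set0 = 0%E.
Proof.
apply/eqP; rewrite eq_le riesz_outer_ge0 andbT; apply: riesz_outer_le.
exists (fun _ _ => 0); split => // [n|n]; first exact: cst_continuous.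
by rewrite positive_functional0.
Qed.

Lemma riesz_coverT : riesz_cover setT (L (fun=> 1)).
Proof.
exists (fun _ _ => 1); split => //; first by move=> n; exact: cst_continuous.
by move=> x _; exists 0%N.
Qed.

Lemma le_riesz_outer : {homo riesz_outer : A B / A `<=` B >-> (A <= B)%E}.
Proof.
move=> A B AB; apply: ereal_inf_le_tmp => _ [c [u [uc u0 und uL uB]] <-].
by exists c => //; exists u; split => // x /AB; exact: uB.
Qed.

Lemma riesz_outer_fin A : riesz_outer A \is a fin_num.
Proof.
rewrite ge0_fin_numE ?riesz_outer_ge0//.
apply: le_lt_trans (le_riesz_outer (@subsetT _ A)) _.
by apply: le_lt_trans (riesz_outer_le riesz_coverT) _; rewrite ltry.
Qed.

Lemma riesz_outer_approx A (e : R) : (0 < e)%R ->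
  exists2 c, riesz_cover A c & (c%:E < riesz_outer A + e%:E)%E.
Proof.
move=> e0; have [_ [c Ac <-] h] := lb_ereal_inf_adherent e0 (riesz_outer_fin A).
by exists c.
Qed.

Lemma riesz_outer_sigma_subadditive : sigma_subadditive riesz_outer.
Proof.
move=> F; apply/lee_addgt0Pr => e e0.
have /choice[c cP] : forall i, exists c, riesz_cover (F i) c /\
    (c%:E <= riesz_outer (F i) + (e / (2 ^ i.+1)%:R)%:E)%E.
  move=> i; have [|c Fc /ltW ce] := @riesz_outer_approx (F i) (e / (2 ^ i.+1)%:R).
    by rewrite divr_gt0// ltr0n expn_gt0.
  by exists c.
have /choice[u uP] := fun i => (cP i).1.
apply: (@le_trans _ _ (\sum_(i <oo) (c i)%:E)%E); last first.
  apply: le_trans (epsilon_trick xpredT _ (ltW e0)); last first.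
    by move=> n; exact: riesz_outer_ge0.
  apply: lee_nneseries => [i _ _|i _]; last exact: (cP i).2.
  by rewrite lee_fin; exact: riesz_cover_ge0 (cP i).1.
have [lty|] := ltP (\sum_(i <oo) (c i)%:E)%E +oo%E; last first.
  by rewrite leye_eq => /eqP ->; rewrite leey.
have c0 i : (0 <= (c i)%:E)%E.
  by rewrite lee_fin; exact: riesz_cover_ge0 (cP i).1.
have lfin : (\sum_(i <oo) (c i)%:E)%E \is a fin_num.
  by rewrite ge0_fin_numE// nneseries_ge0.
rewrite -(fineK lfin); apply: riesz_outer_le.
exists (fun n x => \sum_(0 <= i < n) u i n x); split.
- by move=> n; apply: continuous_fun_sum => i; have [] := uP i.
- by move=> n x; apply: sumr_ge0 => i _; have [] := uP i.
- move=> m n x mn; rewrite (@big_cat_nat _ _ _ m 0%N n)//=.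
  rewrite ler_wpDr//; first by apply: sumr_ge0 => i _; have [] := uP i.
  by apply: ler_sum => i _; have [_ _ + _ _] := uP i; exact.
- move=> n; rewrite positive_functional_sum; last by move=> i; have [] := uP i.
  rewrite -lee_fin fineK//; apply: le_trans (nneseries_lim_ge n _) => //.
  rewrite -sumEFin; apply: lee_sum => i _; rewrite lee_fin.
  by have [_ _ _ + _] := uP i; exact.
- move=> x [i _ Fix]; have [_ u0 und _ /(_ x Fix)[k uk]] := uP i.
  (* The i-th cover enters the diagonal sum only from index i + 1 on; from index k on it is at least
     1 at x. *)
  exists (maxn k i.+1); apply: le_trans uk _.
  rewrite (@big_cat_nat _ _ _ i 0%N)//=; last by rewrite (leq_trans (leqnSn i))// leq_maxr.
  rewrite ler_wpDl//; first by apply: sumr_ge0 => j _; have [] := uP j.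
  rewrite big_ltn ?leq_maxr// ler_wpDr//.
    by apply: sumr_ge0 => j _; have [] := uP j.
  by apply: und; rewrite leq_maxl.
Qed.

HB.instance Definition _ := isOuterMeasure.Build R X riesz_outer
  riesz_outer0 riesz_outer_ge0 le_riesz_outer riesz_outer_sigma_subadditive.

(** A cover u_n of A splits along U: u_n g_n covers the part inside U, and u_n (1 - g_j), with j
    fixed, covers the part outside, where g_j vanishes. If j is chosen so that L(u_j g_j) is within
    e/2 of the supremum S of the L(u_n g_n), the two costs S and c - S + e/2 add up to c + e/2. *)
Lemma riesz_outer_open_caratheodory (U : set X) : metrizable R X -> open U ->
  riesz_outer.-caratheodory U.
Proof.
move=> mX oU.
have [g [gc g01 gnd gU0 gU1]] := metrizable_open_exhaustion mX oU.
apply: le_caratheodory_measurable => A.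
apply/lee_addgt0Pr => e e0.
have e2 : 0 < e / 2 by rewrite divr_gt0.
have [c [u [uc u0 und uL uA]] cA] := riesz_outer_approx A e2.
have g0 n x : 0 <= g n x by have /andP[] := g01 n x.
have g1 n x : g n x <= 1 by have /andP[] := g01 n x.
pose S := sup (range (fun n => L (fun x => u n x * g n x))).
have ugc m n : continuous (fun x => u m x * g n x) by apply: continuous_funM.
have hsup : has_sup (range (fun n => L (fun x => u n x * g n x))).
  split; first by exists (L (fun x => u 0%N x * g 0%N x)), 0%N.
  exists c => _ [n _ <-]; apply: le_trans (uL n).
  by apply: le_positive_functional => // x; rewrite ler_piMr.
have ubS n : L (fun x => u n x * g n x) <= S.
  by apply: ub_le_sup; [exact: hsup.2|exists n].
have [_ [j _ <-] Sj] := sup_adherent e2 hsup.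
have coverI : riesz_cover (A `&` U) S.
  exists (fun n x => u n x * g n x); split => //.
  - by move=> n x; rewrite mulr_ge0.
  - by move=> m n x mn; rewrite ler_pM// ?und ?gnd.
  - move=> x [Ax Ux]; have [m um] := uA x Ax; have [n gn] := gU1 x Ux.
    exists (maxn m n); have -> : g (maxn m n) x = 1.
      by apply/eqP; rewrite eq_le g1 -gn gnd// leq_maxr.
    by rewrite mulr1 (le_trans um)// und// leq_maxl.
have coverD : riesz_cover (A `&` ~` U) (c - S + e / 2).
  exists (fun n x => u n x - u n x * g j x); split => //.
  - by move=> n; apply: continuous_funB.
  - by move=> n x; rewrite subr_ge0 ler_piMr.
  - move=> m n x mn; rewrite -[X in X - _]mulr1 -[X in _ <= X - _]mulr1 -!mulrBr.
    by rewrite ler_wpM2r ?und// subr_ge0.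
  (* Passing to the index max(n, j) makes u g_j at least u_j g_j, whose value under L is nearly S,
     while L(u) stays below c. *)
  - move=> n; have : L (fun x => u n x - u n x * g j x) <=
        L (fun x => u (maxn n j) x - u (maxn n j) x * g j x).
      apply: le_positive_functional; [exact: continuous_funB..|move=> x].
      rewrite -[X in X - _]mulr1 -[X in _ <= X - _]mulr1 -!mulrBr.
      by rewrite ler_wpM2r ?und ?leq_maxl// subr_ge0.
    move=> /le_trans; apply; rewrite positive_functionalB//.
    have : L (fun x => u j x * g j x) <= L (fun x => u (maxn n j) x * g j x).
      by apply: le_positive_functional => // x; rewrite ler_wpM2r// und// leq_maxr.
    by have := uL (maxn n j); rewrite -/S in Sj; lra.
  - move=> x [Ax Ux]; have [m um] := uA x Ax.
    by exists m; rewrite gU0// mulr0 subr0.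
apply: le_trans (leeD (riesz_outer_le coverI) (riesz_outer_le coverD)) _.
rewrite -EFinD (_ : S + _ = c + e / 2); last by ring.
rewrite EFinD; apply: le_trans (leeD2r _ (ltW cA)) _.
by rewrite -addeA -EFinD -splitr.
Qed.
Let outer : {outer_measure set X -> \bar R} := riesz_outer.
Let C : measurableType _ := caratheodory_type outer.

(** Pushing forward along this identity restricts the Carathéodory measure to the Borel sets. *)
Lemma measurable_riesz_id : metrizable R X ->
  measurable_fun setT (id : C -> borel X).
Proof.
move=> mX; apply: borel_measurable_fun => U oU.
exact: riesz_outer_open_caratheodory.
Qed.

Definition riesz_measure (mX : metrizable R X) :
    {measure set (borel X) -> \bar R} :=
  image_measure (outer : {measure set C -> \bar R}) (measurable_riesz_id mX).

(* Dini: an increasing sequence reaching 1 everywhere is eventually above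
   1 - e uniformly. *)
Lemma riesz_outerT : compact [set: X] -> riesz_outer setT = (L (fun=> 1))%:E.
Proof.
have [_ LZ _] := posL.
move=> /compact_near_coveringP cX; apply/eqP; rewrite eq_le.
rewrite (riesz_outer_le riesz_coverT)/=.
apply: le_ereal_inf_tmp => _ [c [u [uc u0 und uL uT]] <-]; rewrite lee_fin.
have key e : 0 < e -> (1 - e) * L (fun=> 1) <= c.
  move=> e0.
  have : \forall n \near \oo, [set: X] `<=` (fun x => 1 - e < u n x).
    apply: cX => x _; have [k uk] := uT x I.
    have : nbhs x [set y | 1 - e < u k y].
      by apply: (cvgr_gt (u k x)); [exact: uc|lra].
    move=> nx; exists ([set y | 1 - e < u k y], [set n | (k <= n)%N]).
      by split => //; exact: nbhs_infty_ge.
    by move=> [y n] /= [uky kn]; apply: lt_le_trans uky (und _ _ _ kn).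
  move=> [n _ /(_ n (leqnn n)) un]; apply: le_trans (uL n).
  rewrite -LZ; last exact: cst_continuous.
  apply: le_positive_functional => //; first exact: cst_continuous.
  by move=> x; rewrite mulr1; apply/ltW/un.
have L1 : 0 <= L (fun=> 1) by exact: riesz_cover_ge0 riesz_coverT.
apply/ler_addgt0Pr => e e0; rewrite -lerBlDr.
(* The summand 1 keeps the denominator positive when [L (fun=> 1)] is 0. *)
have e1 : 0 < e / (1 + L (fun=> 1)) by rewrite divr_gt0// ltr_wpDr.
apply: le_trans (key _ e1); rewrite mulrBl mul1r lerB// -mulrAC -mulrA.
by rewrite ler_piMr ?(ltW e0)// ler_pdivrMr ?mul1r ?lerDr// ltr_wpDr.
Qed.

End Riesz.

Section FiniteBorelMeasure.
Variables (R : realType) (X : ptopologicalType).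
Variable nu : {measure set (borel X) -> \bar R}.
Hypothesis cX : compact [set: X].
Hypothesis nufin : (nu setT < +oo)%E.

Lemma continuous_integrable (f : X -> R) : continuous f ->
  nu.-integrable setT (EFin \o (f : borel X -> R)).
Proof.
move=> fc; have [M fM] := continuous_fun_bounded cX fc.
apply: (bounded_integrable (M := M)) => //.
exact: continuous_borel_measurable.
Qed.

Lemma Rintegral_positive_functional :
  positive_functional (fun f : X -> R => \int[nu]_x (f : borel X -> R) x).
Proof.
split.
- by move=> f g fc gc; rewrite RintegralD//; exact: continuous_integrable.
- by move=> a f fc; rewrite RintegralZl//; exact: continuous_integrable.
- by move=> f fc f0; apply: Rintegral_ge0.
Qed.

End FiniteBorelMeasure.

Section RieszTheorem.
Variables (R : realType) (X : ptopologicalType).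
Variable L : (X -> R) -> R.
Hypothesis posL : positive_functional L.
Hypothesis cX : compact [set: X].

(** Slice N f at integer heights into phi_k = min(N f, k+1) - min(N f, k). With A_k the set where N
    f >= k, phi_k lies between the indicators of A_(k+1) and A_k, so the integral of phi_k is at
    most nu(A_k), while nu(A_(k+1)) <= L(phi_k). The shift by one costs only nu(A_0), the total mass
    c; dividing by N makes the error c/N, which tends to 0. *)
Lemma layer_cake_le (nu : {measure set (borel X) -> \bar R}) :
  (nu setT < +oo)%E ->
  (forall (A : set (borel X)) (f : X -> R), continuous f ->
    (forall x, 0 <= f x) -> (forall x, A x -> 1 <= f x) ->
    (nu A <= (L f)%:E)%E) ->
  forall f : X -> R, continuous f -> (forall x, 0 <= f x) ->
    \int[nu]_x (f : borel X -> R) x <= L f.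
Proof.
move=> nufin nuL f fc f0; have [_ LZ _] := posL.
have posI := Rintegral_positive_functional cX nufin.
have [_ IZ _] := posI.
have [M fM] := continuous_fun_bounded cX fc.
pose c := fine (nu setT).
have c0 : 0 <= c by rewrite fine_ge0.
have key (N : nat) : N%:R * \int[nu]_x (f : borel X -> R) x <= c + N%:R * L f.
  have Nfc : continuous (fun x => N%:R * f x).
    by apply: continuous_funM => //; exact: cst_continuous.
  have Nf0 x : 0 <= N%:R * f x by rewrite mulr_ge0.
  pose J := (Num.truncn (N%:R * M)).+1.
  have fJ x : N%:R * f x <= J%:R.
    apply: ltW; apply: le_lt_trans (truncnS_gt _).
    by rewrite ler_wpM2l//; apply: le_trans (fM x); exact: ler_norm.
  pose phi k x := Num.min (N%:R * f x) k.+1%:R - Num.min (N%:R * f x) k%:R.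
  have phic k : continuous (phi k).
    by apply: continuous_funB; apply: continuous_fun_min => //; exact: cst_continuous.
  have sumphi : (fun x => \sum_(0 <= k < J) phi k x) = (fun x => N%:R * f x).
    apply/funext => x; rewrite telescope_sumr//.
    by rewrite (min_idPl (fJ x)) (min_idPr (Nf0 x)) subr0.
  have phi0 k x : 0 <= phi k x.
    rewrite subr_ge0 le_min !ge_min lexx/= (_ : k%:R <= k.+1%:R) ?orbT//.
    by rewrite ler_nat.
  rewrite -IZ// -LZ// -sumphi.
  rewrite (positive_functional_sum posI)// (positive_functional_sum posL)//.
  pose A k := [set x : borel X | k%:R <= N%:R * f x].
  have mA k : measurable (A k).
    have -> : A k = (fun x : borel X => N%:R * f x) @^-1` `[k%:R, +oo[%classic.
      by apply/seteqP; split => x /=; rewrite in_itv/= andbT.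
    rewrite -[X in measurable X]setTI.
    exact: (continuous_borel_measurable Nfc).
  have phiA k : \int[nu]_x (phi k : borel X -> R) x <= fine (nu (A k)).
    have intA : \int[nu]_x (\1_(A k) x : R) = fine (nu (A k)).
      by rewrite /Rintegral integral_indic// setIT.
    rewrite -intA; apply: le_Rintegral => //.
    - exact: continuous_integrable.
    - apply: (bounded_integrable (M := 1)) => // x _.
      by rewrite indicE normr_nat; case: (_ \in _).
    - move=> x _; rewrite indicE /phi; case: (boolP (x \in A k)) => /=.
        rewrite inE /A/= => kf; rewrite (min_idPr kf) lerBlDr ge_min.
        by rewrite [1 + _]addrC natr1 lexx orbT.
      rewrite notin_setE /A /= => /negP; rewrite -ltNge => kf.
      rewrite (min_idPl (ltW kf)) (min_idPl _) ?subrr//.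
      by apply: ltW; apply: lt_le_trans kf _; rewrite ler_nat.
  have Aphi k : fine (nu (A k.+1)) <= L (phi k).
    have : (nu (A k.+1) <= (L (phi k))%:E)%E.
      apply: nuL => //.
      move=> x; rewrite /A/= /phi => kf; rewrite (min_idPr kf).
      rewrite (min_idPr _) ?(le_trans _ kf) ?ler_nat//.
      by rewrite -natr1; lra.
    move=> h; rewrite -lee_fin fineK// ge0_fin_numE//.
    by apply: le_lt_trans h _; rewrite ltry.
  have Lphi k : 0 <= L (phi k) by have [_ _] := posL; apply.
  apply: (@le_trans _ _ (\sum_(0 <= k < J) fine (nu (A k)))).
    exact: ler_sum.
  rewrite big_nat_recl//= lerD//.
    by rewrite fine_le// ?ge0_fin_numE//; [apply: le_lt_trans nufin|];
      apply: le_measure; rewrite ?inE.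
  rewrite big_nat_recr//= ler_wpDr//.
  exact: ler_sum.
apply/ler_addgt0Pr => e e0.
pose N := (Num.truncn (c / e)).+1.
have N0 : 0 < N%:R :> R by rewrite ltr0n.
rewrite -(ler_pM2l N0); apply: le_trans (key N) _.
rewrite mulrDr addrC lerD2l -ler_pdivrMr//.
exact/ltW/truncnS_gt.
Qed.

(** The layer cake gives one inequality, for nonnegative functions. As the total mass is exactly
    L(1), applying it to f + M and to M - f, with M a bound of |f|, yields both inequalities for
    f. *)
Theorem riesz_representation : metrizable R X ->
  exists nu : {measure set (borel X) -> \bar R},
    (nu setT < +oo)%E /\
    forall f : X -> R, continuous f -> \int[nu]_x (f : borel X -> R) x = L f.
Proof.
move=> mX; have [LD LZ _] := posL.
pose nu := @riesz_measure _ _ _ posL mX.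
have nuT : nu setT = (L (fun=> 1))%:E by exact: riesz_outerT.
have nufin : (nu setT < +oo)%E by rewrite nuT ltry.
have fnuT : fine (nu setT) = L (fun=> 1) by rewrite nuT.
have nule : forall f : X -> R, continuous f -> (forall x, 0 <= f x) ->
    \int[nu]_x (f : borel X -> R) x <= L f.
  apply: layer_cake_le => // A f fc f0 Af.
  apply: riesz_outer_le; exists (fun=> f); split => //.
  by move=> x Ax; exists 0%N; exact: Af.
exists nu; split=> // f fc.
have [M fM] := continuous_fun_bounded cX fc.
have cM : continuous (fun _ : X => M) by exact: cst_continuous.
have posI := Rintegral_positive_functional cX nufin.
have LM : \int[nu]_x M = L (fun=> M).
  rewrite Rintegral_cst// fnuT -LZ; last exact: cst_continuous.
  by under eq_fun do rewrite mulr1.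
apply/eqP; rewrite eq_le; apply/andP; split.
  have := nule _ (continuous_funD fc cM).
  have [ID _ _] := posI.
  rewrite ID// LD// LM lerD2r; apply.
  by move=> x; have := fM x; rewrite ler_norml => /andP[]; lra.
have := nule _ (continuous_funB cM fc).
rewrite (positive_functionalB posI)// (positive_functionalB posL)// LM.
rewrite lerD2l lerN2; apply.
by move=> x; have := fM x; rewrite ler_norml => /andP[]; lra.
Qed.

End RieszTheorem.

(** * Borel measures and square-integrable functions *)

Section BorelUniqueness.
Variables (R : realType) (X : ptopologicalType).
Hypothesis cX : compact [set: X].
Hypothesis mX : metrizable R X.

(** With E_n the set where g_n = 1, nu1(E_n) is at most the integral of g_n, which is the same for
    nu1 and nu2 and is at most nu2(U). The E_n increase to U. *)
Lemma open_measure_le (nu1 nu2 : {measure set (borel X) -> \bar R}) :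
  (nu1 setT < +oo)%E -> (nu2 setT < +oo)%E ->
  (forall f : X -> R, continuous f ->
    \int[nu1]_x (f : borel X -> R) x = \int[nu2]_x (f : borel X -> R) x) ->
  forall U : set X, open U -> (nu1 U <= nu2 U)%E.
Proof.
move=> fin1 fin2 nu12 U oU.
have [g [gc g01 gnd gU0 gU1]] := metrizable_open_exhaustion mX oU.
pose E n : set (borel X) := [set x | g n x = 1].
have mE n : measurable (E n).
  have -> : E n = (g n : borel X -> R) @^-1` [set 1] by [].
  rewrite -[X in measurable X]setTI.
  exact: (continuous_borel_measurable (gc n)).
have mU : measurable (U : set (borel X)) by exact: open_borel.
have UE : U = \bigcup_n E n :> set (borel X).
  apply/seteqP; split => [x Ux|x [n _ gx]]; first by have [n gx] := gU1 x Ux; exists n.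
  by apply: contrapT => Ux; have := gU0 n x Ux; rewrite (gx : g n x = 1); lra.
have fin_sub (nu : {measure set (borel X) -> \bar R}) (A : set (borel X)) :
    measurable A -> (nu setT < +oo)%E -> nu A \is a fin_num.
  move=> mA finnu; rewrite ge0_fin_numE//.
  by apply: le_lt_trans finnu; apply: le_measure; rewrite ?inE.
have int_indic (nu : {measure set (borel X) -> \bar R}) (A : set (borel X)) :
    measurable A -> \int[nu]_x (\1_A x : R) = fine (nu A).
  by move=> mA; rewrite /Rintegral integral_indic// setIT.
have indic_int (nu : {measure set (borel X) -> \bar R}) (A : set (borel X)) :
    measurable A -> (nu setT < +oo)%E ->
    nu.-integrable setT (EFin \o (\1_A : borel X -> R)).
  move=> mA finnu; apply: (bounded_integrable (M := 1)) => // x _.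
  by rewrite indicE normr_nat; case: (_ \in _).
have EU n : (nu1 (E n) <= nu2 U)%E.
  rewrite -[leLHS]fineK ?fin_sub// -[leRHS]fineK ?fin_sub// lee_fin.
  apply: (@le_trans _ _ (\int[nu1]_x (g n : borel X -> R) x)).
    rewrite -int_indic//; apply: le_Rintegral => //.
    - exact: indic_int.
    - exact: continuous_integrable.
    - move=> x _; rewrite indicE; case: (boolP (x \in E n)) => [|_].
        by rewrite inE => ->.
      by have /andP[] := g01 n x.
  rewrite nu12// -int_indic//; apply: le_Rintegral => //.
  - exact: continuous_integrable.
  - exact: indic_int.
  - move=> x _; rewrite indicE; case: (boolP (x \in U)) => [_|].
      by have /andP[] := g01 n x.
    by rewrite notin_setE => /gU0 ->.
have ndE : nondecreasing_seq E.
  move=> a b ab; apply/subsetPset => x /= gx; apply/eqP.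
  by rewrite eq_le (andP (g01 b x)).2 -[X in X <= _]gx gnd.
have cv := nondecreasing_cvg_mu (mu := nu1) mE (bigcupT_measurable _ mE) ndE.
rewrite {1}UE -(cvg_lim _ cv)//; apply: lime_le.
  by apply/cvg_ex; eexists; exact: cv.
exact: nearW.
Qed.

Lemma borel_measure_unique (nu1 nu2 : {measure set (borel X) -> \bar R}) :
  (nu1 setT < +oo)%E -> (nu2 setT < +oo)%E ->
  (forall f : X -> R, continuous f ->
    \int[nu1]_x (f : borel X -> R) x = \int[nu2]_x (f : borel X -> R) x) ->
  forall A : set (borel X), measurable A -> nu1 A = nu2 A.
Proof.
move=> fin1 fin2 nu12 A mA.
apply: (@measure_unique _ _ (borel X) (@open X) (fun=> setT)) => //.
- by move=> U V oU oV; exact: openI.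
- by move=> _; exact: openT.
- by rewrite bigcup_const//; exists 0%N.
- move=> U oU; apply/eqP; rewrite eq_le !open_measure_le//.
  by move=> f fc; rewrite nu12.
Qed.

End BorelUniqueness.

Section SquareDistance.
Context (R : realType) d (T : measurableType d).
Variable m : {measure set T -> \bar R}.
Implicit Types f g h : T -> R.

Definition sqdist f g : \bar R := (\int[m]_x ((f x - g x) ^+ 2)%:E)%E.

Let msq f g : measurable_fun setT f -> measurable_fun setT g ->
  measurable_fun setT (EFin \o (fun x => (f x - g x) ^+ 2)).
Proof.
move=> mf mg; apply/measurable_EFinP.
by apply: measurable_funX; exact: measurable_funB.
Qed.

Lemma sqdist_ge0 f g : (0 <= sqdist f g)%E.
Proof. by apply: integral_ge0 => x _; rewrite lee_fin sqr_ge0. Qed.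

(** The factor 2 comes from (a + b)^2 <= 2 a^2 + 2 b^2, which avoids square roots of extended
    reals. *)
Lemma sqdist_triangle f g h : measurable_fun setT f -> measurable_fun setT g ->
  measurable_fun setT h ->
  (sqdist f h <= 2%:E * sqdist f g + 2%:E * sqdist g h)%E.
Proof.
move=> mf mg mh; rewrite /sqdist.
rewrite -!ge0_integralZl//; try exact: msq;
  try by move=> x _; rewrite lee_fin sqr_ge0.
rewrite -ge0_integralD//; last 4 first.
- by move=> x _; rewrite -EFinM lee_fin mulr_ge0// sqr_ge0.
- by apply: emeasurable_funM => //; exact: msq.
- by move=> x _; rewrite -EFinM lee_fin mulr_ge0// sqr_ge0.
- by apply: emeasurable_funM => //; exact: msq.
apply: ge0_le_integral => //.
- by move=> x _; rewrite lee_fin sqr_ge0.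
- exact: msq.
- by apply: emeasurable_funD; apply: emeasurable_funM => //; exact: msq.
- move=> x _; rewrite -!EFinM -EFinD lee_fin.
  have := sqr_ge0 ((f x - g x) - (g x - h x)).
  by nra.
Qed.

Lemma sqdistDr f f' g g' : measurable_fun setT f -> measurable_fun setT f' ->
  measurable_fun setT g -> measurable_fun setT g' ->
  (sqdist (fun x => f x + f' x)%R (fun x => g x + g' x)%R <=
    2%:E * sqdist f g + 2%:E * sqdist f' g')%E.
Proof.
move=> mf mf' mg mg'.
have -> : sqdist f' g' = sqdist (fun x => g x + f' x) (fun x => g x + g' x).
  by apply: eq_integral => x _; congr (_ ^+ 2)%:E; ring.
have -> : sqdist f g = sqdist (fun x => f x + f' x) (fun x => g x + f' x).
  by apply: eq_integral => x _; congr (_ ^+ 2)%:E; ring.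
by apply: sqdist_triangle; exact: measurable_funD.
Qed.

Lemma sqdistZ (a : R) f g : measurable_fun setT f -> measurable_fun setT g ->
  sqdist (fun x => a * f x) (fun x => a * g x) = ((a ^+ 2)%:E * sqdist f g)%E.
Proof.
move=> mf mg; rewrite /sqdist -ge0_integralZl//.
- by apply: eq_integral => x _; rewrite -EFinM -exprMn mulrBr.
- exact: msq.
- by move=> x _; rewrite lee_fin sqr_ge0.
- by rewrite lee_fin sqr_ge0.
Qed.

Lemma sqdist_dominated (f_ : nat -> T -> R) f (G : T -> R) :
  (forall n, measurable_fun setT (f_ n)) -> measurable_fun setT f ->
  (forall x, f_ ^~ x @ \oo --> f x) ->
  m.-integrable setT (EFin \o G) ->
  (forall n x, (f x - f_ n x) ^+ 2 <= G x) ->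
  sqdist f (f_ n) @[n --> \oo] --> 0%E.
Proof.
move=> mf_ mf cf iG fG.
have h := @dominated_convergence _ _ _ m setT measurableT
  (fun n x => ((f x - f_ n x) ^+ 2)%:E) (cst 0%E) (EFin \o G)
  (fun n => msq mf (mf_ n)) (measurable_cst _).
have [||_ _] := h _ iG; last by rewrite integral0.
- apply: aeW => x _ /=; apply/cvg_EFin; first exact: nearW.
  rewrite (_ : 0 = (f x - f x) * (f x - f x)); last by rewrite subrr mulr0.
  by apply: cvgM; apply: cvgB => //; exact: cvg_cst.
- by apply: aeW => x n _ /=; rewrite lee_fin ger0_norm ?sqr_ge0.
Qed.

End SquareDistance.

(** * Density of the continuous functions in real L^2 *)

Section SquareDensity.
Variables (R : realType) (X : ptopologicalType).
Variable m : {measure set (borel X) -> \bar R}.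
Hypothesis cX : compact [set: X].
Hypothesis mX : metrizable R X.
Hypothesis mfin : (m setT < +oo)%E.
Implicit Types f g : borel X -> R.

Import HBNNSimple.

Definition continuous_approximable f :=
  measurable_fun setT f /\
  forall e : R, 0 < e ->
    exists g : X -> R, continuous g /\ (sqdist m f g < e%:E)%E.

Lemma continuous_approximable_cst (a : R) :
  continuous_approximable (fun=> a).
Proof.
split=> // e e0; exists (fun=> a); split; first exact: cst_continuous.
rewrite /sqdist; under eq_integral do rewrite subrr expr0n.
by rewrite integral0 lte_fin.
Qed.

Lemma continuous_approximable_lim (f_ : nat -> borel X -> R) f :
  (forall n, continuous_approximable (f_ n)) -> measurable_fun setT f ->
  sqdist m f (f_ n) @[n --> \oo] --> 0%E -> continuous_approximable f.
Proof.
move=> af mf cf; split=> // e e0.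
(* Each of the two errors is doubled by [sqdist_triangle]. *)
have e4 : 0 < e / 4 by rewrite divr_gt0.
have [n _ /(_ n (leqnn n)) fn] : \forall n \near \oo,
    (sqdist m f (f_ n) < (e / 4)%:E)%E.
  apply: (cf [set x | (x < (e / 4)%:E)%E]); apply: open_nbhs_nbhs.
  by split; [exact: open_ereal_lt_ereal|rewrite /= lte_fin].
have [mfn /(_ _ e4)[g [gc fg]]] := af n.
exists g; split=> //.
have mg : measurable_fun setT (g : borel X -> R) by exact: continuous_borel_measurable.
apply: le_lt_trans (sqdist_triangle m mf mfn mg) _.
rewrite (_ : e%:E = 2%:E * (e / 4)%:E + 2%:E * (e / 4)%:E)%E; last first.
  by rewrite -!EFinM -EFinD; congr _%:E; lra.
by apply: lteD; rewrite lte_pmul2l// lte_fin.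
Qed.

Lemma continuous_approximableD f f' : continuous_approximable f ->
  continuous_approximable f' -> continuous_approximable (fun x => f x + f' x).
Proof.
move=> [mf af] [mf' af']; split; first exact: measurable_funD.
move=> e e0; have e4 : 0 < e / 4 by rewrite divr_gt0.
have [g [gc fg]] := af _ e4; have [g' [gc' fg']] := af' _ e4.
exists (fun x => g x + g' x); split; first exact: continuous_funD.
have mg : measurable_fun setT (g : borel X -> R) by exact: continuous_borel_measurable.
have mg' : measurable_fun setT (g' : borel X -> R) by exact: continuous_borel_measurable.
apply: le_lt_trans (sqdistDr m mf mf' mg mg') _.
rewrite (_ : e%:E = 2%:E * (e / 4)%:E + 2%:E * (e / 4)%:E)%E; last first.
  by rewrite -!EFinM -EFinD; congr _%:E; lra.
by apply: lteD; rewrite lte_pmul2l// lte_fin.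
Qed.

Lemma continuous_approximableZ (a : R) f : continuous_approximable f ->
  continuous_approximable (fun x => a * f x).
Proof.
(* The error is multiplied by a^2; dividing by a^2 + 1 instead also covers a = 0. *)
move=> [mf af]; split; first exact: measurable_funM.
move=> e e0; have e1 : 0 < e / (a ^+ 2 + 1) by rewrite divr_gt0// ltr_wpDl// sqr_ge0.
have [g [gc fg]] := af _ e1.
exists (fun x => a * g x); split.
  by apply: continuous_funM => //; exact: cst_continuous.
have mg : measurable_fun setT (g : borel X -> R) by exact: continuous_borel_measurable.
rewrite sqdistZ//.
have sfin : sqdist m f g \is a fin_num.
  by rewrite ge0_fin_numE ?sqdist_ge0//; apply: lt_trans fg _; rewrite ltry.
rewrite -(fineK sfin) -EFinM lte_fin.
rewrite -(fineK sfin) lte_fin ltr_pdivlMr ?ltr_wpDl ?sqr_ge0// in fg.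
apply: le_lt_trans fg; rewrite mulrC ler_wpM2l ?lerDl//.
by rewrite fine_ge0// sqdist_ge0.
Qed.

Lemma continuous_approximable_dominated (f_ : nat -> borel X -> R) f (G : borel X -> R) :
  (forall n, continuous_approximable (f_ n)) -> measurable_fun setT f ->
  (forall x, f_ ^~ x @ \oo --> f x) ->
  m.-integrable setT (EFin \o G) ->
  (forall n x, (f x - f_ n x) ^+ 2 <= G x) -> continuous_approximable f.
Proof.
move=> af mf cf iG fG; apply: (continuous_approximable_lim af mf).
by apply: (sqdist_dominated (G := G)) => // n; have [] := af n.
Qed.

Lemma continuous_approximable_continuous (f : X -> R) : continuous f ->
  continuous_approximable f.
Proof.
move=> fc; split; first exact: continuous_borel_measurable.
move=> e e0; exists f; split=> //.
rewrite /sqdist; under eq_integral do rewrite subrr expr0n.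
by rewrite integral0 lte_fin.
Qed.

(** The sets with approximable indicator form a lambda-system, since dominated convergence by the
    constant 1 handles increasing unions, and this system contains the open sets, whose indicators
    are pointwise limits of the exhausting functions. *)
Lemma continuous_approximable_indic (A : set (borel X)) : measurable A ->
  continuous_approximable (\1_A : borel X -> R).
Proof.
pose H := [set A : set (borel X) | measurable A /\
  continuous_approximable (\1_A : borel X -> R)].
suff : <<s @open X >> `<=` H by move=> /[apply] -[].
have int1 : m.-integrable setT (EFin \o (fun _ : borel X => 1 : R)).
  by apply: (bounded_integrable (M := 1)) => // x _; rewrite normr1.
have indic_sq (a b : R) : 0 <= a <= 1 -> 0 <= b <= 1 -> (a - b) ^+ 2 <= 1.
  by move=> /andP[a0 a1] /andP[b0 b1]; nra.
have indic01 (B : set (borel X)) x : 0 <= (\1_B x : R) <= 1.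
  by rewrite indicE; case: (_ \in _); rewrite ?lexx ?ler01.
apply: (@lambda_system_subset _ (@open X)) => //.
- by move=> U V oU oV; exact: openI.
- split => //.
  + split=> //; have := continuous_approximable_cst 1.
    by congr continuous_approximable; apply/funext => x; rewrite indicT.
  + move=> B C CB [mB aB] [mC aC]; split; first exact: measurableD.
    have := continuous_approximableD aB (continuous_approximableZ (-1) aC).
    congr continuous_approximable; apply/funext => x.
    rewrite !indicE in_setD mulN1r; case: (boolP (x \in C)) => /=.
      by rewrite inE => /CB Bx; rewrite mem_set//= subrr.
    by rewrite subr0 andbT.
  + move=> F ndF HF; split; first by apply: bigcupT_measurable => n; have [] := HF n.
    apply: (@continuous_approximable_dominated (fun n => \1_(F n)) _ (fun=> 1)) => //.
    * by move=> n; have [] := HF n.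
    * by apply/measurable_indicP/bigcupT_measurable => n; have [] := HF n.
    * move=> x; case: (pselect ((\bigcup_n F n) x)) => [[n _ Fx]|nFx].
        apply: cvg_near_cst; exists n => // k /= nk.
        have Fk : F k x by have /subsetPset := ndF _ _ nk; exact.
        have UF : (\bigcup_i F i) x by exists n.
        by rewrite !indicE !mem_set.
      apply: cvg_near_cst; apply: nearW => k.
      rewrite !indicE !memNset// => Fx; apply: nFx; exists k => //.
- move=> U oU; split; first exact: sub_sigma_algebra.
  have [g [gc g01 gnd gU0 gU1]] := metrizable_open_exhaustion mX oU.
  apply: (@continuous_approximable_dominated g _ (fun=> 1)) => //.
  + by move=> n; exact: continuous_approximable_continuous.
  + by apply: measurable_indic; exact: open_borel.
  + move=> x; case: (pselect (U x)) => Ux.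
      have [n gx] := gU1 x Ux.
      apply: cvg_near_cst; exists n => // k /= nk.
      rewrite indicE mem_set//; apply/eqP; rewrite eq_le (andP (g01 k x)).2.
      by rewrite -gx gnd.
    apply: cvg_near_cst; apply: nearW => k.
    by rewrite indicE memNset// gU0.
  + by move=> n x /=; apply: indic_sq; [exact: indic01|exact: g01].
Qed.

(** Simple functions h_n increasing to f satisfy (f - h_n)^2 <= f^2, so f^2 is the dominating
    function. *)
Lemma continuous_approximable_ge0 f : measurable_fun setT f ->
  (forall x, 0 <= f x) -> m.-integrable setT (EFin \o (fun x => f x ^+ 2)) ->
  continuous_approximable f.
Proof.
move=> mf f0 iff_.
have mEf : measurable_fun setT (EFin \o f) by exact/measurable_EFinP.
have Ef0 x : [set: borel X] x -> (0 <= (EFin \o f) x)%E by move=> _; rewrite lee_fin.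
pose h n := nnsfun_approx measurableT mEf n.
apply: (@continuous_approximable_dominated (fun n => h n) f (fun x => f x ^+ 2)) => //.
- move=> n.
  have -> : (h n : borel X -> R) =
      fun x => \sum_(y <- finmap.enum_fset (fset_set (range (h n)))) y * \1_(h n @^-1` [set y]) x.
    by apply/funext => x; rewrite {1}fimfunE fsbig_finite.
  elim: (finmap.enum_fset _) => [|y s IH].
    by under eq_fun do rewrite big_nil; exact: continuous_approximable_cst.
  under eq_fun do rewrite big_cons.
  apply: continuous_approximableD => //; apply: continuous_approximableZ.
  exact: continuous_approximable_indic.
- move=> x; have := cvg_nnsfun_approx measurableT mEf Ef0 (I : [set: borel X] x).
  by move=> /fine_cvgP[].
- move=> n x.
  have hf : h n x <= f x.
    by rewrite -lee_fin /h nnsfun_approxE; apply: le_approx.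
  have h0 : 0 <= h n x by [].
  by rewrite ler_pXn2r ?nnegrE// ?subr_ge0// lerBlDr lerDl.
Qed.

Lemma square_integrable_approximable f : measurable_fun setT f ->
  m.-integrable setT (EFin \o (fun x => f x ^+ 2)) ->
  continuous_approximable f.
Proof.
move=> mf iff_.
have part (s : borel X -> R) : measurable_fun setT s ->
    (forall x, s x ^+ 2 = f x ^+ 2) ->
    continuous_approximable (fun x => Num.max (s x) 0).
  move=> ms sf; apply: continuous_approximable_ge0.
  - exact: measurable_maxr.
  - by move=> x; rewrite le_max lexx orbT.
  - apply: le_integrable iff_ => //.
      by apply/measurable_EFinP; apply: measurable_funX; exact: measurable_maxr.
    move=> x _ /=; rewrite lee_fin !ger0_norm ?sqr_ge0// -sf.
    by case: (leP (s x) 0) => // ?; rewrite expr0n sqr_ge0.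
have := continuous_approximableD (part f mf (fun=> erefl))
  (continuous_approximableZ (-1) (part (fun x => - f x) (measurableT_comp (@oppr_measurable _ _) mf) (fun x => sqrrN _))).
congr continuous_approximable; apply/funext => x.
by case: (leP (f x) 0); case: (leP (- f x) 0); lra.
Qed.

End SquareDensity.

Section FiniteMeasures.
Context (R : realType) d (T : measurableType d).
Variable nu : {measure set T -> \bar R}.

(** The proof is a parameter of the alias, so that the finite-measure structure can be attached to
    it by inference; likewise for probabilities below. *)
Definition finite_of_measure (_ : fin_num_fun nu) : set T -> \bar R := nu.

Definition probability_of_measure (_ : nu setT = 1%E) : set T -> \bar R := nu.

HB.instance Definition _ H := Measure.on (finite_of_measure H).
HB.instance Definition _ H :=
  Measure_isFinite.Build _ _ _ (finite_of_measure H) H.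

HB.instance Definition _ H := Measure.on (probability_of_measure H).
HB.instance Definition _ H :=
  Measure_isProbability.Build _ _ _ (probability_of_measure H) H.

End FiniteMeasures.

(** * Bounded Radon-Nikodym densities *)

Section DominatedDensity.
Context (R : realType) d (T : measurableType d).
Variables m nu : {measure set T -> \bar R}.
Hypothesis mfin : (m setT < +oo)%E.
Variable c : R.
Hypothesis c0 : 0 <= c.
Hypothesis num : forall A, measurable A -> (nu A <= c%:E * m A)%E.

Let mfinA A : measurable A -> m A \is a fin_num.
Proof.
move=> mA; rewrite ge0_fin_numE//.
by apply: le_lt_trans mfin; apply: le_measure; rewrite ?inE.
Qed.

Let nufinA A : measurable A -> nu A \is a fin_num.
Proof.
move=> mA; rewrite ge0_fin_numE//.
by apply: le_lt_trans (num mA) _; rewrite -(fineK (mfinA mA)) -EFinM ltry.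
Qed.

Lemma dominated_density : exists rho : T -> R,
  [/\ measurable_fun setT rho, forall x, 0 <= rho x <= c &
      forall (f : T -> R) (M : R), measurable_fun setT f ->
        (forall x, `|f x| <= M) ->
        \int[nu]_x f x = \int[m]_x (f x * rho x)].
Proof.
pose nu' : {finite_measure set T -> \bar R} :=
  finite_of_measure nufinA.
pose m' : {finite_measure set T -> \bar R} :=
  finite_of_measure mfinA.
have numu : nu' `<< m'.
  apply/null_content_dominatesP => A mA mA0; apply/eqP.
  rewrite eq_le measure_ge0 andbT.
  by apply: le_trans (num mA) _; rewrite (_ : m A = 0%E) ?mule0.
pose rho0 := Radon_Nikodym_SigmaFinite.f nu' m'.
have rho0_ge0 x : (0 <= rho0 x)%E by exact: Radon_Nikodym_SigmaFinite.f_ge0.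
have rho0_fin x : rho0 x \is a fin_num by exact: Radon_Nikodym_SigmaFinite.f_fin_num.
have rho0_int : m.-integrable setT rho0.
  have /integrableP[? ?] := Radon_Nikodym_SigmaFinite.f_integrable numu.
  exact/integrableP.
have rho0_nu A : measurable A -> nu A = (\int[m]_(x in A) rho0 x)%E.
  by move=> mA; exact: (Radon_Nikodym_SigmaFinite.f_integral numu mA).
pose r x := fine (rho0 x).
have rE : EFin \o r = rho0 by apply/funext => x /=; rewrite fineK.
have ri : m.-integrable setT (EFin \o r) by rewrite rE.
have mr : measurable_fun setT r by apply/measurable_EFinP; exact: measurable_int ri.
have r0 x : 0 <= r x by exact: fine_ge0.
(* On the set A where r > c, the integral of the positive function r - c is nu(A) - c m(A) <= 0, so
   A is null. *)
have rc : {ae m, forall x, r x <= c}.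
  pose A := [set x | c < r x].
  have mA : measurable A.
    have -> : A = r @^-1` `]c, +oo[%classic.
      by apply/seteqP; split => x /=; rewrite in_itv/= andbT.
    by rewrite -[X in measurable X]setTI; exact: mr.
  have rA : m.-integrable A (EFin \o r) by exact: integrableS ri.
  have cA : m.-integrable A (EFin \o (fun=> c)).
    by apply: (bounded_integrable (M := `|c|)) => //; rewrite ltey_eq mfinA.
  have mrc : measurable_fun A (EFin \o (fun x => r x - c)).
    apply/measurable_EFinP; apply: measurable_funB => //.
    exact: measurable_funTS.
  have : (\int[m]_(x in A) `| (EFin \o (fun x => r x - c)%R) x |)%E = 0%E.
    apply/eqP; rewrite eq_le integral_ge0 ?andbT; last by move=> *; exact: abse_ge0.
    rewrite (_ : (\int[m]_(x in A) _)%E = (\int[m]_(x in A) (r x)%:E - \int[m]_(x in A) c%:E)%E).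
      rewrite integral_cst// sube_le0 -(rE) in rho0_nu *.
      by rewrite -rho0_nu// num.
    rewrite -integralB_EFin//; apply: eq_integral => x; rewrite inE /A /= => Ax.
    by rewrite ger0_norm// subr_ge0 ltW.
  move=> /(ae_eq_integral_abs m mA mrc).
  apply: filterS => x /= h; rewrite leNgt; apply/negP => cx.
  by have [] := h cx; move=> /eqP; rewrite subr_eq0 => /eqP rx; move: cx; rewrite rx ltxx.
(* Cutting at c changes r on a null set only and makes the bound hold at every point. *)
exists (fun x => Num.min (r x) c); split.
- exact: measurable_minr.
- by move=> x; rewrite le_min r0 c0 ge_min lexx orbT.
have int_ge0 (f : T -> R) (M : R) : measurable_fun setT f -> (forall x, 0 <= f x <= M) ->
    \int[nu]_x f x = \int[m]_x (f x * Num.min (r x) c).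
  move=> mf fM; congr fine.
  rewrite -(@Radon_Nikodym_SigmaFinite.change_of_variables _ _ _ nu' m' numu (EFin \o f))//.
  - apply: ae_eq_integral => //.
    + apply: emeasurable_funM; first exact/measurable_EFinP.
      exact: measurable_int rho0_int.
    + apply/measurable_EFinP; apply: measurable_funM => //.
      exact: measurable_minr.
    + apply: filterS rc => x rx _; rewrite -/(rho0 x) -rE /= (min_idPl rx).
      by rewrite EFinM.
  - by move=> x; rewrite lee_fin; case/andP: (fM x).
  - exact/measurable_EFinP.
move=> f M mf fM.
have nufin : (nu setT < +oo)%E by rewrite ltey_eq nufinA.
have mmin : measurable_fun setT (fun x => Num.min (r x) c) by exact: measurable_minr.
have bmin x : `|Num.min (r x) c| <= c.
  by rewrite ger0_norm ?le_min ?r0//= ge_min lexx orbT.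
(* The change of variables is available for nonnegative functions: it is applied to f + M and to the
   constant, then subtracted. The constant enters as |M| because M >= 0 is derived only from a point
   of T. *)
have := int_ge0 (fun x => f x + M) (M + M).
have := int_ge0 (fun=> `|M|) `|M|.
move=> /(_ (measurable_cst _)) hM hf.
have M0 (x : T) : 0 <= M by exact: le_trans (fM x).
have {}hM : \int[nu]_x M = \int[m]_x (M * Num.min (r x) c).
  have hM' : forall x : T, 0 <= `|M| <= `|M| by rewrite normr_ge0 lexx.
  have := hM hM'; under eq_Rintegral => x _ do rewrite (ger0_norm (M0 x)).
  by under [in RHS]eq_Rintegral => x _ do rewrite (ger0_norm (M0 x)).
have fi : nu.-integrable setT (EFin \o f) by exact: (bounded_integrable (M := M)).
have Mi : nu.-integrable setT (EFin \o (fun=> M)).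
  by apply: (bounded_integrable (M := `|M|)).
have fmi : m.-integrable setT (EFin \o (fun x => f x * Num.min (r x) c)).
  apply: (bounded_integrable (M := M * c)) => //; first exact: measurable_funM.
  by move=> x _; rewrite normrM ler_pM.
have Mmi : m.-integrable setT (EFin \o (fun x => M * Num.min (r x) c)).
  apply: (bounded_integrable (M := `|M| * c)) => //; first exact: measurable_funM.
  by move=> x _; rewrite normrM ler_wpM2l.
have : \int[nu]_x (f x + M) = \int[m]_x ((f x + M) * Num.min (r x) c).
  apply: hf; first exact: measurable_funD.
  by clear M0 => x; have := fM x; rewrite ler_norml => /andP[]; lra.
rewrite RintegralD//; under [RHS]eq_Rintegral do rewrite mulrDl.
by rewrite RintegralD// hM => /addIr.
Qed.

End DominatedDensity.

(** * Complex-valued integration and L^2 *)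

Section ComplexNumbers.
Variable R : realType.
Implicit Types x y z : R[i].

Local Notation Re := (@complex.Re R).
Local Notation Im := (@complex.Im R).

Lemma complex_ext x y : Re x = Re y -> Im x = Im y -> x = y.
Proof. by case: x y => a b [c d] /= -> ->. Qed.

Lemma ReD x y : Re (x + y) = Re x + Re y. Proof. by case: x; case: y. Qed.
Lemma ImD x y : Im (x + y) = Im x + Im y. Proof. by case: x; case: y. Qed.
Lemma ReN x : Re (- x) = - Re x. Proof. by case: x. Qed.
Lemma ImN x : Im (- x) = - Im x. Proof. by case: x. Qed.
Lemma ReM x y : Re (x * y) = Re x * Re y - Im x * Im y.
Proof. by case: x; case: y. Qed.
Lemma ImM x y : Im (x * y) = Re x * Im y + Im x * Re y.
Proof. by case: x; case: y. Qed.
Lemma Re_conj x : Re (x^*%C) = Re x. Proof. by case: x. Qed.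
Lemma Im_conj x : Im (x^*%C) = - Im x. Proof. by case: x. Qed.
Lemma conjcM x y : (x * y)^*%C = x^*%C * y^*%C. Proof. exact: rmorphM. Qed.

Definition ReImE := (ReD, ImD, ReN, ImN, ReM, ImM, Re_conj, Im_conj).

Lemma sqr_cmodulus z : cmodulus z ^+ 2 = Re z ^+ 2 + Im z ^+ 2.
Proof. by case: z => a b /=; rewrite sqr_sqrtr// addr_ge0// sqr_ge0. Qed.

Lemma cmodulus_ge0 z : 0 <= cmodulus z.
Proof. by case: z => a b; rewrite /= sqrtr_ge0. Qed.

Lemma cmodulus0 : cmodulus (0 : R[i]) = 0.
Proof. exact: ComplexField.Normc.normc0. Qed.

Lemma cmodulus1 : cmodulus (1 : R[i]) = 1.
Proof. exact: ComplexField.Normc.normc1. Qed.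

Lemma cmodulusM x y : cmodulus (x * y) = cmodulus x * cmodulus y.
Proof. exact: ComplexField.Normc.normcM. Qed.

Lemma cmodulusD x y : cmodulus (x + y) <= cmodulus x + cmodulus y.
Proof. by have := ler_normD x y; rewrite -lecR rmorphD. Qed.

Lemma cmodulusN x : cmodulus (- x) = cmodulus x.
Proof. by have := normrN x => -[]. Qed.

Lemma cmodulus_conj x : cmodulus (x^*%C) = cmodulus x.
Proof. by case: x => a b /=; rewrite sqrrN. Qed.

Lemma cmodulus_eq0 z : cmodulus z = 0 -> z = 0.
Proof. exact: ComplexField.Normc.eq0_normc. Qed.

Lemma cmodulus_real (a : R) : cmodulus (Complex a 0) = `|a|.
Proof. by rewrite /cmodulus /= expr0n /= addr0 sqrtr_sqr. Qed.

Lemma normr_Re_le z : `|Re z| <= cmodulus z.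
Proof.
rewrite -(@ler_pXn2r _ 2)// ?nnegrE ?normr_ge0 ?cmodulus_ge0//.
by rewrite sqr_cmodulus real_normK ?num_real// lerDl sqr_ge0.
Qed.

Lemma normr_Im_le z : `|Im z| <= cmodulus z.
Proof.
rewrite -(@ler_pXn2r _ 2)// ?nnegrE ?normr_ge0 ?cmodulus_ge0//.
by rewrite sqr_cmodulus real_normK ?num_real// lerDr sqr_ge0.
Qed.

Lemma cmodulus_le z : cmodulus z <= `|Re z| + `|Im z|.
Proof.
rewrite -(@ler_pXn2r _ 2)// ?nnegrE ?addr_ge0 ?normr_ge0 ?cmodulus_ge0//.
rewrite sqr_cmodulus -(real_normK (num_real (Re z))) -(real_normK (num_real (Im z))).
have := normr_ge0 (Re z); have := normr_ge0 (Im z).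
by move: `|Re z| `|Im z| => a b; nra.
Qed.

Lemma ccvgP (u : nat -> R[i]) a :
  ((u : nat -> R[i]^o) @ \oo --> (a : R[i]^o)) <->
  ((fun n => Re (u n)) @ \oo --> Re a /\ (fun n => Im (u n)) @ \oo --> Im a).
Proof.
have normE z : `|z| = (cmodulus z)%:C%C by [].
split.
  move=> /cvgrPdist_lt ua.
  have H (e : R) : 0 < e -> \forall n \near \oo, cmodulus (a - u n) < e.
    move=> e0; have /ua : (0 : R[i]) < e%:C%C by rewrite ltcR.
    by apply: filterS => n; rewrite normE ltcR.
  split; apply/cvgrPdist_lt => e /H; apply: filterS => n.
    by apply: le_lt_trans; rewrite -ReN -ReD normr_Re_le.
  by apply: le_lt_trans; rewrite -ImN -ImD normr_Im_le.
move=> [/cvgrPdist_lt ur /cvgrPdist_lt ui]; apply/cvgrPdist_lt => e e0.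
(* Being positive in [R[i]] forces e to be real. *)
have [er e0'] : e = (Re e)%:C%C /\ 0 < Re e.
  by move: e0; rewrite ltcE /= => /andP[/eqP ie re]; split=> //; exact: complex_ext.
have e2 : 0 < Re e / 2 by rewrite divr_gt0.
near=> n; rewrite normE er ltcR.
apply: le_lt_trans (cmodulus_le _) _.
rewrite (splitr (Re e)) ltrD// ?ReD ?ReN ?ImD ?ImN.
  by near: n; exact: ur.
by near: n; exact: ui.
Unshelve. all: by end_near. Qed.

Lemma ccvg_unique (u : nat -> R[i]) a b :
  (u : nat -> R[i]^o) @ \oo --> (a : R[i]^o) ->
  (u : nat -> R[i]^o) @ \oo --> (b : R[i]^o) -> a = b.
Proof.
move=> /ccvgP[ra ia] /ccvgP[rb ib]; apply: complex_ext.
  exact: (cvg_unique _ ra rb).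
exact: (cvg_unique _ ia ib).
Qed.

Lemma ccontinuousP (T : topologicalType) (f : T -> R[i]) :
  ccontinuous f <->
  (continuous (fun x : T => Re (f x)) /\ continuous (fun x : T => Im (f x))).
Proof.
have normE z : `|z| = (cmodulus z)%:C%C by [].
split=> [fc|[rc ic] x].
  split=> x; apply/cvgrPdist_lt => e e0.
    have : nbhs x (f @^-1` [set z | cmodulus (f x - z) < e]).
      have /cvgrPdist_lt := fc x; move=> /(_ e%:C%C); rewrite ltcR => /(_ e0).
      by apply: filterS => y /=; rewrite normE ltcR.
    apply: filterS => y /=; apply: le_lt_trans.
    by rewrite -ReN -ReD normr_Re_le.
  have : nbhs x (f @^-1` [set z | cmodulus (f x - z) < e]).
    have /cvgrPdist_lt := fc x; move=> /(_ e%:C%C); rewrite ltcR => /(_ e0).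
    by apply: filterS => y /=; rewrite normE ltcR.
  apply: filterS => y /=; apply: le_lt_trans.
  by rewrite -ImN -ImD normr_Im_le.
apply/cvgrPdist_lt => e e0.
have [er e0'] : e = (Re e)%:C%C /\ 0 < Re e.
  by move: e0; rewrite ltcE /= => /andP[/eqP ie re]; split=> //; exact: complex_ext.
have e2 : 0 < Re e / 2 by rewrite divr_gt0.
near=> y; rewrite normE er ltcR.
apply: le_lt_trans (cmodulus_le _) _.
rewrite (splitr (Re e)) ltrD// ?ReD ?ReN ?ImD ?ImN.
  by near: y; move/cvgrPdist_lt: (rc x); exact.
by near: y; move/cvgrPdist_lt: (ic x); exact.
Unshelve. all: by end_near. Qed.

End ComplexNumbers.

Section ComplexIntegral.
Context (R : realType) d (T : measurableType d).
Variable mu : {measure set T -> \bar R}.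
Local Notation Re := (@complex.Re R).
Local Notation Im := (@complex.Im R).
Implicit Types f g : T -> R[i].

Definition cintegrable (D : set T) f :=
  mu.-integrable D (EFin \o (fun x => Re (f x))) /\
  mu.-integrable D (EFin \o (fun x => Im (f x))).

Lemma integrable_funD (D : set T) (a b : T -> R) : measurable D ->
  mu.-integrable D (EFin \o a) -> mu.-integrable D (EFin \o b) ->
  mu.-integrable D (EFin \o (fun x => a x + b x)).
Proof. by move=> mD ia ib; exact: (integrableD mD ia ib). Qed.

Lemma integrable_funZ (D : set T) (k : R) (a : T -> R) : measurable D ->
  mu.-integrable D (EFin \o a) -> mu.-integrable D (EFin \o (fun x => k * a x)).
Proof. by move=> mD ia; exact: (integrableZl mD k ia). Qed.

Lemma cintegralD (D : set T) f g : measurable D ->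
  cintegrable D f -> cintegrable D g ->
  cintegral mu D (fun x => f x + g x) = cintegral mu D f + cintegral mu D g.
Proof.
move=> mD [rf imf] [rg img]; apply: complex_ext; rewrite ?ReD ?ImD /=.
  by under eq_Rintegral do rewrite ReD; rewrite RintegralD.
by under eq_Rintegral do rewrite ImD; rewrite RintegralD.
Qed.

Lemma cintegralZ (D : set T) (c : R[i]) f : measurable D -> cintegrable D f ->
  cintegral mu D (fun x => c * f x) = c * cintegral mu D f.
Proof.
move=> mD [rf imf]; apply: complex_ext; rewrite ?ReM ?ImM /=.
  under eq_Rintegral do rewrite ReM -mulNr.
  by rewrite RintegralD ?RintegralZl ?mulNr//; exact: integrable_funZ.
under eq_Rintegral do rewrite ImM.
by rewrite RintegralD ?RintegralZl//; exact: integrable_funZ.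
Qed.

Lemma cintegral_conj (D : set T) f : measurable D -> cintegrable D f ->
  cintegral mu D (fun x => (f x)^*%C) = (cintegral mu D f)^*%C.
Proof.
move=> mD [rf imf]; apply: complex_ext; rewrite ?Re_conj ?Im_conj /=.
  by under eq_Rintegral do rewrite Re_conj.
under eq_Rintegral do rewrite Im_conj -mulN1r.
by rewrite RintegralZl// mulN1r.
Qed.

End ComplexIntegral.

Section L2Space.
Context (R : realType) d (T : measurableType d).
Variable m : {measure set T -> \bar R}.
Local Notation Re := (@complex.Re R).
Local Notation Im := (@complex.Im R).
Implicit Types f g h : T -> R[i].

Definition nsq f : R := Re (inner m f f).

Lemma cmeasurableD f g : cmeasurable f -> cmeasurable g ->
  cmeasurable (fun x => f x + g x).
Proof.
move=> [rf imf] [rg img]; split.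
  by under eq_fun do rewrite ReD; exact: measurable_funD.
by under eq_fun do rewrite ImD; exact: measurable_funD.
Qed.

Lemma cmeasurableM f g : cmeasurable f -> cmeasurable g ->
  cmeasurable (fun x => f x * g x).
Proof.
move=> [rf imf] [rg img]; split.
  by under eq_fun do rewrite ReM; apply: measurable_funB; exact: measurable_funM.
by under eq_fun do rewrite ImM; apply: measurable_funD; exact: measurable_funM.
Qed.

Lemma cmeasurable_conj f : cmeasurable f -> cmeasurable (fun x => (f x)^*%C).
Proof.
move=> [rf imf]; split; first by under eq_fun do rewrite Re_conj.
by under eq_fun do rewrite Im_conj; exact: measurableT_comp.
Qed.

Lemma cmeasurable_cst (c : R[i]) : cmeasurable (fun _ : T => c).
Proof. by split; exact: measurable_cst. Qed.

Lemma cmeasurable_cmodulus f : cmeasurable f ->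
  measurable_fun setT (fun x => cmodulus (f x)).
Proof.
move=> [rf imf].
have -> : (fun x => cmodulus (f x)) =
    (fun x => Num.sqrt (Re (f x) ^+ 2 + Im (f x) ^+ 2)).
  by apply/funext => x; case: (f x).
apply: measurableT_comp.
  by apply: continuous_measurable_fun; exact: sqrt_continuous.
by apply: measurable_funD; exact: measurable_funX.
Qed.

Lemma L2P f : L2 m f <-> [/\ cmeasurable f,
  m.-integrable setT (EFin \o (fun x => Re (f x) ^+ 2)) &
  m.-integrable setT (EFin \o (fun x => Im (f x) ^+ 2))].
Proof.
split=> [[mf lty]|[[rf imf] ir ii]].
  have int2 : m.-integrable setT (EFin \o (fun x => cmodulus (f x) ^+ 2)).
    apply/integrableP; split.
      apply/measurable_EFinP; apply: measurable_funX.
      exact: cmeasurable_cmodulus.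
    under eq_integral do rewrite /= ger0_norm ?sqr_ge0//.
    exact: lty.
  have [rf imf] := mf.
  split=> //; apply: le_integrable int2 => //.
  - by apply/measurable_EFinP; exact: measurable_funX.
  - by move=> x _; rewrite /= lee_fin !ger0_norm ?sqr_ge0// sqr_cmodulus lerDl sqr_ge0.
  - by apply/measurable_EFinP; exact: measurable_funX.
  - by move=> x _; rewrite /= lee_fin !ger0_norm ?sqr_ge0// sqr_cmodulus lerDr sqr_ge0.
split=> //; have /integrableP[_] := integrable_funD measurableT ir ii.
apply: le_lt_trans; rewrite le_eqVlt; apply/orP; left; apply/eqP.
apply: eq_integral => x _; rewrite /= sqr_cmodulus ger0_norm//.
by rewrite addr_ge0 ?sqr_ge0.
Qed.

Lemma integrable_sqrD (a b : T -> R) : measurable_fun setT a ->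
  measurable_fun setT b ->
  m.-integrable setT (EFin \o (fun x => a x ^+ 2)) ->
  m.-integrable setT (EFin \o (fun x => b x ^+ 2)) ->
  m.-integrable setT (EFin \o (fun x => (a x + b x) ^+ 2)).
Proof.
move=> ma mb ia ib.
apply: le_integrable (integrable_funZ 2 measurableT (integrable_funD measurableT ia ib)) => //.
  by apply/measurable_EFinP; apply: measurable_funX; exact: measurable_funD.
move=> x _; rewrite /= lee_fin !ger0_norm ?sqr_ge0//; last first.
  by rewrite mulr_ge0// addr_ge0// sqr_ge0.
by have := sqr_ge0 (a x - b x); nra.
Qed.

Lemma integrable_sqrM (a b : T -> R) : measurable_fun setT a ->
  measurable_fun setT b ->
  m.-integrable setT (EFin \o (fun x => a x ^+ 2)) ->
  m.-integrable setT (EFin \o (fun x => b x ^+ 2)) ->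
  m.-integrable setT (EFin \o (fun x => a x * b x)).
Proof.
move=> ma mb ia ib.
apply: le_integrable (integrable_funD measurableT ia ib) => //.
  by apply/measurable_EFinP; exact: measurable_funM.
move=> x _; rewrite /= lee_fin [leRHS]ger0_norm ?addr_ge0 ?sqr_ge0//.
by rewrite ler_norml; apply/andP; split;
  [have := sqr_ge0 (a x + b x)|have := sqr_ge0 (a x - b x)];
  have := sqr_ge0 (a x); have := sqr_ge0 (b x); nra.
Qed.

Lemma L2D f g : L2 m f -> L2 m g -> L2 m (fun x => f x + g x).
Proof.
move=> /L2P[mf rf imf] /L2P[mg rg img].
have [? ?] := mf; have [? ?] := mg.
apply/L2P; split; first exact: cmeasurableD.
  by under [X in _.-integrable _ X]eq_fun do rewrite /= ReD; exact: integrable_sqrD.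
by under [X in _.-integrable _ X]eq_fun do rewrite /= ImD; exact: integrable_sqrD.
Qed.

Lemma L2Z (c : R[i]) f : L2 m f -> L2 m (fun x => c * f x).
Proof.
move=> /L2P[mf rf imf]; have [? ?] := mf.
have sqrZ (k : R) (a : T -> R) : m.-integrable setT (EFin \o (fun x => a x ^+ 2)) ->
    m.-integrable setT (EFin \o (fun x => (k * a x) ^+ 2)).
  move=> ia; under [X in _.-integrable _ X]eq_fun do rewrite /= exprMn.
  exact: integrable_funZ.
apply/L2P; split; first by apply: cmeasurableM => //; exact: cmeasurable_cst.
  under [X in _.-integrable _ X]eq_fun do rewrite /= ReM -mulNr.
  by apply: integrable_sqrD; [exact: measurable_funM..|exact: sqrZ|exact: sqrZ].
under [X in _.-integrable _ X]eq_fun do rewrite /= ImM.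
by apply: integrable_sqrD; [exact: measurable_funM..|exact: sqrZ|exact: sqrZ].
Qed.

Lemma L2B f g : L2 m f -> L2 m g -> L2 m (fun x => f x - g x).
Proof.
move=> Lf Lg; have := L2D Lf (L2Z (-1) Lg).
by under eq_fun do rewrite mulN1r.
Qed.

Lemma L2_0 : L2 m (fun=> 0).
Proof.
apply/L2P; split; first exact: cmeasurable_cst.
  by under [X in _.-integrable _ X]eq_fun do rewrite /= expr0n; exact: integrable0.
by under [X in _.-integrable _ X]eq_fun do rewrite /= expr0n; exact: integrable0.
Qed.

Lemma L2_sum (k : nat) (c : 'I_k -> R[i]) (e : 'I_k -> T -> R[i]) :
  (forall j, L2 m (e j)) -> L2 m (fun x => \sum_(j < k) c j * e j x).
Proof.
elim: k c e => [|k IH] c e Le.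
  by under eq_fun do rewrite big_ord0; exact: L2_0.
under eq_fun do rewrite big_ord_recr/=.
by apply: L2D; [apply: IH => j; exact: Le|exact: L2Z].
Qed.

Lemma inner_integrable f g : L2 m f -> L2 m g ->
  cintegrable m setT (fun x => f x * (g x)^*%C).
Proof.
move=> /L2P[[? ?] rf imf] /L2P[[? ?] rg img]; split.
  under [X in _.-integrable _ X]eq_fun do rewrite /= ReM Re_conj Im_conj mulrN opprK.
  by apply: integrable_funD => //; exact: integrable_sqrM.
under [X in _.-integrable _ X]eq_fun do rewrite /= ImM Re_conj Im_conj mulrN -mulNr.
apply: integrable_funD => //; apply: integrable_sqrM => //.
  exact: measurableT_comp.
by under [X in _.-integrable _ X]eq_fun do rewrite /= sqrrN.
Qed.

Lemma innerDl f g h : L2 m f -> L2 m g -> L2 m h ->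
  inner m (fun x => f x + g x) h = inner m f h + inner m g h.
Proof.
move=> Lf Lg Lh; rewrite /inner -cintegralD//; try exact: inner_integrable.
by congr cintegral; apply/funext => x; rewrite mulrDl.
Qed.

Lemma innerZl (c : R[i]) f g : L2 m f -> L2 m g ->
  inner m (fun x => c * f x) g = c * inner m f g.
Proof.
move=> Lf Lg; rewrite /inner -cintegralZ//; try exact: inner_integrable.
by congr cintegral; apply/funext => x; rewrite mulrA.
Qed.

Lemma inner_conj f g : L2 m f -> L2 m g -> inner m g f = (inner m f g)^*%C.
Proof.
move=> Lf Lg; rewrite /inner -cintegral_conj//; try exact: inner_integrable.
by congr cintegral; apply/funext => x; rewrite rmorphM /= conjcK mulrC.
Qed.

Lemma innerBl f g h : L2 m f -> L2 m g -> L2 m h ->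
  inner m (fun x => f x - g x) h = inner m f h - inner m g h.
Proof.
move=> Lf Lg Lh; have := innerDl Lf (L2Z (-1) Lg) Lh.
by rewrite innerZl// mulN1r => <-; congr inner; apply/funext => x; rewrite mulN1r.
Qed.

Lemma innerDr f g h : L2 m f -> L2 m g -> L2 m h ->
  inner m h (fun x => f x + g x) = inner m h f + inner m h g.
Proof.
move=> Lf Lg Lh; rewrite inner_conj//; last exact: L2D.
by rewrite innerDl// rmorphD (inner_conj Lf Lh) (inner_conj Lg Lh).
Qed.

Lemma innerZr (c : R[i]) f g : L2 m f -> L2 m g ->
  inner m f (fun x => c * g x) = c^*%C * inner m f g.
Proof.
move=> Lf Lg; rewrite inner_conj//; last exact: L2Z.
by rewrite innerZl// rmorphM (inner_conj Lg Lf).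
Qed.

Lemma innerBr f g h : L2 m f -> L2 m g -> L2 m h ->
  inner m h (fun x => f x - g x) = inner m h f - inner m h g.
Proof.
move=> Lf Lg Lh; rewrite inner_conj//; last exact: L2B.
by rewrite innerBl// rmorphB (inner_conj Lf Lh) (inner_conj Lg Lh).
Qed.

Lemma inner_suml (k : nat) (c : 'I_k -> R[i]) (e : 'I_k -> T -> R[i]) g :
  (forall j, L2 m (e j)) -> L2 m g ->
  inner m (fun x => \sum_(j < k) c j * e j x) g = \sum_(j < k) c j * inner m (e j) g.
Proof.
move=> + Lg; elim: k c e => [|k IH] c e Le.
  under eq_fun do rewrite big_ord0; rewrite big_ord0.
  have -> : (fun _ : T => 0 : R[i]) = (fun x => 0 * g x).
    by apply/funext => x; rewrite mul0r.
  by rewrite innerZl// mul0r.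
under eq_fun do rewrite big_ord_recr/=.
rewrite innerDl//; [|by apply: L2_sum => j; exact: Le|exact: L2Z].
by rewrite innerZl// IH ?big_ord_recr// => j; exact: Le.
Qed.

Lemma Im_inner_self f : Im (inner m f f) = 0.
Proof.
rewrite /=; under eq_Rintegral do rewrite ImM Re_conj Im_conj mulrN mulrC addNr.
by rewrite /Rintegral integral0.
Qed.

Lemma inner_selfE f : inner m f f = Complex (nsq f) 0.
Proof. by apply: complex_ext => //=; exact: Im_inner_self. Qed.

Lemma nsqE f : L2 m f -> (\int[m]_x (cmodulus (f x) ^+ 2)%:E)%E = (nsq f)%:E.
Proof.
move=> Lf; have [rf _] := inner_integrable Lf Lf.
rewrite /nsq /= /Rintegral fineK; last exact: integrable_fin_num.
apply: eq_integral => x _; congr _%:E.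
by rewrite sqr_cmodulus ReM Re_conj Im_conj mulrN opprK !expr2.
Qed.

Lemma nsq_ge0 f : L2 m f -> 0 <= nsq f.
Proof.
move=> Lf; rewrite -lee_fin -nsqE//; apply: integral_ge0 => x _.
by rewrite lee_fin sqr_ge0.
Qed.

Lemma nsq_eq0 f : L2 m f -> nsq f = 0 -> {ae m, forall x, f x = 0}.
Proof.
move=> Lf f0; have [mf _] := Lf.
have msq : measurable_fun setT (EFin \o (fun x => cmodulus (f x) ^+ 2)).
  by apply/measurable_EFinP; apply: measurable_funX; exact: cmeasurable_cmodulus.
have : (\int[m]_x `| (EFin \o (fun x => cmodulus (f x) ^+ 2)%R) x |)%E = 0%E.
  rewrite -[RHS]/(0%:E) -f0 -nsqE//; apply: eq_integral => x _.
  by rewrite /= ger0_norm ?sqr_ge0.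
move=> /(ae_eq_integral_abs m measurableT msq).
apply: filterS => x /= /(_ I) [] /eqP; rewrite sqrf_eq0 => /eqP.
exact: cmodulus_eq0.
Qed.

Lemma nsqD f g : L2 m f -> L2 m g ->
  nsq (fun x => f x + g x) = nsq f + nsq g + 2 * Re (inner m f g).
Proof.
move=> Lf Lg; have LD := L2D Lf Lg.
rewrite /nsq innerDl// !innerDr// !ReD (inner_conj Lf Lg) Re_conj.
by rewrite mulr2n mulrDl mul1r; ring.
Qed.

Lemma nsqZ (c : R[i]) f : L2 m f ->
  nsq (fun x => c * f x) = cmodulus c ^+ 2 * nsq f.
Proof.
move=> Lf; rewrite /nsq innerZl ?innerZr//; last exact: L2Z.
rewrite inner_selfE sqr_cmodulus; case: c => a b /=.
by rewrite /nsq /=; ring.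
Qed.

Lemma nsqB f g : L2 m f -> L2 m g ->
  nsq (fun x => f x - g x) = nsq f + nsq g - 2 * Re (inner m f g).
Proof.
move=> Lf Lg; have := nsqD Lf (L2Z (-1) Lg).
rewrite nsqZ// innerZr// cmodulusN cmodulus1 expr1n mul1r.
rewrite rmorphN rmorph1 mulN1r ReN mulrN => <-.
by congr nsq; apply/funext => x; rewrite mulN1r.
Qed.

Lemma nsqD_le f g : L2 m f -> L2 m g ->
  nsq (fun x => f x + g x) <= 2 * nsq f + 2 * nsq g.
Proof.
move=> Lf Lg; have := nsq_ge0 (L2B Lf Lg).
by rewrite nsqB// nsqD//; lra.
Qed.

Lemma nsq_triangle f g h : L2 m f -> L2 m g -> L2 m h ->
  nsq (fun x => f x - h x) <=
  2 * nsq (fun x => f x - g x) + 2 * nsq (fun x => g x - h x).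
Proof.
move=> Lf Lg Lh; have := nsqD_le (L2B Lf Lg) (L2B Lg Lh).
by under [X in nsq X <= _ -> _]eq_fun do rewrite addrA subrK.
Qed.

(* Pythagoras: a vector orthogonal to vectors arbitrarily close to it is zero. *)
Lemma orthogonal_approx_eq0 f : L2 m f ->
  (forall e : R, 0 < e -> exists g,
    [/\ L2 m g, inner m f g = 0 & nsq (fun x => f x - g x) < e]) ->
  {ae m, forall x, f x = 0}.
Proof.
move=> Lf approx; apply: nsq_eq0 => //; apply/eqP; rewrite eq_le nsq_ge0// andbT.
apply/ler_addgt0Pr => e /approx[g [Lg fg0]]; rewrite add0r nsqB// fg0 /=.
by have := nsq_ge0 Lg; lra.
Qed.

Lemma inner_ael f f' g : cmeasurable f -> cmeasurable f' -> cmeasurable g ->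
  {ae m, forall x, f x = f' x} -> inner m f g = inner m f' g.
Proof.
move=> mf mf' mg ff'.
have [r i] := cmeasurableM mf (cmeasurable_conj mg).
have [r' i'] := cmeasurableM mf' (cmeasurable_conj mg).
apply: complex_ext => /=; congr fine; apply: ae_eq_integral => //;
  try exact/measurable_EFinP; by apply: filterS ff' => x -> _.
Qed.

Lemma L2_bounded f (M : R) : (m setT < +oo)%E -> cmeasurable f ->
  (forall x, cmodulus (f x) <= M) -> L2 m f.
Proof.
move=> mfin mf fM; have [rf imf] := mf.
have bsq (a : T -> R) : measurable_fun setT a ->
    (forall x, `|a x| <= cmodulus (f x)) ->
    m.-integrable setT (EFin \o (fun x => a x ^+ 2)).
  move=> ma af; apply: (bounded_integrable (M := M ^+ 2)) => //.
    exact: measurable_funX.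
  move=> x _; rewrite normrX ler_pXn2r// ?nnegrE ?(le_trans (af x))//.
  exact: le_trans (cmodulus_ge0 _) (fM x).
by apply/L2P; split=> //; apply: bsq => // x; [exact: normr_Re_le|exact: normr_Im_le].
Qed.

End L2Space.

Section L2Density.
Variables (R : realType) (X : ptopologicalType).
Variable m : {measure set (borel X) -> \bar R}.
Hypothesis cX : compact [set: X].
Hypothesis mX : metrizable R X.
Hypothesis mfin : (m setT < +oo)%E.

Lemma ccontinuous_bounded (f : X -> R[i]) : ccontinuous f ->
  exists M, forall x, cmodulus (f x) <= M.
Proof.
move=> /ccontinuousP[rc ic].
have [M1 f1] := continuous_fun_bounded cX rc.
have [M2 f2] := continuous_fun_bounded cX ic.
by exists (M1 + M2) => x; apply: le_trans (cmodulus_le _) (lerD (f1 x) (f2 x)).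
Qed.

Lemma ccontinuous_cmeasurable (f : X -> R[i]) : ccontinuous f ->
  cmeasurable (f : borel X -> R[i]).
Proof.
by move=> /ccontinuousP[rc ic]; split; exact: continuous_borel_measurable.
Qed.

Lemma ccontinuous_L2 (f : X -> R[i]) : ccontinuous f -> L2 m (f : borel X -> R[i]).
Proof.
move=> fc; have [M fM] := ccontinuous_bounded fc.
exact: L2_bounded (ccontinuous_cmeasurable fc) fM.
Qed.

Lemma L2_ccontinuous_dense (f : borel X -> R[i]) (e : R) : L2 m f -> 0 < e ->
  exists g : X -> R[i], ccontinuous g /\
    nsq m (fun x => f x - (g : borel X -> R[i]) x) < e.
Proof.
move=> Lf e0; have /L2P[[mr mi] ir ii] := Lf.
have e2 : 0 < e / 2 by rewrite divr_gt0.
have [_ /(_ _ e2)[gr [grc fgr]]] := square_integrable_approximable mX mfin mr ir.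
have [_ /(_ _ e2)[gi [gic fgi]]] := square_integrable_approximable mX mfin mi ii.
pose g x := Complex (gr x) (gi x).
have gc : ccontinuous g by apply/ccontinuousP.
exists g; split=> //; rewrite -lte_fin -nsqE; last first.
  by apply: L2B => //; exact: ccontinuous_L2.
have mgr := continuous_borel_measurable grc.
have mgi := continuous_borel_measurable gic.
rewrite (_ : (\int[m]_x _)%E = (sqdist m (fun x => complex.Re (f x)) gr +
    sqdist m (fun x => complex.Im (f x)) gi)%E).
  by rewrite (splitr e) EFinD; exact: lteD.
rewrite /sqdist -ge0_integralD//.
- apply: eq_integral => x _; rewrite -EFinD; congr _%:E.
  by rewrite sqr_cmodulus ReD ImD ReN ImN.
- by move=> x _; rewrite lee_fin sqr_ge0.
- by apply/measurable_EFinP; apply: measurable_funX; exact: measurable_funB.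
- by move=> x _; rewrite lee_fin sqr_ge0.
- by apply/measurable_EFinP; apply: measurable_funX; exact: measurable_funB.
Qed.

(** Averages along the orbit determine inner products with continuous functions only; this turns
    such information into almost everywhere identities. *)
Lemma orthogonal_continuous_eq0 (f : borel X -> R[i]) : L2 m f ->
  (forall g : X -> R[i], ccontinuous g -> inner m (g : borel X -> R[i]) f = 0) ->
  {ae m, forall x, f x = 0}.
Proof.
move=> Lf fg; apply: orthogonal_approx_eq0 => // e /(L2_ccontinuous_dense Lf)[g [gc fge]].
have Lg := ccontinuous_L2 gc.
by exists g; split=> //; rewrite inner_conj// fg// conjc0.
Qed.

End L2Density.

(** * Averages along a Foelner sequence *)

Section HaarAverages.
Variables (R : realType) (G : topologicalZmodType).
Variable mu : {measure set (borel_group G) -> \bar R}.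
Hypothesis hausdorffG : hausdorff_space G.
Hypothesis haar_mu : haar mu.

(** [haar] and [folner] speak of images of sets; as preimages under the inverse translation these
    inherit openness and measurability. *)
Lemma translate_preimage (t : G) (A : set G) :
  [set t + s | s in A] = (fun s => - t + s) @^-1` A.
Proof.
apply/seteqP; split => [_ [s As <-]|s /= As]; first by rewrite /= addKr.
by exists (- t + s) => //; rewrite addNKr.
Qed.

Lemma continuous_translate (t : G) : continuous (fun s : G => t + s).
Proof.
move=> s; apply: (@continuous_comp _ _ _ (fun s => (t, s)) (fun x => x.1 + x.2)).
  by apply: cvg_pair; [exact: cvg_cst|exact: cvg_id].
exact: add_continuous.
Qed.

Lemma open_translate (t : G) (A : set G) : open A -> open [set t + s | s in A].
Proof.
move=> oA; rewrite translate_preimage.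
by apply: open_comp => // s _; exact: continuous_translate.
Qed.

Lemma open_measurable_group (U : set G) : open U ->
  measurable (U : set (borel_group G)).
Proof. exact: (@open_borel (pointed_group G)). Qed.

Lemma closed_measurable_group (U : set G) : closed U ->
  measurable (U : set (borel_group G)).
Proof.
move=> cU; rewrite -(setCK U); apply: measurableC.
by apply: open_measurable_group; exact: closed_openC.
Qed.

Lemma measurable_translate (t : G) :
  measurable_fun setT ((fun s => t + s) : borel_group G -> borel_group G).
Proof.
apply: (@borel_measurable_fun (pointed_group G)) => U oU.
by apply: open_measurable_group; apply: open_comp => // s _; exact: continuous_translate.
Qed.

Lemma compact_measurable_group (K : set G) : compact K ->
  measurable (K : set (borel_group G)).
Proof.
by move=> cK; apply: closed_measurable_group; exact: compact_closed.
Qed.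

(** If U were null, so would be every compact set, being covered by finitely many translates of U,
    and then G itself by inner regularity. This makes the normalisation by the volume of [B n]
    legitimate. *)
Lemma haar_open_gt0 (U : set G) : open U -> U !=set0 -> (0 < mu U)%E.
Proof.
have [muT inv _ _ inner_reg] := haar_mu => oU [u Uu].
rewrite lt0e measure_ge0 andbT; apply/eqP => U0; apply: muT.
apply/eqP; rewrite eq_le measure_ge0 andbT inner_reg; last exact: openT.
apply: ub_ereal_sup => _ [K [cK _] <-].
have mU : measurable (U : set (borel_group G)) by exact: open_measurable_group.
have : @cover_compact (pointed_group G) K by rewrite -compact_cover.
move=> /(_ G K (fun k => [set (k - u) + s | s in U])).
case; first by move=> k _; exact: open_translate.
  by move=> k Kk; exists k => //; exists u => //; rewrite subrK.
move=> D _ KD.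
have mD i : measurable ([set (i - u) + s | s in U] : set (borel_group G)).
  by apply: open_measurable_group; exact: open_translate.
move: KD; set C := cover _ _ => KC.
have mC : measurable (C : set (borel_group G)) by exact: fin_bigcup_measurable.
have KU : (mu K <= mu C)%E.
  by apply: le_measure; rewrite ?inE//; exact: compact_measurable_group.
apply: le_trans KU _; rewrite /C /cover bigcup_fset.
suff [_ ->] : measurable (\big[setU/set0]_(i <- finmap.enum_fset D)
    [set i - u + s | s in U] : set (borel_group G)) /\
  mu (\big[setU/set0]_(i <- finmap.enum_fset D) [set i - u + s | s in U]) = 0%E by [].
apply: (@big_ind _ (fun A : set (borel_group G) => measurable A /\ mu A = 0%E)) => //.
- move=> A A' [mA A0] [mA' A'0]; split; first exact: measurableU.
  by rewrite measureU0.
- by move=> i _; split=> //; rewrite inv.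
Qed.

Variable B : nat -> set G.
Hypothesis folnerB : folner mu B.

Lemma measurable_folner n : measurable (B n : set (borel_group G)).
Proof.
by have [/(_ n)[_ oB _] _] := folnerB; exact: open_measurable_group.
Qed.

Lemma folner_lty n : (mu (B n) < +oo)%E.
Proof.
have [/(_ n)[_ oB pB] _] := folnerB; have [_ _ fin _ _] := haar_mu.
move: pB; rewrite precompactE => cB; apply: le_lt_trans (fin _ cB).
apply: le_measure; rewrite ?inE; last exact: subset_closure.
  exact: open_measurable_group.
exact: compact_measurable_group.
Qed.

Definition vol n : R := fine (mu (B n)).

Lemma vol_gt0 n : 0 < vol n.
Proof.
have [/(_ n)[B0 oB _] _] := folnerB.
by apply: fine_gt0; rewrite haar_open_gt0// folner_lty.
Qed.

Definition rbounded (h : G -> R) :=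
  measurable_fun setT (h : borel_group G -> R) /\
  exists M : R, forall x, `|h x| <= M.

Definition ravg n (h : G -> R) : R :=
  (vol n)^-1 * \int[mu]_(s in (B n : set (borel_group G))) (h : borel_group G -> R) s.

Lemma rbounded_cst (c : R) : rbounded (fun=> c).
Proof. by split; [exact: measurable_cst|exists `|c|]. Qed.

Lemma rboundedD h k : rbounded h -> rbounded k -> rbounded (fun x => h x + k x).
Proof.
move=> [mh [M hM]] [mk [N kN]]; split; first exact: measurable_funD.
by exists (M + N) => x; apply: le_trans (ler_normD _ _) (lerD _ _).
Qed.

Lemma rboundedM h k : rbounded h -> rbounded k -> rbounded (fun x => h x * k x).
Proof.
move=> [mh [M hM]] [mk [N kN]]; split; first exact: measurable_funM.
by exists (M * N) => x; rewrite normrM ler_pM.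
Qed.

Lemma rboundedZ c h : rbounded h -> rbounded (fun x => c * h x).
Proof. by apply: rboundedM; exact: rbounded_cst. Qed.

Lemma rboundedB h k : rbounded h -> rbounded k -> rbounded (fun x => h x - k x).
Proof.
move=> bh bk; have := rboundedD bh (rboundedZ (-1) bk).
by under eq_fun do rewrite mulN1r.
Qed.

Lemma rbounded_norm h : rbounded h -> rbounded (fun x => `|h x|).
Proof.
move=> [mh [M hM]]; split; first exact: measurableT_comp.
by exists M => x; rewrite normr_id.
Qed.

Lemma rbounded_translate t h : rbounded h -> rbounded (fun s => h (t + s)).
Proof.
move=> [mh [M hM]]; split; last by exists M => x.
exact: (measurableT_comp mh (measurable_translate t)).
Qed.

Lemma rbounded_integrable (D : set (borel_group G)) h : measurable D ->
  (mu D < +oo)%E -> rbounded h ->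
  mu.-integrable D (EFin \o (h : borel_group G -> R)).
Proof.
move=> mD Dfin [mh [M hM]]; apply: (bounded_integrable (M := M)) => //.
exact: measurable_funTS.
Qed.

Lemma rbounded_restrict_integrable (D : set (borel_group G)) h : measurable D ->
  (mu D < +oo)%E -> rbounded h ->
  mu.-integrable setT (EFin \o ((h : borel_group G -> R) \_ D)).
Proof.
move=> mD Dfin bh; rewrite -restrict_EFin.
exact: (proj1 (integrable_mkcond _ mD) (rbounded_integrable mD Dfin bh)).
Qed.

Let rint n h : rbounded h ->
  mu.-integrable (B n : set (borel_group G)) (EFin \o (h : borel_group G -> R)).
Proof.
by apply: rbounded_integrable; [exact: measurable_folner|exact: folner_lty].
Qed.

Lemma ravgD n h k : rbounded h -> rbounded k ->
  ravg n (fun x => h x + k x) = ravg n h + ravg n k.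
Proof.
move=> bh bk; rewrite /ravg RintegralD ?mulrDr//; try exact: rint.
exact: measurable_folner.
Qed.

Lemma ravgZ n c h : rbounded h -> ravg n (fun x => c * h x) = c * ravg n h.
Proof.
move=> bh; rewrite /ravg RintegralZl; [|exact: measurable_folner|exact: rint].
by rewrite mulrCA.
Qed.

Lemma ravg_cst n c : ravg n (fun=> c) = c.
Proof.
rewrite /ravg Rintegral_cst; last exact: measurable_folner.
by rewrite mulrCA mulVf ?mulr1// gt_eqF// vol_gt0.
Qed.

Lemma ravg_le n h k : rbounded h -> rbounded k -> (forall x, h x <= k x) ->
  ravg n h <= ravg n k.
Proof.
move=> bh bk hk; rewrite /ravg ler_wpM2l ?invr_ge0 ?(ltW (vol_gt0 n))//.
apply: le_Rintegral => //; try exact: rint.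
exact: measurable_folner.
Qed.

Lemma ravg_norm n h : rbounded h -> `|ravg n h| <= ravg n (fun x => `|h x|).
Proof.
move=> bh; rewrite /ravg normrM gtr0_norm ?invr_gt0 ?vol_gt0//.
rewrite ler_wpM2l ?invr_ge0 ?(ltW (vol_gt0 n))//.
by apply: le_normr_Rintegral; [exact: measurable_folner|exact: rint].
Qed.

Lemma Rintegral_translate t (D : set (borel_group G)) h :
  measurable D -> (mu D < +oo)%E -> rbounded h ->
  \int[mu]_(s in D) (h : borel_group G -> R) (t + s) =
  \int[mu]_(s in ([set t + s | s in D] : set (borel_group G)))
    (h : borel_group G -> R) s.
Proof.
move=> mD Dfin bh; have [_ inv _ _ _] := haar_mu; have [mh _] := bh.
pose phi : borel_group G -> borel_group G := fun s => t + s.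
have mphi : measurable_fun setT phi by exact: measurable_translate.
have mtD : measurable ([set t + s | s in D] : set (borel_group G)).
  rewrite (translate_preimage t) -[X in measurable X]setTI.
  exact: (measurable_translate (- t)).
have phiD : phi @^-1` [set t + s | s in D] = D.
  apply/seteqP; split => [s /= [s' Ds' /addrI <-]//|s Ds /=]; by exists s.
congr fine.
have := @integral_pushforward _ _ _ _ R phi mphi mu [set t + s | s in D]
  (EFin \o (h : borel_group G -> R)).
rewrite phiD => <-//; first last.
- by apply: rbounded_integrable => //; exact: rbounded_translate.
- exact/measurable_EFinP.
apply: (@eq_measure_integral _ _ _ _ mu (image_measure mu mphi)) => A mA _.
rewrite -(inv (- t) A mA); congr (mu _).
by rewrite translate_preimage opprK.
Qed.

(** After a change of variables the two integrands h 1_(t + B_n) and h 1_(B_n) differ only on the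
    symmetric difference, by at most M. This is the one place where the Foelner convergence is
    used. *)
Lemma ravg_translate t h : rbounded h ->
  (fun n => ravg n (fun s => h (t + s)) - ravg n h) @ \oo --> (0 : R).
Proof.
move=> bh; have [mh [M hM]] := bh.
have [_ /(_ t) fol] := folnerB; have [_ inv _ _ _] := haar_mu.
pose tB n : set (borel_group G) := [set t + s | s in B n].
pose D n : set (borel_group G) := (B n `\` tB n) `|` (tB n `\` B n).
have mB n := measurable_folner n.
have mtB n : measurable (tB n).
  apply: open_measurable_group; apply: open_translate.
  by have [/(_ n)[]] := folnerB.
have mD n : measurable (D n) by apply: measurableU; exact: measurableD.
have tBfin n : (mu (tB n) < +oo)%E by rewrite inv// folner_lty.
have Dfin n : (mu (D n) < +oo)%E.
  apply: (@le_lt_trans _ _ (mu (B n `|` tB n))).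
    apply: le_measure; rewrite ?inE//; first exact: measurableU.
    by move=> x [[? _]|[? _]]; [left|right].
  by apply: le_lt_trans (measureU2 mu (mB n) (mtB n)) _;
    apply: lte_add_pinfty; [exact: folner_lty|exact: tBfin].
have key n : `|ravg n (fun s => h (t + s)) - ravg n h| <= M * (fine (mu (D n)) / vol n).
  rewrite /ravg -mulrBr normrM gtr0_norm ?invr_gt0 ?vol_gt0//.
  rewrite mulrA [leRHS]mulrC ler_wpM2l ?invr_ge0 ?(ltW (vol_gt0 n))//.
  rewrite Rintegral_translate//; last exact: folner_lty.
  rewrite Rintegral_mkcond [X in _ - X]Rintegral_mkcond -RintegralB//; last 2 first.
  - exact: (rbounded_restrict_integrable (mtB n) (tBfin n) bh).
  - by apply: rbounded_restrict_integrable => //; exact: folner_lty.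
  have iB : mu.-integrable setT (EFin \o (fun x : borel_group G =>
      (h \_ (tB n)) x - (h \_ (B n)) x)).
    exact: (integrableB measurableT
      (rbounded_restrict_integrable (mtB n) (tBfin n) bh)
      (rbounded_restrict_integrable (mB n) (folner_lty n) bh)).
  have iD : mu.-integrable setT (EFin \o (\1_(D n) : borel_group G -> R)).
    have := rbounded_restrict_integrable (mD n) (Dfin n) (rbounded_cst 1).
    by congr (mu.-integrable _ _); apply/funext => x; rewrite /= patchE indicE; case: ifP.
  apply: le_trans (le_normr_Rintegral _ _) _ => //.
  have <- : \int[mu]_x (M * (\1_(D n) : borel_group G -> R) x) = M * fine (mu (D n)).
    rewrite RintegralZl//.
    by congr (_ * _); rewrite /Rintegral integral_indic// setIT.
  apply: le_Rintegral => //.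
  - exact: integrable_norm.
  - exact: integrable_funZ.
  - move=> x _; have M0 : 0 <= M := le_trans (normr_ge0 _) (hM x).
    rewrite !patchE indicE; case: (boolP (x \in tB n)); case: (boolP (x \in B n)) => xB xt.
    + by rewrite subrr normr0 mulr_ge0.
    + rewrite subr0 mem_set ?mulr1//; right; split; first exact: set_mem.
      by move=> /mem_set; apply/negP.
    + rewrite sub0r normrN mem_set ?mulr1//; left; split; first exact: set_mem.
      by move=> /mem_set; apply/negP.
    + by rewrite subrr normr0 mulr_ge0.
apply: norm_cvg0.
apply: (@squeeze_cvgr _ _ _ _ (fun=> 0) (fun n => M * (fine (mu (D n)) / vol n))).
- by apply: nearW => n; rewrite normr_ge0 key.
- exact: cvg_cst.
- by rewrite -(mulr0 M); apply: cvgM; [exact: cvg_cst|exact: fol].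
Qed.
Local Notation Re := (@complex.Re R).
Local Notation Im := (@complex.Im R).
Local Notation bm h := (bounded_measurable (h : borel_group G -> R[i])).
Implicit Types xi : G -> R[i].

Definition rmean (h : G -> R) (a : R) := (fun n => ravg n h) @ \oo --> a.

Lemma has_meanP (h : G -> R[i]) a : has_mean mu B h a <->
  rmean (fun t => Re (h t)) (Re a) /\ rmean (fun t => Im (h t)) (Im a).
Proof.
rewrite /has_mean ccvgP.
have ReE n : Re ((real_complex R (fine (mu (B n))))^-1 * cintegral mu (B n) h) =
    ravg n (fun t => Re (h t)).
  by rewrite -fmorphV ReM /= mul0r subr0.
have ImE n : Im ((real_complex R (fine (mu (B n))))^-1 * cintegral mu (B n) h) =
    ravg n (fun t => Im (h t)).
  by rewrite -fmorphV ImM /= mul0r addr0.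
by under eq_cvg do rewrite ReE; under [X in _ /\ X]eq_cvg do rewrite ImE.
Qed.

Lemma bmP (h : G -> R[i]) :
  bm h <-> rbounded (fun t => Re (h t)) /\ rbounded (fun t => Im (h t)).
Proof.
split=> [[[mr mi] [M hM]]|[[mr [M hM]] [mi [N hN]]]].
  by split; split=> //; exists M => x; apply: le_trans (hM x);
    [exact: normr_Re_le|exact: normr_Im_le].
split; first by split.
by exists (M + N) => x; apply: le_trans (cmodulus_le _) (lerD _ _).
Qed.

Lemma bm_cmodulus (h : G -> R[i]) : bm h -> rbounded (fun t => cmodulus (h t)).
Proof.
move=> [mh [M hM]]; split; first exact: cmeasurable_cmodulus.
by exists M => x; rewrite ger0_norm// cmodulus_ge0.
Qed.

Lemma bm_cst (c : R[i]) : bm (fun=> c).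
Proof. by apply/bmP; split; exact: rbounded_cst. Qed.

Lemma bmD (h k : G -> R[i]) : bm h -> bm k -> bm (fun t => h t + k t).
Proof.
move=> /bmP[hr hi] /bmP[kr ki]; apply/bmP; split.
  by under eq_fun do rewrite ReD; exact: rboundedD.
by under eq_fun do rewrite ImD; exact: rboundedD.
Qed.

Lemma bmM (h k : G -> R[i]) : bm h -> bm k -> bm (fun t => h t * k t).
Proof.
move=> /bmP[hr hi] /bmP[kr ki]; apply/bmP; split.
  by under eq_fun do rewrite ReM; apply: rboundedB; exact: rboundedM.
by under eq_fun do rewrite ImM; apply: rboundedD; exact: rboundedM.
Qed.

Lemma bmZ (c : R[i]) (h : G -> R[i]) : bm h -> bm (fun t => c * h t).
Proof. by apply: bmM; exact: bm_cst. Qed.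

Lemma bmB (h k : G -> R[i]) : bm h -> bm k -> bm (fun t => h t - k t).
Proof.
move=> bh bk; have := bmD bh (bmZ (-1) bk).
by under eq_fun do rewrite mulN1r.
Qed.

Lemma bm_conj (h : G -> R[i]) : bm h -> bm (fun t => (h t)^*%C).
Proof.
move=> [mh [M hM]]; split; first exact: cmeasurable_conj.
by exists M => x; rewrite cmodulus_conj.
Qed.

Lemma bm_translate t (h : G -> R[i]) : bm h -> bm (fun s => h (t + s)).
Proof.
move=> /bmP[hr hi]; apply/bmP; split.
  exact: (rbounded_translate t hr).
exact: (rbounded_translate t hi).
Qed.

Lemma rmeanD h k a b : rbounded h -> rbounded k -> rmean h a -> rmean k b ->
  rmean (fun t => h t + k t) (a + b).
Proof.
move=> bh bk ha kb; rewrite /rmean; under eq_cvg do rewrite ravgD//.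
exact: cvgD.
Qed.

Lemma rmeanZ c h a : rbounded h -> rmean h a -> rmean (fun t => c * h t) (c * a).
Proof.
move=> bh ha; rewrite /rmean; under eq_cvg do rewrite ravgZ//.
by apply: cvgM => //; exact: cvg_cst.
Qed.

Lemma ravgB n h k : rbounded h -> rbounded k ->
  ravg n (fun t => h t - k t) = ravg n h - ravg n k.
Proof.
move=> bh bk; rewrite -mulN1r -ravgZ// -ravgD//; last exact: rboundedZ.
by congr ravg; apply/funext => t; rewrite mulN1r.
Qed.

Lemma rmean_cst c : rmean (fun=> c) c.
Proof. by rewrite /rmean; under eq_cvg do rewrite ravg_cst; exact: cvg_cst. Qed.

Lemma rmean_translate t h a : rbounded h -> rmean h a ->
  rmean (fun s => h (t + s)) a.
Proof.
move=> bh ha; rewrite /rmean.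
rewrite (_ : (fun n => _) = fun n => (ravg n (fun s => h (t + s)) - ravg n h) + ravg n h).
  by rewrite -[a]add0r; apply: cvgD; [exact: ravg_translate|exact: ha].
by apply/funext => n; rewrite subrK.
Qed.

Lemma rmean_le h k a b : rbounded h -> rbounded k -> (forall x, h x <= k x) ->
  rmean h a -> rmean k b -> a <= b.
Proof.
move=> bh bk hk ha kb; apply: (ler_cvg_to ha kb).
by apply: nearW => n; exact: ravg_le.
Qed.

Lemma has_mean_unique (h : G -> R[i]) a b :
  has_mean mu B h a -> has_mean mu B h b -> a = b.
Proof. exact: ccvg_unique. Qed.

Lemma has_meanD (h k : G -> R[i]) a b : bm h -> bm k -> has_mean mu B h a ->
  has_mean mu B k b -> has_mean mu B (fun t => h t + k t) (a + b).
Proof.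
move=> /bmP[hr hi] /bmP[kr ki] /has_meanP[ar ai] /has_meanP[br bi].
apply/has_meanP; rewrite ReD ImD; split.
  by under eq_fun do rewrite ReD; exact: rmeanD.
by under eq_fun do rewrite ImD; exact: rmeanD.
Qed.

Lemma has_meanZ (c : R[i]) (h : G -> R[i]) a : bm h -> has_mean mu B h a ->
  has_mean mu B (fun t => c * h t) (c * a).
Proof.
move=> /bmP[hr hi] /has_meanP[ar ai].
apply/has_meanP; rewrite ReM ImM -mulNr; split.
  under eq_fun do rewrite ReM -mulNr.
  by apply: rmeanD; try apply: rboundedZ; try exact: rmeanZ.
under eq_fun do rewrite ImM.
by apply: rmeanD; try apply: rboundedZ; try exact: rmeanZ.
Qed.

Lemma has_meanB (h k : G -> R[i]) a b : bm h -> bm k -> has_mean mu B h a ->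
  has_mean mu B k b -> has_mean mu B (fun t => h t - k t) (a - b).
Proof.
move=> bh bk ha kb; have := has_meanD bh (bmZ (-1) bk) ha (has_meanZ (c := -1) bk kb).
by rewrite mulN1r; under eq_fun do rewrite mulN1r.
Qed.

Lemma has_mean_conj (h : G -> R[i]) a : bm h -> has_mean mu B h a ->
  has_mean mu B (fun t => (h t)^*%C) (a^*%C).
Proof.
move=> /bmP[hr hi] /has_meanP[ar ai].
apply/has_meanP; rewrite Re_conj Im_conj; split.
  by under eq_fun do rewrite Re_conj.
have := rmeanZ (c := -1) hi ai; rewrite mulN1r.
by congr rmean; apply/funext => t; rewrite Im_conj mulN1r.
Qed.

Lemma has_mean_cst (c : R[i]) : has_mean mu B (fun=> c) c.
Proof. by apply/has_meanP; split; exact: rmean_cst. Qed.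

Lemma has_mean_translate t (h : G -> R[i]) a : bm h -> has_mean mu B h a ->
  has_mean mu B (fun s => h (t + s)) a.
Proof.
move=> /bmP[hr hi] /has_meanP[ar ai]; apply/has_meanP; split.
  exact: (rmean_translate t hr).
exact: (rmean_translate t hi).
Qed.

(** * Characters and trigonometric polynomials *)

Lemma dual_bm xi : dual xi -> bm xi.
Proof.
move=> [/ccontinuousP[rc ic] xi1 _]; split; last by exists 1 => x; rewrite xi1.
by split; exact: (@continuous_borel_measurable _ (pointed_group G)).
Qed.

Lemma dual_one : dual (fun _ : G => 1 : R[i]).
Proof.
split=> [|t|s t]; [exact: cst_continuous|exact: cmodulus1|by rewrite mulr1].
Qed.

Lemma dualM xi eta : dual xi -> dual eta -> dual (fun t => xi t * eta t).
Proof.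
move=> [/ccontinuousP[rc ic] xi1 xiD] [/ccontinuousP[rc' ic'] eta1 etaD]; split.
- apply/ccontinuousP; split.
    under eq_fun do rewrite ReM.
    by apply: (@continuous_funB _ (pointed_group G));
      apply: (@continuous_funM _ (pointed_group G)).
  under eq_fun do rewrite ImM.
  by apply: (@continuous_funD _ (pointed_group G));
    apply: (@continuous_funM _ (pointed_group G)).
- by move=> t; rewrite cmodulusM xi1 eta1 mulr1.
- by move=> s t; rewrite xiD etaD mulrACA.
Qed.

Lemma dual_conj xi : dual xi -> dual (fun t => (xi t)^*%C).
Proof.
move=> [/ccontinuousP[rc ic] xi1 xiD]; split.
- apply/ccontinuousP; split; first by under eq_fun do rewrite Re_conj.
  under eq_fun do rewrite Im_conj -sub0r.
  apply: (@continuous_funB _ (pointed_group G)) => //; exact: cst_continuous.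
- by move=> t; rewrite cmodulus_conj.
- by move=> s t; rewrite xiD rmorphM.
Qed.

Lemma dual_conjM xi : dual xi -> forall t, xi t * (xi t)^*%C = 1.
Proof.
move=> [_ xi1 _] t; have := sqr_cmodulus (xi t); rewrite xi1 expr1n => h.
by apply: complex_ext; rewrite ?ReM ?ImM Re_conj Im_conj /=;
  [rewrite mulrN opprK -!expr2 -h|ring].
Qed.

(* Translating by t with xi t <> 1 multiplies the averages by xi t while
   changing them by o(1), so they tend to 0. *)
Lemma has_mean_char xi : dual xi -> xi <> (fun=> 1) -> has_mean mu B xi 0.
Proof.
move=> dxi xi_neq1; have bxi := dual_bm dxi; have [_ _ xiD] := dxi.
have [t xit] : exists t, xi t != 1.
  apply: contrapT => H; apply: xi_neq1; apply/funext => t.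
  by apply/eqP/negPn/negP => xit; apply: H; exists t.
have /bmP[bxr bxi_] := bxi.
have bt := bm_translate t bxi.
have bd : bm (fun s => xi (t + s) - xi s) by exact: bmB.
have d0 : has_mean mu B (fun s => xi (t + s) - xi s) 0.
  have /bmP[btr bti] := bt.
  apply/has_meanP; split; rewrite /rmean.
    rewrite (_ : (fun n => _) = fun n => ravg n (fun s => Re (xi (t + s))) -
        ravg n (fun s => Re (xi s))); first exact: (ravg_translate t bxr).
    apply/funext => n; rewrite -ravgB//; congr ravg.
    by apply/funext => s; rewrite ReD ReN.
  rewrite (_ : (fun n => _) = fun n => ravg n (fun s => Im (xi (t + s))) -
      ravg n (fun s => Im (xi s))); first exact: (ravg_translate t bxi_).
  apply/funext => n; rewrite -ravgB//; congr ravg.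
  by apply/funext => s; rewrite ImD ImN.
have := has_meanZ (c := (xi t - 1)^-1) bd d0; rewrite mulr0.
congr has_mean; apply/funext => s.
by rewrite xiD; field; rewrite subr_eq0.
Qed.

(** As an inductive closure, products, conjugates, means and the transfer to L^2 are inductions,
    without reindexing of sums or collecting of repeated characters. *)
Inductive trigpoly : (G -> R[i]) -> Prop :=
| trigpoly_char (c : R[i]) xi : dual xi -> trigpoly (fun t => c * xi t)
| trigpoly_add h k : trigpoly h -> trigpoly k -> trigpoly (fun t => h t + k t).

Lemma trigpolyZ (c : R[i]) h : trigpoly h -> trigpoly (fun t => c * h t).
Proof.
elim=> {h} [a xi dxi|h k _ IHh _ IHk].
  by under eq_fun do rewrite mulrA; exact: trigpoly_char.
by under eq_fun do rewrite mulrDr; exact: trigpoly_add.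
Qed.

Lemma trigpolyM h k : trigpoly h -> trigpoly k -> trigpoly (fun t => h t * k t).
Proof.
elim=> {h} [c xi dxi|h h' _ IHh _ IHh'] tk; last first.
  by under eq_fun do rewrite mulrDl; apply: trigpoly_add; [exact: IHh|exact: IHh'].
elim: tk => {k} [a eta deta|k k' _ IHk _ IHk'].
  under eq_fun do rewrite mulrACA.
  by apply: trigpoly_char; exact: dualM.
by under eq_fun do rewrite mulrDr; exact: trigpoly_add.
Qed.

Lemma trigpoly_conj h : trigpoly h -> trigpoly (fun t => (h t)^*%C).
Proof.
elim=> {h} [c xi dxi|h h' _ IHh _ IHh'].
  by under eq_fun do rewrite rmorphM; apply: trigpoly_char; exact: dual_conj.
by under eq_fun do rewrite rmorphD; exact: trigpoly_add.
Qed.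

Lemma trigpoly_cst (c : R[i]) : trigpoly (fun=> c).
Proof.
by have := trigpoly_char c dual_one; under eq_fun do rewrite mulr1.
Qed.

Lemma trigpoly_dual xi : dual xi -> trigpoly xi.
Proof. by move=> /(trigpoly_char 1); under eq_fun do rewrite mul1r. Qed.

Lemma trigpoly_sum (k : nat) (xi : 'I_k -> G -> R[i]) (c : 'I_k -> R[i]) :
  (forall j, dual (xi j)) -> trigpoly (fun t => \sum_(j < k) c j * xi j t).
Proof.
elim: k xi c => [|k IH] xi c dxi.
  by under eq_fun do rewrite big_ord0; exact: trigpoly_cst.
under eq_fun do rewrite big_ord_recr/=.
by apply: trigpoly_add; [apply: IH|exact: trigpoly_char].
Qed.

Lemma trigpoly_bm h : trigpoly h -> bm h.
Proof.
elim=> {h} [c xi dxi|h k _ IHh _ IHk]; last exact: bmD.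
by apply: bmZ; exact: dual_bm.
Qed.

Lemma trigpoly_has_mean h : trigpoly h -> exists a, has_mean mu B h a.
Proof.
elim=> {h} [c xi dxi|h k th [a ha] tk [b kb]]; last first.
  by exists (a + b); apply: has_meanD => //; exact: trigpoly_bm.
have bxi := dual_bm dxi.
have [->|xi1] := pselect (xi = fun=> 1); first by exists (c * 1); exact: has_mean_cst.
by exists (c * 0); apply: has_meanZ => //; exact: has_mean_char.
Qed.

(** * Besicovitch almost periodic functions and their means *)

Definition besicovitch_ap (h : G -> R[i]) := bm h /\
  forall e : R, 0 < e -> exists Q, trigpoly Q /\
    \forall n \near \oo, ravg n (fun t => cmodulus (h t - Q t)) < e.

(** A limsup below e means a supremum below e on some tail; the eventual form stays within real
    numbers. *)
Lemma besicovitch_apP h : besicovitch mu B h -> besicovitch_ap h.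
Proof.
move=> [bh H]; split=> // e /H[k [xi [c [dxi lt]]]].
exists (fun t => \sum_(j < k) c j * xi j t); split; first exact: trigpoly_sum.
move: lt; rewrite /upper_mean /limn_esup /limf_esup.
move=> /ereal_inf_lt[_ [V [N _ NV] <-] lt].
exists N => // n /NV Vn; rewrite -lte_fin; apply: le_lt_trans lt.
by apply: ereal_sup_ubound; exists n.
Qed.

Lemma besicovitch_apM h w : besicovitch_ap h -> trigpoly w ->
  besicovitch_ap (fun t => h t * w t).
Proof.
move=> [bh H] tw; have bw := trigpoly_bm tw; split; first exact: bmM.
have [_ [M wM]] := bw.
have M0 : 0 < `|M| + 1 by rewrite ltr_wpDl.
move=> e e0; have [Q [tQ hQ]] := H _ (divr_gt0 e0 M0).
exists (fun t => Q t * w t); split; first exact: trigpolyM.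
apply: filterS hQ => n; rewrite ltr_pdivlMr//; apply: le_lt_trans.
rewrite mulrC -ravgZ; last by apply: bm_cmodulus; apply: bmB => //; exact: trigpoly_bm.
have bQ := trigpoly_bm tQ.
apply: ravg_le.
- by apply: bm_cmodulus; apply: bmB; exact: bmM.
- by apply: rboundedZ; apply: bm_cmodulus; exact: bmB.
- move=> t; rewrite -mulrBl cmodulusM mulrC ler_wpM2r ?cmodulus_ge0//.
  by apply: le_trans (wM t) _; rewrite ler_wpDr// ler_norm.
Qed.

(** The averages of h eventually lie within e of the limit a of the averages of k, so they form a
    Cauchy sequence. *)
Lemma rmean_approx h : rbounded h ->
  (forall e, 0 < e -> exists k a, [/\ rbounded k, rmean k a &
    \forall n \near \oo, ravg n (fun t => `|h t - k t|) < e]) ->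
  exists a, rmean h a.
Proof.
move=> bh H; suff : cvg ((fun n => ravg n h) @ \oo) by move=> /cvg_ex.
apply: R_complete; apply: cauchy_exP => e e0.
have e2 : 0 < e / 2 by rewrite divr_gt0.
have [k [a [bk /cvgrPdist_lt ka hk]]] := H _ e2; exists a.
have := ka _ e2; apply: filterS2 hk => n hk kn.
rewrite /= -ball_normE /= (splitr e).
rewrite (_ : a - ravg n h = (a - ravg n k) + (ravg n k - ravg n h)); last by ring.
apply: le_lt_trans (ler_normD _ _) (ltrD kn _).
apply: le_lt_trans hk; rewrite -normrN opprB -ravgB//.
by apply: ravg_norm; exact: rboundedB.
Qed.

Lemma besicovitch_ap_has_mean h : besicovitch_ap h -> exists a, has_mean mu B h a.
Proof.
move=> [bh H]; have /bmP[bhr bhi] := bh.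
have [ar har] : exists a, rmean (fun t => Re (h t)) a.
  apply: rmean_approx => // e /H[Q [tQ hQ]]; have bQ := trigpoly_bm tQ.
  have /bmP[bQr bQi] := bQ; have [a /has_meanP[Qa _]] := trigpoly_has_mean tQ.
  exists (fun t => Re (Q t)), (Re a); split=> //; apply: filterS hQ => n.
  apply: le_lt_trans; apply: ravg_le.
  - by apply: rbounded_norm; exact: rboundedB.
  - by apply: bm_cmodulus; exact: bmB.
  - by move=> t; rewrite -ReN -ReD normr_Re_le.
have [ai hai] : exists a, rmean (fun t => Im (h t)) a.
  apply: rmean_approx => // e /H[Q [tQ hQ]]; have bQ := trigpoly_bm tQ.
  have /bmP[bQr bQi] := bQ; have [a /has_meanP[_ Qa]] := trigpoly_has_mean tQ.
  exists (fun t => Im (Q t)), (Im a); split=> //; apply: filterS hQ => n.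
  apply: le_lt_trans; apply: ravg_le.
  - by apply: rbounded_norm; exact: rboundedB.
  - by apply: bm_cmodulus; exact: bmB.
  - by move=> t; rewrite -ImN -ImD normr_Im_le.
by exists (Complex ar ai); apply/has_meanP.
Qed.

(** * Real trigonometric polynomials, truncation and quadratic mean *)

Definition rtrig (u : G -> R) := trigpoly (fun t => (u t)%:C%C).

Lemma rtrigD u v : rtrig u -> rtrig v -> rtrig (fun t => u t + v t).
Proof. by move=> tu tv; rewrite /rtrig; under eq_fun do rewrite rmorphD; exact: trigpoly_add. Qed.

Lemma rtrigM u v : rtrig u -> rtrig v -> rtrig (fun t => u t * v t).
Proof. by move=> tu tv; rewrite /rtrig; under eq_fun do rewrite rmorphM; exact: trigpolyM. Qed.

Lemma rtrig_cst c : rtrig (fun=> c).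
Proof. exact: trigpoly_cst. Qed.

Lemma rtrigZ c u : rtrig u -> rtrig (fun t => c * u t).
Proof. by apply: rtrigM; exact: rtrig_cst. Qed.

Lemma rtrigB u v : rtrig u -> rtrig v -> rtrig (fun t => u t - v t).
Proof.
move=> tu tv; have := rtrigD tu (rtrigZ (-1) tv).
by rewrite /rtrig; under eq_fun do rewrite mulN1r.
Qed.

Lemma rtrig_Re Q : trigpoly Q -> rtrig (fun t => Re (Q t)).
Proof.
move=> tQ; have := trigpolyZ (2^-1)%:C%C (trigpoly_add tQ (trigpoly_conj tQ)).
congr trigpoly; apply/funext => t.
by apply: complex_ext; rewrite !ReImE /=; field.
Qed.

Lemma rtrig_Im Q : trigpoly Q -> rtrig (fun t => Im (Q t)).
Proof.
move=> tQ; have := rtrig_Re (trigpolyZ (Complex 0 (-1)) tQ).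
by congr rtrig; apply/funext => t; rewrite ReM /=; ring.
Qed.

(* Polynomials a_n(x^2) increasing to |x| uniformly on [-1, 1]. *)
Fixpoint abs_poly (n : nat) (u : G -> R) (t : G) : R :=
  if n is n'.+1 then
    abs_poly n' u t + 2^-1 * (u t * u t - abs_poly n' u t * abs_poly n' u t)
  else 0.

Lemma rtrig_abs_poly n u : rtrig u -> rtrig (abs_poly n u).
Proof.
move=> tu; elim: n => [|n IH] /=; first exact: rtrig_cst.
by apply: rtrigD => //; apply: rtrigZ; apply: rtrigB; exact: rtrigM.
Qed.

(** For x = |u t| and e = x - a_n, the recursion gives a new error e (1 - (x + a_n)/2) = e (1 - x +
    e/2), at most e (1 - e/2) because e <= x. Iterating e -> e (1 - e/2) decays like 2/n, whatever x
    is; hence the uniform bound 2/(n + 2). *)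
Lemma abs_poly_le n u t : `|u t| <= 1 ->
  [/\ 0 <= abs_poly n u t, abs_poly n u t <= `|u t| &
      n.+2%:R * (`|u t| - abs_poly n u t) <= 2].
Proof.
have uu : u t * u t = `|u t| * `|u t| by rewrite -normrM ger0_norm// -expr2 sqr_ge0.
elim: n => [|n IH] u1 /=; first by rewrite subr0 normr_ge0; split=> //; lra.
have [] := IH u1; rewrite uu; move: (abs_poly n u t) => a.
have := normr_ge0 (u t); move: `|u t| u1 => x x1 x0 a0 ax kx.
split; [nra|nra|].
have k2 : 0 <= n%:R :> R by [].
have -> : n.+3%:R = n.+2%:R + 1 :> R by rewrite natr1.
rewrite -addn2 natrD in kx *; move: (n%:R) k2 kx => k k0.
set e := x - a => kx.
have -> : x - (a + 2^-1 * (x * x - a * a)) = e * (1 - x + e / 2) by rewrite /e; field.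
have e0 : 0 <= e by rewrite /e; lra.
have ex : e <= x by rewrite /e; lra.
have h1 : e * (1 - x + e / 2) <= e * (1 - e / 2) by nra.
have k3 : 0 <= k + 2 + 1 by lra.
apply: le_trans (ler_wpM2l k3 h1) _; rewrite -subr_ge0.
rewrite (_ : 2 - _ = (2 - (k + 2) * e) * (1 - e / 2) + e ^+ 2 / 2); last by field.
by rewrite addr_ge0 ?mulr_ge0 ?sqr_ge0//; lra.
Qed.

Lemma rtrig_abs_approx u C e : rtrig u -> (forall t, `|u t| <= C) -> 0 < e ->
  exists v, rtrig v /\ forall t, `| `|u t| - v t| <= e.
Proof.
move=> tu uC e0; pose D := `|C| + 1.
have D0 : 0 < D by rewrite ltr_wpDl.
pose w t := D^-1 * u t.
have w1 t : `|w t| <= 1.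
  rewrite normrM gtr0_norm ?invr_gt0// mulrC ler_pdivrMr// mul1r.
  by apply: le_trans (uC t) _; rewrite ler_wpDr// ler_norm.
(* After rescaling by D, the error 2 D / (n + 2) is at most e. *)
pose n := Num.truncn (2 * D / e).
exists (fun t => D * abs_poly n w t); split.
  by apply: rtrigZ; apply: rtrig_abs_poly; exact: rtrigZ.
move=> t; have [a0 a1 an] := abs_poly_le n (w1 t).
have -> : `|u t| = D * `|w t|.
  by rewrite /w normrM gtr0_norm ?invr_gt0// mulrA divff ?mul1r// gt_eqF.
rewrite -mulrBr normrM gtr0_norm// ger0_norm ?subr_ge0//.
have n2 : 0 < n.+2%:R :> R by rewrite ltr0n.
rewrite -(ler_pM2l n2) mulrCA.
apply: le_trans (ler_wpM2l (ltW D0) an) _.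
rewrite -ler_pdivrMr// [D * 2]mulrC; apply/ltW; apply: lt_trans (truncnS_gt _) _.
by rewrite ltr_nat.
Qed.

(* |f - v| <= |f - u| + e when v is e-close to the truncation of u at height M. *)
Lemma rtrig_clamp_approx h u M C e : rtrig u -> (forall t, `|u t| <= C) ->
  (forall t, `|h t| <= M) -> 0 < e ->
  exists v, rtrig v /\ forall t, (h t - v t) ^+ 2 <= (2 * M + e) * (`|h t - u t| + e).
Proof.
move=> tu uC hM e0.
have tuM : rtrig (fun t => u t + M) by apply: rtrigD => //; exact: rtrig_cst.
have tuN : rtrig (fun t => u t - M) by apply: rtrigB => //; exact: rtrig_cst.
have uMb t : `|u t + M| <= C + `|M| by apply: le_trans (ler_normD _ _) _; rewrite lerD2r.
have uNb t : `|u t - M| <= C + `|M| by apply: le_trans (ler_normB _ _) _; rewrite lerD2r.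
have [v1 [tv1 h1]] := rtrig_abs_approx tuM uMb e0.
have [v2 [tv2 h2]] := rtrig_abs_approx tuN uNb e0.
exists (fun t => 2^-1 * (v1 t - v2 t)); split.
  by apply: rtrigZ; exact: rtrigB.
move=> t; have := h1 t; have := h2 t; have := hM t.
move: (h t) (u t) (v1 t) (v2 t) => a b c d aM h2' h1'.
(* The truncation of b to [-M, M], written with absolute values. Since a lies in [-M, M], truncating
   b does not move it away from a. *)
pose a' := 2^-1 * (`|b + M| - `|b - M|).
have M0 : 0 <= M := le_trans (normr_ge0 _) aM.
have [a'M a'b] : `|a'| <= M /\ `|a - a'| <= `|a - b|.
  move: aM; rewrite ler_norml => /andP[aM1 aM2].
  case: (lerP M b) => bM.
    have -> : a' = M by rewrite /a' !ger0_norm; [field|lra|lra].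
    by rewrite ger0_norm// !ler0_norm; [split; lra|lra|lra].
  case: (lerP b (- M)) => bN.
    have -> : a' = - M by rewrite /a' !ler0_norm; [field|lra|lra].
    by rewrite normrN !ger0_norm//; [split; lra|lra|lra].
  have -> : a' = b by rewrite /a' ger0_norm ?ler0_norm; [field|lra|lra].
  by split=> //; rewrite ler_norml; lra.
set x := a - _.
have xa : `|x - (a - a')| <= e.
  rewrite (_ : x - (a - a') = 2^-1 * ((`|b + M| - c) - (`|b - M| - d))); last first.
    by rewrite /x /a'; ring.
  rewrite normrM ger0_norm//; have := ler_normB (`|b + M| - c) (`|b - M| - d).
  by move: h1' h2'; lra.
have xa' : `|x| <= `|a - a'| + e.
  rewrite -[x](subrK (a - a')) addrC.
  by apply: le_trans (ler_normD _ _) _; rewrite lerD2l.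
have xM : `|x| <= 2 * M + e.
  apply: le_trans xa' _; rewrite lerD2r.
  by apply: le_trans (ler_normB _ _) _; lra.
have xu : `|x| <= `|a - b| + e by apply: le_trans xa' _; rewrite lerD2r.
(* One factor of the square is bounded by the sup norm, the other by the L^1 error. *)
by rewrite -(real_normK (num_real x)) expr2 ler_pM.
Qed.

(** An L^1 approximation becomes a quadratic one once the approximant is essentially bounded by the
    sup norm of h; real and imaginary parts are truncated separately. *)
Lemma besicovitch_ap_square h : besicovitch_ap h -> forall e : R, 0 < e ->
  exists Q, trigpoly Q /\
    \forall n \near \oo, ravg n (fun t => cmodulus (h t - Q t) ^+ 2) < e.
Proof.
move=> [bh H] e e0; have [_ [M' hM']] := bh.
pose M := `|M'| + 1.
have hM t : cmodulus (h t) <= M.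
  by apply: le_trans (hM' t) _; rewrite ler_wpDr// ler_norm.
have M1 : 1 <= M by rewrite lerDr.
pose K := 2 * M + 1.
have K0 : 0 < K by rewrite /K; lra.
(* d <= 1 gives 2 M + d <= K. The two parts together cost 2 K times the mean of |h - P| + d, which
   is below 2 K (d + d). *)
have [d [d0 d1 dK]] : exists d : R, [/\ 0 < d, d <= 1 & 4 * K * d <= e].
  exists (Num.min 1 (e / (4 * K))); split.
  - by rewrite lt_min ltr01 divr_gt0// mulr_gt0.
  - by rewrite ge_min lexx.
  - by rewrite mulrC -ler_pdivlMr ?mulr_gt0// ge_min lexx orbT.
have [P [tP hP]] := H _ d0; have bP := trigpoly_bm tP; have [_ [C PC]] := bP.
have [vr [tvr hvr]] : exists v, rtrig v /\
    forall t, (Re (h t) - v t) ^+ 2 <= (2 * M + d) * (`|Re (h t) - Re (P t)| + d).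
  apply: (rtrig_clamp_approx (C := C)) => //; first exact: rtrig_Re.
  - by move=> t; apply: le_trans (normr_Re_le _) (PC t).
  - by move=> t; apply: le_trans (normr_Re_le _) (hM t).
have [vi [tvi hvi]] : exists v, rtrig v /\
    forall t, (Im (h t) - v t) ^+ 2 <= (2 * M + d) * (`|Im (h t) - Im (P t)| + d).
  apply: (rtrig_clamp_approx (C := C)) => //; first exact: rtrig_Im.
  - by move=> t; apply: le_trans (normr_Im_le _) (PC t).
  - by move=> t; apply: le_trans (normr_Im_le _) (hM t).
pose Q t := (vr t)%:C%C + Complex 0 1 * (vi t)%:C%C.
have tQ : trigpoly Q by apply: trigpoly_add => //; exact: trigpolyZ.
exists Q; split=> //; have bQ := trigpoly_bm tQ.
apply: filterS hP => n hP.
have bhP : rbounded (fun t => cmodulus (h t - P t)) by apply: bm_cmodulus; exact: bmB.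
apply: (@le_lt_trans _ _ (ravg n (fun t => 2 * K * (cmodulus (h t - P t) + d)))).
  apply: ravg_le.
  - have b := bm_cmodulus (bmB bh bQ).
    by under eq_fun do rewrite expr2; exact: rboundedM.
  - by apply: rboundedZ; apply: rboundedD => //; exact: rbounded_cst.
  - move=> t; rewrite sqr_cmodulus.
    have -> : Re (h t - Q t) = Re (h t) - vr t by rewrite !ReImE /=; ring.
    have -> : Im (h t - Q t) = Im (h t) - vi t by rewrite !ReImE /=; ring.
    have hr : `|Re (h t) - Re (P t)| <= cmodulus (h t - P t).
      by rewrite -ReN -ReD normr_Re_le.
    have hi : `|Im (h t) - Im (P t)| <= cmodulus (h t - P t).
      by rewrite -ImN -ImD normr_Im_le.
    have Kd : 2 * M + d <= K by rewrite /K lerD2l.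
    have Kd0 : 0 <= 2 * M + d by lra.
    rewrite [leRHS](_ : _ = K * (cmodulus (h t - P t) + d) + K * (cmodulus (h t - P t) + d)); last by ring.
    rewrite lerD//.
      apply: le_trans (hvr t) _; apply: ler_pM => //; last by rewrite lerD2r.
      by rewrite addr_ge0 ?normr_ge0 ?(ltW d0).
    apply: le_trans (hvi t) _; apply: ler_pM => //; last by rewrite lerD2r.
    by rewrite addr_ge0 ?normr_ge0 ?(ltW d0).
rewrite ravgZ; last by apply: rboundedD => //; exact: rbounded_cst.
rewrite ravgD ?ravg_cst//; last exact: rbounded_cst.
apply: lt_le_trans dK; rewrite (_ : 4 * K * d = 2 * K * (d + d)); last by ring.
by rewrite ltr_pM2l ?ltrD2r// mulr_gt0.
Qed.

(** * The measure generated by the orbit of p *)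

Variables (X : ptopologicalType) (act : G -> X -> X) (p : X).
Hypothesis dynXG : dynamical_system R act.
Hypothesis bap_p : besicovitch_point act mu B p.

Let cX : compact [set: X]. Proof. by case: dynXG. Qed.
Let mX : metrizable R X. Proof. by case: dynXG. Qed.
Let actD s t x : act (s + t) x = act s (act t x). Proof. by case: dynXG. Qed.
Let act0 x : act 0 x = x. Proof. by case: dynXG. Qed.

Lemma continuous_act t : continuous (act t).
Proof.
have [_ _ _ _ ac] := dynXG => x.
apply: (@continuous_comp _ _ _ (fun x => (t, x)) (fun tx => act tx.1 tx.2)).
  by apply: cvg_pair; [exact: cvg_cst|exact: cvg_id].
exact: ac.
Qed.

Lemma measurable_act t : measurable_fun setT (act t : borel X -> borel X).
Proof.
apply: borel_measurable_fun => U oU; apply: open_borel.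
by apply: open_comp => // x _; exact: continuous_act.
Qed.

Lemma continuous_fun_act t (f : X -> R) : continuous f ->
  continuous (fun x => f (act t x)).
Proof.
move=> fc x; apply: (@continuous_comp _ _ _ (act t) f); first exact: continuous_act.
exact: fc.
Qed.

Lemma ccontinuous_act t (f : X -> R[i]) : ccontinuous f ->
  ccontinuous (fun x => f (act t x)).
Proof.
move=> /ccontinuousP[rc ic]; apply/ccontinuousP; split.
  exact: (@continuous_fun_act t (fun x => Re (f x))).
exact: (@continuous_fun_act t (fun x => Im (f x))).
Qed.

Lemma ccontinuous_real (f : X -> R) : continuous f ->
  ccontinuous (fun x => (f x)%:C%C).
Proof. by move=> fc; apply/ccontinuousP; split=> //; exact: cst_continuous. Qed.

Lemma ccontinuousM_conj (f g : X -> R[i]) : ccontinuous f -> ccontinuous g ->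
  ccontinuous (fun x => f x * (g x)^*%C).
Proof.
move=> /ccontinuousP[rf imf] /ccontinuousP[rg img]; apply/ccontinuousP; split.
  under eq_fun do rewrite ReM Re_conj Im_conj mulrN opprK.
  by apply: continuous_funD; exact: continuous_funM.
under eq_fun do rewrite ImM Re_conj Im_conj mulrN addrC.
by apply: continuous_funB; exact: continuous_funM.
Qed.

Lemma orbit_besicovitch_ap (f : X -> R[i]) : ccontinuous f ->
  besicovitch_ap (fun t => f (act t p)).
Proof. by move=> fc; apply: besicovitch_apP; exact: bap_p. Qed.

Lemma orbit_bm (f : X -> R[i]) : ccontinuous f -> bm (fun t => f (act t p)).
Proof. by move=> /orbit_besicovitch_ap[]. Qed.

Lemma orbit_rbounded (f : X -> R) : continuous f ->
  rbounded (fun t => f (act t p)).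
Proof. by move=> /ccontinuous_real/orbit_bm/bmP[]. Qed.

Lemma rtrig_rbounded u : rtrig u -> rbounded u.
Proof. by move=> /trigpoly_bm/bmP[]. Qed.

Lemma orbit_rmean_ex (w : G -> R) (f : X -> R) : rtrig w -> continuous f ->
  exists a, rmean (fun t => f (act t p) * w t) a.
Proof.
move=> tw fc.
have [a /has_meanP[ha _]] := besicovitch_ap_has_mean
  (besicovitch_apM (orbit_besicovitch_ap (ccontinuous_real fc)) tw).
exists (Re a); move: ha; congr rmean; apply/funext => t.
by rewrite ReM /= mulr0 subr0.
Qed.

Lemma rmean_unique h a b : rmean h a -> rmean h b -> a = b.
Proof. by move=> ha hb; exact: (cvg_unique _ ha hb). Qed.

Lemma orbit_measure (w : G -> R) : rtrig w -> (forall t, 0 <= w t) ->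
  exists nu : {measure set (borel X) -> \bar R}, (nu setT < +oo)%E /\
    forall f : X -> R, continuous f ->
      rmean (fun t => f (act t p) * w t) (\int[nu]_x (f : borel X -> R) x).
Proof.
move=> tw w0.
(* [lim] assigns a value to every f; it is identified with the mean for continuous f only. *)
pose L (f : X -> R) : R := lim ((fun n => ravg n (fun t => f (act t p) * w t)) @ \oo).
have LP (f : X -> R) : continuous f -> rmean (fun t => f (act t p) * w t) (L f).
  move=> fc; have [a ha] := orbit_rmean_ex tw fc.
  by rewrite /L (cvg_lim _ ha).
have bw := rtrig_rbounded tw.
have bfw (f : X -> R) : continuous f -> rbounded (fun t => f (act t p) * w t).
  by move=> fc; apply: rboundedM => //; exact: orbit_rbounded.
have posL : positive_functional L.
  split.
  - move=> f g fc gc; apply: rmean_unique (LP _ (continuous_funD fc gc)) _.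
    under eq_fun do rewrite mulrDl.
    by apply: rmeanD; [exact: bfw|exact: bfw|exact: LP|exact: LP].
  - move=> a f fc.
    have ac : continuous (fun x => a * f x).
      by apply: continuous_funM => //; exact: cst_continuous.
    apply: rmean_unique (LP _ ac) _.
    under eq_fun do rewrite -mulrA.
    by apply: rmeanZ; [exact: bfw|exact: LP].
  - move=> f fc f0.
    have fw0 t : 0 <= f (act t p) * w t by rewrite mulr_ge0.
    exact: (rmean_le (rbounded_cst 0) (bfw _ fc) fw0 (@rmean_cst 0) (LP _ fc)).
have [nu [nufin nuL]] := riesz_representation posL cX mX.
by exists nu; split=> // f fc; rewrite nuL//; exact: LP.
Qed.

Lemma generic_measure_ex : exists m : probability (borel X) R, generic act m mu B p.
Proof.
have [nu [nufin nuP]] := orbit_measure (rtrig_cst 1) (fun=> ler01).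
have nuT : fine (nu setT) = 1.
  apply: (@rmean_unique (fun=> 1)); last exact: rmean_cst.
  have := nuP _ (@cst_continuous X R (1 : R)).
  rewrite Rintegral_cst// (mul1r (fine _)).
  by under eq_fun do rewrite mul1r.
have nu1 : nu setT = 1%E by rewrite -[LHS]fineK ?nuT ?ge0_fin_numE.
exists (probability_of_measure nu1) => f /ccontinuousP[rc ic]; apply/has_meanP; split.
  by have := nuP _ rc; under eq_fun do rewrite mulr1.
by have := nuP _ ic; under eq_fun do rewrite mulr1.
Qed.

Variable m : probability (borel X) R.
Hypothesis gen_m : generic act m mu B p.

Let mfin : (m setT < +oo)%E.
Proof. by rewrite probability_setT ltry. Qed.

Lemma generic_rmean (f : X -> R) : continuous f ->
  rmean (fun t => f (act t p)) (\int[m]_x (f : borel X -> R) x).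
Proof. by move=> /ccontinuous_real /gen_m /has_meanP[]. Qed.

Lemma generic_inner (f g : X -> R[i]) : ccontinuous f -> ccontinuous g ->
  has_mean mu B (fun t => f (act t p) * (g (act t p))^*%C)
    (inner m (f : borel X -> R[i]) (g : borel X -> R[i])).
Proof. by move=> fc gc; have := gen_m (ccontinuousM_conj fc gc). Qed.

Lemma generic_unique (m' : probability (borel X) R) : generic act m' mu B p ->
  forall A : set (borel X), measurable A -> m' A = m A.
Proof.
move=> gen'; apply: (borel_measure_unique cX mX) => //.
  by apply: (le_lt_trans (probability_le1 m' _)); rewrite ?ltry.
move=> f fc; apply: rmean_unique (generic_rmean fc).
by have /has_meanP[] := gen' _ (ccontinuous_real fc).
Qed.

(** On C(X) this is translation invariance of means, as f (t (s p)) = f ((t + s) p); uniqueness of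
    Borel measures does the rest. *)
Lemma generic_invariant : invariant_measure act m.
Proof.
move=> t A mA.
pose mt := image_measure m (measurable_act t).
apply: (borel_measure_unique (nu1 := mt) cX mX) => //.
move=> f fc; have fac := @continuous_fun_act t f fc.
transitivity (\int[m]_x (f (act t x))).
  congr fine.
  rewrite (integral_pushforward (measurable_act t))//.
  - by apply/measurable_EFinP; exact: continuous_borel_measurable.
  - exact: (continuous_integrable cX mfin fac).
apply: rmean_unique (generic_rmean fac) _.
have := rmean_translate t (orbit_rbounded fc) (generic_rmean fc).
by congr rmean; apply/funext => s; rewrite actD.
Qed.

(* The measures attached to the weights 1 + u and 1 - u add up to 2m, so the
   first one has a bounded density with respect to m. *)
Lemma orbit_density (u : G -> R) : rtrig u -> (forall t, `|u t| <= 1) ->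
  exists r : borel X -> R, [/\ measurable_fun setT r, forall x, `|r x| <= 1 &
    forall f : X -> R, continuous f ->
      rmean (fun t => f (act t p) * u t) (\int[m]_x ((f : borel X -> R) x * r x))].
Proof.
move=> tu u1.
have [nu [nufin nuP]] : exists nu : {measure set (borel X) -> \bar R},
    (nu setT < +oo)%E /\ forall f : X -> R, continuous f ->
    rmean (fun t => f (act t p) * (1 + u t)) (\int[nu]_x (f : borel X -> R) x).
  apply: orbit_measure; first by apply: rtrigD => //; exact: rtrig_cst.
  by move=> t; have := u1 t; rewrite ler_norml; lra.
have [nu' [nu'fin nu'P]] : exists nu : {measure set (borel X) -> \bar R},
    (nu setT < +oo)%E /\ forall f : X -> R, continuous f ->
    rmean (fun t => f (act t p) * (1 - u t)) (\int[nu]_x (f : borel X -> R) x).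
  apply: orbit_measure; first by apply: rtrigB => //; exact: rtrig_cst.
  by move=> t; have := u1 t; rewrite ler_norml; lra.
have bu := rtrig_rbounded tu.
have addfin (n1 n2 : {measure set (borel X) -> \bar R}) : (n1 setT < +oo)%E ->
    (n2 setT < +oo)%E -> (measure_add n1 n2 setT < +oo)%E.
  by move=> *; rewrite measure_addE lte_add_pinfty.
have addint (n1 n2 : {measure set (borel X) -> \bar R}) (f : X -> R) :
    (n1 setT < +oo)%E -> (n2 setT < +oo)%E -> continuous f ->
    \int[measure_add n1 n2]_x (f : borel X -> R) x =
    \int[n1]_x (f : borel X -> R) x + \int[n2]_x (f : borel X -> R) x.
  move=> fin1 fin2 fc; rewrite /Rintegral integral_measure_add//.
  - rewrite fineD//; apply: integrable_fin_num => //; exact: continuous_integrable.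
  - exact: (continuous_integrable cX fin1 fc).
  - exact: (continuous_integrable cX fin2 fc).
have sum2m (A : set (borel X)) : measurable A -> (nu A + nu' A = m A + m A)%E.
  move=> mA; rewrite -!measure_addE.
  apply: (borel_measure_unique cX mX) => //; try exact: addfin.
  move=> f fc; rewrite !addint//.
  have bf := orbit_rbounded fc.
  apply: (@rmean_unique (fun t => f (act t p) + f (act t p))).
    have := rmeanD (rboundedM bf (rboundedD (rbounded_cst 1) bu))
      (rboundedM bf (rboundedB (rbounded_cst 1) bu)) (nuP _ fc) (nu'P _ fc).
    by congr rmean; apply/funext => t; ring.
  by apply: rmeanD => //; exact: generic_rmean.
have nu2m (A : set (borel X)) : measurable A -> (nu A <= 2%:E * m A)%E.
  move=> mA; rewrite (_ : 2 = 1 + 1 :> R); last by [].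
  by rewrite EFinD ge0_muleDl// mul1e -sum2m// leeDl.
have [rho [mrho rho2 rhoP]] := dominated_density mfin (ler0n _ 2) nu2m.
(* rho is the density for the weight 1 + u and lies in [0, 2]; subtracting the density 1 of m leaves
   the weight u and the bound 1. *)
exists (fun x => rho x - 1); split.
- by apply: measurable_funB.
- by move=> x; have := rho2 x; rewrite ler_norml; lra.
move=> f fc; have [M fM] := continuous_fun_bounded cX fc.
have bf := orbit_rbounded fc.
have mf := continuous_borel_measurable fc.
rewrite (_ : \int[m]_x _ = \int[nu]_x (f : borel X -> R) x - \int[m]_x (f : borel X -> R) x).
  have := rmeanD (rboundedM bf (rboundedD (rbounded_cst 1) bu)) (rboundedZ (-1) bf)
    (nuP _ fc) (rmeanZ (c := -1) bf (generic_rmean fc)).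
  by rewrite mulN1r; congr rmean; apply/funext => t; ring.
rewrite (rhoP _ M)// -RintegralB//.
- by apply: eq_Rintegral => x _; ring.
- apply: (bounded_integrable (M := M * 2)) => //; first exact: measurable_funM.
  move=> x _; rewrite normrM ler_pM//.
  by have := rho2 x; rewrite ler_norml; lra.
- exact: (continuous_integrable cX mfin fc).
Qed.

(** e = r1 + i r2, with r1 and r2 the densities for the weights Re xi and Im xi, both bounded by
    |xi| = 1. The pointwise bound is kept because it puts e in L^2. *)
Lemma orbit_eigenfunction_ex xi : dual xi -> exists e : borel X -> R[i],
  [/\ cmeasurable e, exists M, forall x, cmodulus (e x) <= M &
    forall f : X -> R[i], ccontinuous f ->
      has_mean mu B (fun t => f (act t p) * (xi t)^*%C)
        (inner m (f : borel X -> R[i]) e)].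
Proof.
move=> dxi; have [_ xi1 _] := dxi; have txi := trigpoly_dual dxi.
have [r1 [mr1 r11 r1P]] : exists r : borel X -> R, [/\ measurable_fun setT r,
    forall x, `|r x| <= 1 & forall f : X -> R, continuous f ->
      rmean (fun t => f (act t p) * Re (xi t)) (\int[m]_x ((f : borel X -> R) x * r x))].
  by apply: orbit_density => [|t]; [exact: rtrig_Re|rewrite -(xi1 t) normr_Re_le].
have [r2 [mr2 r21 r2P]] : exists r : borel X -> R, [/\ measurable_fun setT r,
    forall x, `|r x| <= 1 & forall f : X -> R, continuous f ->
      rmean (fun t => f (act t p) * Im (xi t)) (\int[m]_x ((f : borel X -> R) x * r x))].
  by apply: orbit_density => [|t]; [exact: rtrig_Im|rewrite -(xi1 t) normr_Im_le].
exists (fun x => Complex (r1 x) (r2 x)); split.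
- by split.
- by exists (1 + 1) => x; apply: le_trans (cmodulus_le _) _ => /=; exact: lerD (r11 x) (r21 x).
move=> f /ccontinuousP[rc ic].
have /bmP[bx1 bx2] := dual_bm dxi.
have br := orbit_rbounded rc; have bi := orbit_rbounded ic.
have ifr (g : X -> R) (r : borel X -> R) : continuous g -> measurable_fun setT r ->
    (forall x, `|r x| <= 1) ->
    m.-integrable setT (EFin \o (fun x => (g : borel X -> R) x * r x)).
  move=> gc mr r1'; have [M gM] := continuous_fun_bounded cX gc.
  apply: (bounded_integrable (M := M * 1)) => //.
    by apply: measurable_funM => //; exact: continuous_borel_measurable.
  by move=> x _; rewrite normrM ler_pM.
apply/has_meanP; split.
  have -> : Re (inner m (f : borel X -> R[i]) (fun x => Complex (r1 x) (r2 x))) =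
      \int[m]_x (Re (f x) * r1 x) + \int[m]_x (Im (f x) * r2 x).
    rewrite -RintegralD//; [|exact: ifr rc mr1 r11|exact: ifr ic mr2 r21].
    by apply: eq_Rintegral => x _; rewrite ReM /=; ring.
  have := rmeanD (rboundedM br bx1) (rboundedM bi bx2) (r1P _ rc) (r2P _ ic).
  by congr rmean; apply/funext => t; rewrite ReM Re_conj Im_conj mulrN opprK.
have -> : Im (inner m (f : borel X -> R[i]) (fun x => Complex (r1 x) (r2 x))) =
    \int[m]_x (Im (f x) * r1 x) - \int[m]_x (Re (f x) * r2 x).
  rewrite -RintegralB//; [|exact: ifr ic mr1 r11|exact: ifr rc mr2 r21].
  by apply: eq_Rintegral => x _; rewrite ImM /=; ring.
have := rmeanD (rboundedM bi bx1) (rboundedZ (-1) (rboundedM br bx2)) (r1P _ ic)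
  (rmeanZ (c := -1) (rboundedM br bx2) (r2P _ rc)).
by rewrite mulN1r; congr rmean; apply/funext => t; rewrite ImM Re_conj Im_conj; ring.
Qed.

(** * Eigenfunctions *)

(** One representative is fixed for each character, so that the orthonormal family can be the image
    of the frequencies under [e]. *)
Variable e : (G -> R[i]) -> borel X -> R[i].
Hypothesis eP : forall xi, dual xi ->
  [/\ cmeasurable (e xi), exists M, forall x, cmodulus (e xi x) <= M &
    forall f : X -> R[i], ccontinuous f ->
      has_mean mu B (fun t => f (act t p) * (xi t)^*%C)
        (inner m (f : borel X -> R[i]) (e xi))].

Local Notation F := (Freq act mu B p).

Lemma e_L2 xi : dual xi -> L2 m (e xi).
Proof. by move=> /eP[me [M eM] _]; exact: L2_bounded mfin me eM. Qed.

Lemma e_mean xi (f : X -> R[i]) : dual xi -> ccontinuous f ->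
  has_mean mu B (fun t => f (act t p) * (xi t)^*%C)
    (inner m (f : borel X -> R[i]) (e xi)).
Proof. by move=> /eP[_ _]; apply. Qed.

Lemma cmeasurable_act t (g : borel X -> R[i]) : cmeasurable g ->
  cmeasurable (fun x : borel X => g (act t x)).
Proof.
move=> [rg ig]; split.
  exact: (measurableT_comp rg (measurable_act t)).
exact: (measurableT_comp ig (measurable_act t)).
Qed.

Lemma invariant_ge0_integral t (g : borel X -> \bar R) : measurable_fun setT g ->
  (forall x, 0 <= g x)%E -> (\int[m]_x g (act t x) = \int[m]_x g x)%E.
Proof.
move=> mg g0.
rewrite -(@ge0_integral_pushforward _ _ _ _ R _ (measurable_act t) m setT g)//.
apply: (@eq_measure_integral _ _ _ _ m (image_measure m (measurable_act t))) => A mA _.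
exact: generic_invariant.
Qed.

Lemma invariant_Rintegral t (g : borel X -> R) : measurable_fun setT g ->
  m.-integrable setT (EFin \o g) ->
  \int[m]_x g (act t x) = \int[m]_x g x.
Proof.
move=> mg ig; have mEg : measurable_fun setT (EFin \o g) by exact/measurable_EFinP.
congr fine; transitivity (\int[image_measure m (measurable_act t)]_x (g x)%:E)%E.
  rewrite (integral_pushforward (measurable_act t) mEg)//.
  apply/integrableP; split.
    exact: (measurableT_comp mEg (measurable_act t)).
  rewrite (@invariant_ge0_integral t (fun x => `|g x|%:E))//.
    by case/integrableP: ig.
  by apply/measurable_EFinP; exact: measurableT_comp.
apply: (@eq_measure_integral _ _ _ _ m (image_measure m (measurable_act t))) => A mA _.
exact: generic_invariant.
Qed.

Lemma L2_act t (g : borel X -> R[i]) : L2 m g -> L2 m (fun x : borel X => g (act t x)).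
Proof.
move=> [mg lty]; split; first exact: cmeasurable_act.
rewrite (@invariant_ge0_integral t (fun x => (cmodulus (g x) ^+ 2)%:E))//.
  apply/measurable_EFinP; apply: measurable_funX; exact: cmeasurable_cmodulus.
by move=> x; rewrite lee_fin sqr_ge0.
Qed.

Lemma inner_act t (g h : borel X -> R[i]) : L2 m g -> L2 m h ->
  inner m (fun x : borel X => g (act t x)) (fun x : borel X => h (act t x)) = inner m g h.
Proof.
move=> Lg Lh; have [rgh igh] := inner_integrable Lg Lh.
have [mr mi] := cmeasurableM Lg.1 (cmeasurable_conj Lh.1).
apply: complex_ext.
  exact: (@invariant_Rintegral t (fun x => Re (g x * (h x)^*%C))).
exact: (@invariant_Rintegral t (fun x => Im (g x * (h x)^*%C))).
Qed.

Lemma ae_subr_eq0 (f g : borel X -> R[i]) :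
  {ae m, forall x, f x - g x = 0} -> {ae m, forall x, f x = g x}.
Proof. by move=> h; apply: filterS h => x /eqP; rewrite subr_eq0 => /eqP. Qed.

(** Tested against g, the translate of [e xi] gives the inner product of g(-t .) with [e xi], by
    invariance of m. This is the mean of g((s - t) p) times the conjugate of xi(s), and shifting s
    by t pulls out the conjugate of xi(t). *)
Lemma e_act xi t : dual xi -> {ae m, forall x, e xi (act t x) = xi t * e xi x}.
Proof.
move=> dxi; have [_ _ xiD] := dxi; have Le := e_L2 dxi.
have Let := L2_act t Le; have Lxe := L2Z (xi t) Le.
have : {ae m, forall x, e xi (act t x) - xi t * e xi x = 0}.
  apply: (orthogonal_continuous_eq0 cX mX mfin); first exact: L2B.
  move=> g gc; have Lg := ccontinuous_L2 cX mfin gc.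
  rewrite innerBr// innerZr//; apply/eqP; rewrite subr_eq0; apply/eqP.
  pose g' x := g (act (- t) x).
  have gc' : ccontinuous g' by exact: ccontinuous_act.
  have Lg' := ccontinuous_L2 cX mfin gc'.
  have -> : inner m (g : borel X -> R[i]) (fun x : borel X => e xi (act t x)) =
      inner m (g' : borel X -> R[i]) (e xi).
    rewrite -(inner_act t Lg' Le); congr inner; apply/funext => x.
    by rewrite /g' -actD addNr act0.
  apply: has_mean_unique (e_mean dxi gc') _.
  have bxi := bm_conj (dual_bm dxi).
  have := has_meanZ (c := (xi t)^*%C) (bmM (orbit_bm gc) bxi) (e_mean dxi gc).
  move=> /(has_mean_translate (- t) (bmZ _ (bmM (orbit_bm gc) bxi))).
  congr has_mean; apply/funext => s.
  rewrite /g' actD mulrCA -conjcM -xiD addrA subrr add0r//.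
exact: ae_subr_eq0.
Qed.

(** Translating both arguments multiplies the inner product by eta(t) times the conjugate of xi(t),
    which differs from 1 for some t. eta is an arbitrary function because members of [Eig] come
    without continuity or multiplicativity. *)
Lemma eigen_inner0 (eta : G -> R[i]) xi (g : borel X -> R[i]) : L2 m g ->
  (forall t, {ae m, forall x, g (act t x) = eta t * g x}) -> dual xi ->
  eta <> xi -> inner m g (e xi) = 0.
Proof.
move=> Lg geta dxi neq; have Le := e_L2 dxi.
have [t etat] : exists t, eta t <> xi t.
  apply: contrapT => H; apply: neq; apply/funext => t.
  by apply: contrapT => h; apply: H; exists t.
have h : inner m g (e xi) = (eta t * (xi t)^*%C) * inner m g (e xi).
  rewrite -[LHS](inner_act t Lg Le).
  rewrite (inner_ael (L2_act t Lg).1 (L2Z (eta t) Lg).1 (L2_act t Le).1 (geta t)).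
  rewrite innerZl//; last exact: L2_act.
  rewrite [inner m g _]inner_conj//; last exact: L2_act.
  rewrite (inner_ael (L2_act t Le).1 (L2Z (xi t) Le).1 Lg.1 (e_act t dxi)).
  by rewrite innerZl// conjcM mulrA -inner_conj.
apply: contrapT => /eqP i0; apply: etat.
have : eta t * (xi t)^*%C = 1.
  by apply: (mulIf i0); rewrite mul1r -h.
move=> /(congr1 (fun z => z * xi t)).
by rewrite -mulrA [_^*%C * _]mulrC dual_conjM// mulr1 mul1r.
Qed.

Lemma e_orthogonal xi eta : dual xi -> dual eta -> xi <> eta ->
  inner m (e xi) (e eta) = 0.
Proof.
move=> dxi deta; apply: eigen_inner0 => //; first exact: e_L2.
by move=> t; exact: e_act.
Qed.

Lemma e_notin_Freq xi : dual xi -> ~ F xi -> {ae m, forall x, e xi x = 0}.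
Proof.
move=> dxi nF; apply: (orthogonal_continuous_eq0 cX mX mfin); first exact: e_L2.
move=> g gc; apply: contrapT => h; apply: nF; split=> //.
by exists g, (inner m (g : borel X -> R[i]) (e xi)); split=> //; exact: e_mean.
Qed.

(** * Comparison of trigonometric polynomials with combinations of eigenfunctions *)

Definition e_span (h : borel X -> R[i]) := exists (k : nat)
  (b : 'I_k -> borel X -> R[i]) (c : 'I_k -> R[i]),
  (forall j, (e @` F) (b j)) /\ {ae m, forall x, h x = \sum_(j < k) c j * b j x}.

Lemma e_spanD h h' : e_span h -> e_span h' -> e_span (fun x => h x + h' x).
Proof.
move=> [k [b [c [bF hE]]]] [k' [b' [c' [bF' hE']]]].
exists (k + k')%N.
exists (fun j : 'I_(k + k') => match fintype.split j with inl i => b i | inr i => b' i end).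
exists (fun j : 'I_(k + k') => match fintype.split j with inl i => c i | inr i => c' i end).
split; first by move=> j; case: (fintype.split j).
apply: filterS2 hE hE' => x -> ->; rewrite big_split_ord /=; congr (_ + _).
  by apply: eq_bigr => i _; rewrite (unsplitK (inl i)).
by apply: eq_bigr => i _; rewrite (unsplitK (inr i)).
Qed.

(** Outside the frequencies [e xi] vanishes almost everywhere, so the empty combination serves; this
    is why [e_span] asks for equality almost everywhere only. *)
Lemma e_span_char (c : R[i]) xi : dual xi -> e_span (fun x => c * e xi x).
Proof.
move=> dxi; have [Fxi|nF] := pselect (F xi).
  exists 1%N, (fun=> e xi), (fun=> c); split; first by move=> _; exists xi.
  by apply: aeW => x; rewrite big_ord1.
exists 0%N, (fun=> e xi), (fun=> c); split; first by case.
by apply: filterS (e_notin_Freq dxi nF) => x ->; rewrite big_ord0 mulr0.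
Qed.

(* A trigonometric polynomial on G corresponds to the same combination of the
   eigenfunctions on X; the two agree when tested against C(X). *)
Lemma trigpoly_transfer Q : trigpoly Q -> exists q : borel X -> R[i],
  [/\ L2 m q, e_span q,
    forall g : X -> R[i], ccontinuous g ->
      has_mean mu B (fun t => Q t * (g (act t p))^*%C) (inner m q (g : borel X -> R[i])) &
    forall xi, dual xi -> exists c,
      has_mean mu B (fun t => Q t * (xi t)^*%C) c /\
      inner m q (e xi) = Complex (nsq m (e xi)) 0 * c].
Proof.
elim=> {Q} [c eta deta|Q Q' tQ [q [Lq sq qg qxi]] tQ' [q' [Lq' sq' qg' qxi']]].
  have Le := e_L2 deta; have beta := dual_bm deta.
  exists (fun x => c * e eta x); split.
  - exact: L2Z.
  - exact: e_span_char.
  - move=> g gc; have Lg := ccontinuous_L2 cX mfin gc.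
    rewrite innerZl// inner_conj//.
    have bg := orbit_bm gc.
    have := has_meanZ (c := c) (bm_conj (bmM bg (bm_conj beta)))
      (has_mean_conj (bmM bg (bm_conj beta)) (e_mean deta gc)).
    by congr has_mean; apply/funext => t; rewrite conjcM conjcK mulrA mulrAC.
  (* The Fourier coefficient c of Q at xi corresponds to c times [nsq m (e xi)] in L^2. The factor
     is still unknown here; comparing both sides determines it in [nsq_e]. *)
  - move=> xi dxi; have bxi := dual_bm dxi.
    have bex := bmM beta (bm_conj bxi).
    have [->|neq] := pselect (eta = xi).
      exists c; split; last by rewrite (innerZl _ (e_L2 dxi) (e_L2 dxi)) inner_selfE// mulrC.
      have := @has_mean_cst c; congr has_mean; apply/funext => t.
      by rewrite -mulrA dual_conjM// mulr1.
    exists 0; split; last by rewrite (innerZl _ (e_L2 deta) (e_L2 dxi)) e_orthogonal// !mulr0.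
    have ne1 : (fun t => eta t * (xi t)^*%C) <> (fun=> 1).
      move=> /(congr1 (fun f => fun t => f t * xi t)) h; apply: neq.
      apply/funext => t; have := congr1 (fun f => f t) h => /=.
      by rewrite -mulrA [_^*%C * _]mulrC dual_conjM// mulr1 mul1r.
    have := has_meanZ (c := c) bex (has_mean_char (dualM deta (dual_conj dxi)) ne1).
    by rewrite mulr0; congr has_mean; apply/funext => t; rewrite mulrA.
have bQ := trigpoly_bm tQ; have bQ' := trigpoly_bm tQ'.
exists (fun x => q x + q' x); split.
- exact: L2D.
- exact: e_spanD.
- move=> g gc; have bg := bm_conj (orbit_bm gc).
  rewrite innerDl//; last exact: ccontinuous_L2.
  have := has_meanD (bmM bQ bg) (bmM bQ' bg) (qg g gc) (qg' g gc).
  by congr has_mean; apply/funext => t; rewrite mulrDl.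
- move=> xi dxi; have bxi := bm_conj (dual_bm dxi).
  have [c [mc ic]] := qxi xi dxi; have [c' [mc' ic']] := qxi' xi dxi.
  exists (c + c'); split; last by rewrite innerDl ?ic ?ic' ?mulrDr//; exact: e_L2.
  have := has_meanD (bmM bQ bxi) (bmM bQ' bxi) mc mc'.
  by congr has_mean; apply/funext => t; rewrite mulrDl.
Qed.

Lemma has_mean_Re_le (h : G -> R[i]) (k : G -> R) a (c : R) : bm h -> rbounded k ->
  (forall t, Re (h t) <= k t) -> has_mean mu B h a ->
  (\forall n \near \oo, ravg n k < c) -> Re a <= c.
Proof.
move=> /bmP[bh _] bk hk /has_meanP[ha _] kc.
apply: (ler_cvg_to ha (@rmean_cst c)).
by apply: filterS kc => n kn; rewrite ravg_cst ltW// (le_lt_trans _ kn)// ravg_le.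
Qed.

(** Since q need not be continuous, the norm of u = f - q is not given by genericity. But 2 Re <u,g>
    - |g|^2 with g continuous is a mean along the orbit, of a function bounded pointwise by |f_p -
    Q|^2. *)
Lemma orbit_sq_approx (f : X -> R[i]) (eps : R) : ccontinuous f -> 0 < eps ->
  exists Q q, [/\ trigpoly Q,
    \forall n \near \oo, ravg n (fun t => cmodulus (f (act t p) - Q t) ^+ 2) < eps,
    [/\ L2 m q, e_span q & nsq m (fun x => (f : borel X -> R[i]) x - q x) <= eps] &
    forall xi, dual xi -> exists c,
      has_mean mu B (fun t => Q t * (xi t)^*%C) c /\
      inner m q (e xi) = Complex (nsq m (e xi)) 0 * c].
Proof.
move=> fc eps0; have bf := orbit_bm fc; have Lf := ccontinuous_L2 cX mfin fc.
have [Q [tQ hQ]] := besicovitch_ap_square (orbit_besicovitch_ap fc) eps0.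
have [q [Lq sq qg qxi]] := trigpoly_transfer tQ; have bQ := trigpoly_bm tQ.
exists Q, q; split=> //; split=> //.
have Lu := L2B Lf Lq; set u := (fun x => _) in Lu *.
apply/ler_addgt0Pr => d d0.
have [g [gc gd]] := L2_ccontinuous_dense cX mX mfin Lu d0.
have Lg := ccontinuous_L2 cX mfin gc; have bg := orbit_bm gc.
(* The left side equals |u|^2 - |u - g|^2, hence exceeds |u|^2 - d by the choice of g. *)
suff : 2 * Re (inner m u (g : borel X -> R[i])) - nsq m (g : borel X -> R[i]) <= eps.
  by rewrite nsqB// in gd; lra.
have bfQ := bmB bf bQ.
pose H t := Complex 2 0 * ((f (act t p) - Q t) * (g (act t p))^*%C) -
  g (act t p) * (g (act t p))^*%C.
have Hmean : has_mean mu B H (Complex 2 0 * inner m u (g : borel X -> R[i]) -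
    inner m (g : borel X -> R[i]) (g : borel X -> R[i])).
  apply: has_meanB.
  - by apply: bmZ; apply: bmM => //; exact: bm_conj.
  - by apply: bmM => //; exact: bm_conj.
  - apply: has_meanZ; first by apply: bmM => //; exact: bm_conj.
    rewrite /u innerBl//.
    have := has_meanB (bmM bf (bm_conj bg)) (bmM bQ (bm_conj bg))
      (generic_inner fc gc) (qg g gc).
    by congr has_mean; apply/funext => t; rewrite mulrBl.
  - exact: generic_inner.
have -> : 2 * Re (inner m u (g : borel X -> R[i])) - nsq m (g : borel X -> R[i]) =
    Re (Complex 2 0 * inner m u (g : borel X -> R[i]) -
      inner m (g : borel X -> R[i]) (g : borel X -> R[i])).
  by rewrite ReD ReN ReM mul0r subr0.
apply: (has_mean_Re_le _ _ _ Hmean hQ).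
- apply: bmB; first by apply: bmZ; apply: bmM => //; exact: bm_conj.
  by apply: bmM => //; exact: bm_conj.
- have := bm_cmodulus bfQ => b.
  by under eq_fun do rewrite expr2; exact: rboundedM.
- move=> t; rewrite /H; move: (f (act t p) - Q t) (g (act t p)) => a b.
  rewrite sqr_cmodulus !ReImE /=.
  have := sqr_ge0 (Re a - Re b); have := sqr_ge0 (Im a - Im b).
  by nra.
Qed.

Lemma cauchy_schwarz (u v : borel X -> R[i]) : L2 m u -> L2 m v ->
  cmodulus (inner m u v) ^+ 2 <= nsq m u * nsq m v.
Proof.
move=> Lu Lv; have [v0|] := eqVneq (nsq m v) 0.
  have vae := nsq_eq0 Lv v0.
  rewrite inner_conj// (inner_ael Lv.1 (@cmeasurable_cst R _ (borel X) 0) Lu.1 vae).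
  have -> : inner m (fun=> 0) u = 0.
    have := innerZl 0 Lu Lu; rewrite mul0r; under eq_fun do rewrite mul0r.
    by [].
  by rewrite conjc0 cmodulus0 expr0n /= v0 mulr0.
move=> v0; have vpos : 0 < nsq m v by rewrite lt0r v0 nsq_ge0.
(* The squared norm of |v|^2 u - <u,v> v equals |v|^2 (|u|^2 |v|^2 - |<u,v>|^2). *)
have := nsq_ge0 (L2B (L2Z (Complex (nsq m v) 0) Lu) (L2Z (inner m u v) Lv)).
rewrite nsqB; [|exact: L2Z|exact: L2Z].
rewrite !nsqZ// innerZl//; last exact: L2Z.
rewrite innerZr//.
move: (inner m u v) (nsq m v) (nsq m u) vpos => [x y] a N a0; rewrite !sqr_cmodulus /= => h.
rewrite -subr_ge0 -(pmulr_rge0 _ a0).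
by apply: le_trans h _; rewrite le_eqVlt; apply/orP; left; apply/eqP; ring.
Qed.

(** Let a = <f, e_xi> be nonzero, c the coefficient of Q at xi and k = |e_xi|^2. Then a is close to
    c, because Q is close to f_p, and to k c = <q, e_xi>, because q is close to f. In the limit a =
    k a. *)
Lemma nsq_e xi : F xi -> nsq m (e xi) = 1.
Proof.
move=> [dxi [f [a [fc fa a0]]]]; have Le := e_L2 dxi.
have ia : inner m (f : borel X -> R[i]) (e xi) = a.
  by apply: has_mean_unique (e_mean dxi fc) fa.
have Lf := ccontinuous_L2 cX mfin fc.
set k := nsq m (e xi); have k0 : 0 <= k by exact: nsq_ge0.
have key eps : 0 < eps -> exists c, cmodulus (a - c) ^+ 2 <= eps /\
    cmodulus (a - Complex k 0 * c) ^+ 2 <= eps * k.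
  move=> eps0.
  have [Q [q [tQ hQ [Lq _ fq] qxi]]] := orbit_sq_approx fc eps0.
  have [c [mc ic]] := qxi xi dxi; exists c; split; last first.
    rewrite -ic -ia -innerBl//; apply: le_trans (cauchy_schwarz (L2B Lf Lq) Le) _.
    by rewrite ler_wpM2r.
  have bf := orbit_bm fc; have bQ := trigpoly_bm tQ.
  have bxi := bm_conj (dual_bm dxi).
  set w := a - c.
  pose z t := (f (act t p) - Q t) * (xi t)^*%C.
  have bz : bm z by apply: bmM => //; exact: bmB.
  have zw : has_mean mu B z w.
    have := has_meanB (bmM bf bxi) (bmM bQ bxi) fa mc.
    by congr has_mean; apply/funext => t; rewrite /z mulrBl.
  (* Cauchy-Schwarz for means: the mean w of z satisfies |w|^2 <= mean of |z|^2, from 2 Re (conj(w)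
     z) - |w|^2 <= |z|^2. *)
  have Hmean : has_mean mu B (fun t => (2%:R * w^*%C) * z t - w * w^*%C)
      ((2%:R * w^*%C) * w - w * w^*%C).
    apply: has_meanB; [exact: bmZ|exact: bm_cst|exact: has_meanZ|exact: has_mean_cst].
  have -> : cmodulus w ^+ 2 = Re ((2%:R * w^*%C) * w - w * w^*%C).
    by rewrite sqr_cmodulus; case: w {zw Hmean} => x y /=; ring.
  apply: (has_mean_Re_le _ _ _ Hmean hQ).
  - by apply: bmB; [exact: bmZ|exact: bm_cst].
  - have b := bm_cmodulus (bmB bf bQ).
    by under eq_fun do rewrite expr2; exact: rboundedM.
  - move=> t; have -> : cmodulus (f (act t p) - Q t) = cmodulus (z t).
      by have [_ xi1 _] := dxi; rewrite /z cmodulusM cmodulus_conj xi1 mulr1.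
    rewrite sqr_cmodulus; move: (z t) w {zw Hmean} => [x y] [x' y'] /=.
    by have := sqr_ge0 (x - x'); have := sqr_ge0 (y - y'); nra.
have ak : cmodulus a ^+ 2 * (1 - k) ^+ 2 <= 0.
  apply/ler_addgt0Pr => eps eps0; rewrite add0r.
  (* With s = a - k c and r = a - c, a (1 - k) = s - k r, so its square is at most 2 |s|^2 + 2 k^2
     |r|^2 <= (2 k + 2 k^2) d when |s|^2 <= d k and |r|^2 <= d. The final 1 keeps the divisor
     positive. *)
  have K0 : 0 < 2 * k + 2 * k ^+ 2 + 1 by rewrite ltr_wpDl// addr_ge0// mulr_ge0// sqr_ge0.
  have [c [h1 h2]] := key _ (divr_gt0 eps0 K0).
  have -> : cmodulus a ^+ 2 * (1 - k) ^+ 2 = cmodulus (a - Complex k 0 * c - Complex k 0 * (a - c)) ^+ 2.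
    by rewrite !sqr_cmodulus; case: a c {h1 h2 key fa ia a0} => x y [x' y'] /=; ring.
  set s := a - Complex k 0 * c in h2 *; set r := a - c in h1 *.
  have : cmodulus (s - Complex k 0 * r) ^+ 2 <= 2 * cmodulus s ^+ 2 + 2 * k ^+ 2 * cmodulus r ^+ 2.
    rewrite !sqr_cmodulus; move: s r {h1 h2} => [x y] [x' y'] /=.
    by have := sqr_ge0 (x + k * x'); have := sqr_ge0 (y + k * y'); nra.
  move=> /le_trans; apply.
  set d := eps / _ in h1 h2.
  have d0 : 0 <= d by rewrite divr_ge0// ltW.
  have dE : eps = d * (2 * k + 2 * k ^+ 2 + 1) by rewrite /d divfK// gt_eqF.
  rewrite dE; have := sqr_ge0 k; move: (k ^+ 2) (cmodulus s ^+ 2) (cmodulus r ^+ 2) h1 h2.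
  by move=> k2 s2 r2 h1 h2 k20; nra.
have apos : 0 < cmodulus a ^+ 2.
  rewrite exprn_gt0// lt0r cmodulus_ge0 andbT; apply/eqP => /cmodulus_eq0.
  exact: a0.
move: ak; rewrite pmulr_rle0// => h.
have : (1 - k) ^+ 2 == 0 by rewrite eq_le h sqr_ge0.
by rewrite sqrf_eq0 subr_eq0 => /eqP.
Qed.

(** * Completeness of the eigenfunctions and its consequences *)

Lemma e_span_dense (f : borel X -> R[i]) (eps : R) : L2 m f -> 0 < eps ->
  exists (k : nat) (b : 'I_k -> borel X -> R[i]) (c : 'I_k -> R[i]),
    (forall j, (e @` F) (b j)) /\
    nsq m (fun x => f x - \sum_(j < k) c j * b j x) < eps.
Proof.
move=> Lf eps0; have eps4 : 0 < eps / 4 by rewrite divr_gt0.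
(* [nsq_triangle] doubles both errors, for a total below 3 eps / 4. *)
have eps8 : 0 < eps / 8 by rewrite divr_gt0.
have [g [gc fg]] := L2_ccontinuous_dense cX mX mfin Lf eps4.
have Lg := ccontinuous_L2 cX mfin gc.
have [Q [q [_ _ [Lq [k [b [c [bF qE]]]] gq] _]]] := orbit_sq_approx gc eps8.
exists k, b, c; split=> //.
have Lb : L2 m (fun x => \sum_(j < k) c j * b j x).
  by apply: L2_sum => j; have [xi [dxi _] <-] := bF j; exact: e_L2.
have -> : nsq m (fun x => f x - \sum_(j < k) c j * b j x) = nsq m (fun x => f x - q x).
  have ae : {ae m, forall x, f x - \sum_(j < k) c j * b j x = f x - q x}.
    by apply: filterS qE => x ->.
  have L1 := L2B Lf Lb; have L2' := L2B Lf Lq.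
  rewrite /nsq (inner_ael L1.1 L2'.1 L1.1 ae) inner_conj//.
  by rewrite (inner_ael L1.1 L2'.1 L2'.1 ae) -inner_conj.
apply: le_lt_trans (nsq_triangle Lf Lg Lq) _; lra.
Qed.

(** Both the inclusion of [Eig] in the frequencies and ergodicity reduce to this. *)
Lemma e_orthogonal_eq0 (g : borel X -> R[i]) : L2 m g ->
  (forall xi, F xi -> inner m g (e xi) = 0) -> {ae m, forall x, g x = 0}.
Proof.
move=> Lg ge; apply: orthogonal_approx_eq0 => // eps eps0.
have [k [b [c [bF gb]]]] := e_span_dense Lg eps0.
have Lbj j : L2 m (b j) by have [xi [dxi _] <-] := bF j; exact: e_L2.
exists (fun x => \sum_(j < k) c j * b j x); split=> //; first exact: L2_sum.
rewrite inner_conj//; last exact: L2_sum.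
rewrite inner_suml// big1 ?conjc0// => j _.
have [xi Fxi <-] := bF j; have Le := e_L2 Fxi.1.
by rewrite inner_conj// ge// conjc0 mulr0.
Qed.

Lemma e_eigenfunction xi : F xi -> eigenfunction_for act m xi (e xi).
Proof.
move=> Fxi; have dxi := Fxi.1; have Le := e_L2 dxi.
split=> //; last by move=> t; exact: e_act.
move=> e0; have := nsq_e Fxi.
rewrite /nsq (inner_ael Le.1 (@cmeasurable_cst R _ (borel X) 0) Le.1 e0).
have -> : inner m (fun=> 0) (e xi) = 0.
  have := innerZl 0 Le Le; rewrite mul0r; under eq_fun do rewrite mul0r.
  by [].
by move=> /eqP; rewrite eq_sym oner_eq0.
Qed.

Lemma generic_pure_point : pure_point_spectrum act m.
Proof.
exists (e @` F); split; last by move=> _ [xi Fxi <-]; exists xi; exact: e_eigenfunction.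
split.
- by move=> _ [xi [dxi _] <-]; exact: e_L2.
- by move=> _ [xi Fxi <-]; rewrite inner_selfE nsq_e.
- move=> _ _ [xi Fxi <-] [eta Feta <-] neq.
  by apply: e_orthogonal; [exact: Fxi.1|exact: Feta.1|move=> xe; apply: neq; rewrite xe].
- move=> f Lf eps eps0.
  have [k [b [c [bF fb]]]] := e_span_dense Lf (exprn_gt0 2 eps0).
  exists k, b, c; split=> //; rewrite nsqE ?lte_fin//.
  apply: L2B => //; apply: L2_sum => j.
  by have [xi [dxi _] <-] := bF j; exact: e_L2.
Qed.

(** An eigenfunction whose eigenvalue is not a frequency is orthogonal to every [e xi] with xi a
    frequency, hence zero. *)
Lemma generic_Eig : Eig act m = F.
Proof.
apply/seteqP; split=> [eta [g [Lg g0 geta]]|xi Fxi]; last first.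
  by exists (e xi); exact: e_eigenfunction.
apply: contrapT => nF; apply: g0; apply: e_orthogonal_eq0 => // xi Fxi.
apply: (eigen_inner0 Lg geta Fxi.1) => exi.
by apply: nF; rewrite exi.
Qed.

Lemma e_one : {ae m, forall x, e (fun=> 1) x = 1}.
Proof.
have L1 : L2 m (fun _ : borel X => 1 : R[i]).
  apply: (L2_bounded mfin (cmeasurable_cst _ 1) (M := 1)).
  by move=> x; rewrite cmodulus1.
have Le := e_L2 dual_one.
have : {ae m, forall x, e (fun=> 1) x - 1 = 0}.
  apply: (orthogonal_continuous_eq0 cX mX mfin); first exact: L2B.
  move=> g gc; have Lg := ccontinuous_L2 cX mfin gc.
  rewrite innerBr//; apply/eqP; rewrite subr_eq0; apply/eqP.
  apply: has_mean_unique (e_mean dual_one gc) _.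
  exact: (generic_inner gc (@cst_continuous X R[i]^o (1 : R[i]))).
exact: ae_subr_eq0.
Qed.

(** h = 1_A - m(A) is invariant, thus orthogonal to [e xi] for xi <> 1, and it has integral 0, thus
    is orthogonal to e_1 = 1 as well. Hence h = 0 almost everywhere. *)
Lemma generic_ergodic : ergodic act m.
Proof.
move=> A mA Ainv.
have mAR : measurable_fun setT (\1_A : borel X -> R) by exact: measurable_indic.
pose h x : R[i] := Complex (\1_A x) 0 - Complex (fine (m A)) 0.
have Lh : L2 m h.
  apply: (L2_bounded (M := 1 + `|fine (m A)|)) => //.
    split; under eq_fun do rewrite ReImE /=; first exact: measurable_funB.
    by rewrite subr0; exact: measurable_cst.
  move=> x; apply: le_trans (cmodulusD _ _) _; rewrite cmodulusN !cmodulus_real.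
  by rewrite lerD2r indicE normr_nat; case: (_ \in _).
have hinv t : {ae m, forall x, h (act t x) = 1 * h x}.
  have mAt : measurable (act t @^-1` A : set (borel X)).
    by rewrite -[X in measurable X]setTI; exact: measurable_act.
  exists ((act t @^-1` A `\` A) `|` (A `\` act t @^-1` A)); split=> //.
    by apply: measurableU; exact: measurableD.
  move=> x /= hx; apply: contrapT => nx; apply: hx; rewrite mul1r /h !indicE.
  case: (pselect (A (act t x))) => At; case: (pselect (A x)) => Ax.
  - by rewrite !mem_set.
  - by exfalso; apply: nx; left.
  - by exfalso; apply: nx; right.
  - by rewrite !memNset.
have h0 : {ae m, forall x, h x = 0}.
  apply: e_orthogonal_eq0 => // xi Fxi; have dxi := Fxi.1.
  have [xi1|neq] := pselect ((fun=> 1) = xi); last exact: (eigen_inner0 Lh hinv dxi neq).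
  rewrite -xi1.
  have L1 : L2 m (fun _ : borel X => 1 : R[i]).
    apply: (L2_bounded mfin (cmeasurable_cst _ 1) (M := 1)).
    by move=> x; rewrite cmodulus1.
  rewrite inner_conj//; last exact: (e_L2 dual_one).
  rewrite (inner_ael (e_L2 dual_one).1 L1.1 Lh.1 e_one) -inner_conj//.
  have iA : m.-integrable setT (EFin \o (\1_A : borel X -> R)).
    by apply: integrable_indic.
  apply: complex_ext; rewrite /inner /cintegral /=.
    under eq_Rintegral do rewrite !(mulr0, mulr1, subr0, oppr0).
    rewrite RintegralB//; last exact: finite_measure_integrable_cst.
    rewrite Rintegral_cst// (_ : fine (m [set: borel X]) = 1); last exact: (congr1 fine (probability_setT m)).
    rewrite mulr1 /Rintegral integral_indic// setIT.
    by rewrite subrr.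
  under eq_Rintegral do rewrite !(mulr0, mulr1, subr0, oppr0, addr0, add0r).
  by rewrite Rintegral_cst// mul0r.
(* On A one has h = 1 - m(A); if m(A) is not 1, then A lies in the null set where h is nonzero. *)
have [mA1|mA1] := pselect (fine (m A) = 1).
  by right; rewrite -[m A]fineK ?mA1// fin_num_measure.
left; move: h0; rewrite /almost_everywhere => -[N [mN N0 hN]].
apply/eqP; rewrite eq_le measure_ge0 andbT -N0; apply: le_measure; rewrite ?inE//.
move=> x Ax; apply: hN => /= -[]; rewrite indicE mem_set// => /eqP.
by rewrite subr_eq0 => /eqP h1 _; apply: mA1; rewrite -h1.
Qed.

Lemma generic_eigenfunction_unique xi (e' : borel X -> R[i]) : dual xi -> L2 m e' ->
  (forall f : X -> R[i], ccontinuous f ->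
    has_mean mu B (fun t => f (act t p) * (xi t)^*%C)
      (inner m (f : borel X -> R[i]) e')) ->
  {ae m, forall x, e' x = e xi x}.
Proof.
move=> dxi Le' he'; have Le := e_L2 dxi.
have : {ae m, forall x, e' x - e xi x = 0}.
  apply: (orthogonal_continuous_eq0 cX mX mfin); first exact: L2B.
  move=> g gc; have Lg := ccontinuous_L2 cX mfin gc.
  rewrite innerBr//; apply/eqP; rewrite subr_eq0; apply/eqP.
  exact: has_mean_unique (he' g gc) (e_mean dxi gc).
exact: ae_subr_eq0.
Qed.

End HaarAverages.

Theorem theorem3p4 (R : realType) (G : topologicalZmodType) (X : ptopologicalType)
    (mu : {measure set (borel_group G) -> \bar R}) (act : G -> X -> X)
    (B : nat -> set G) (p : X)
    (hausdorffG : hausdorff_space G)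
    (locally_compactG : locally_compact [set: G])
    (sigma_compactG : sigma_compact G)
    (haar_mu : haar mu)
    (dynXG : dynamical_system R act)
    (folnerB : folner mu B)
    (bap_p : besicovitch_point act mu B p) :
  exists m : probability (borel X) R,
    [/\ [/\ invariant_measure act m, ergodic act m & generic act m mu B p],
        forall m' : probability (borel X) R,
          invariant_measure act m' -> ergodic act m' -> generic act m' mu B p ->
          forall A : set (borel X), measurable A -> m' A = m A,
        pure_point_spectrum act m,
        Eig act m = Freq act mu B p &
        forall xi : G -> R[i], Eig act m xi ->
          exists e : borel X -> R[i],
            [/\ eigenfunction_for act m xi e,
                forall f : X -> R[i], ccontinuous f ->
                  has_mean mu B (fun t => f (act t p) * (xi t)^*%C)
                    (cintegral m setT (fun x => f x * (e x)^*%C)) &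
                forall e' : borel X -> R[i], eigenfunction act m e' ->
                  (forall f : X -> R[i], ccontinuous f ->
                    has_mean mu B (fun t => f (act t p) * (xi t)^*%C)
                      (cintegral m setT (fun x => f x * (e' x)^*%C))) ->
                  {ae m, forall x, e' x = e x}]].
Proof.
have [m gen_m] := generic_measure_ex hausdorffG haar_mu folnerB dynXG bap_p.
have /choice[e eP] : forall xi, exists e : borel X -> R[i], dual xi ->
  [/\ cmeasurable e, exists M, forall x, cmodulus (e x) <= M &
    forall f : X -> R[i], ccontinuous f ->
      has_mean mu B (fun t => f (act t p) * (xi t)^*%C)
        (inner m (f : borel X -> R[i]) e)].
  (* Outside the dual the choice function takes the value 0; every later use of [e] is at a
     character. *)
  move=> xi; have [dxi|ndxi] := pselect (dual xi); last by exists (fun=> 0).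
  by have [e eP] := orbit_eigenfunction_ex hausdorffG haar_mu folnerB dynXG bap_p
    gen_m dxi; exists e.
have EigE := generic_Eig hausdorffG haar_mu folnerB dynXG bap_p gen_m eP.
exists m; split.
- split=> //.
    exact: (generic_invariant hausdorffG haar_mu folnerB dynXG bap_p gen_m).
  exact: (generic_ergodic hausdorffG haar_mu folnerB dynXG bap_p gen_m eP).
- by move=> m' _ _; exact: (generic_unique dynXG gen_m).
- exact: (generic_pure_point hausdorffG haar_mu folnerB dynXG bap_p gen_m eP).
- exact: EigE.
- rewrite EigE => xi Fxi; have dxi := Fxi.1; exists (e xi); split.
  + exact: (e_eigenfunction hausdorffG haar_mu folnerB dynXG bap_p gen_m eP).
  + by move=> f fc; have [_ _] := eP xi dxi; apply.
  + move=> e' [eta [Le' _ _]].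
    exact: (generic_eigenfunction_unique dynXG eP dxi Le').
Qed.
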